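(* Suppose $E$ is an admissible boundary point of the essential spectrum of $\tau_0$, with $u_0,v_0$ and $\alpha,\beta$ as in the definition of admissibility. Let $\mu,\nu\in\mathbb R$ and suppose that, as $x\to\infty$, $$\Delta q=\mu\frac{\beta'}{\alpha^2\beta^2}(1+o(1)),\qquad \Delta p=\nu\frac{\beta'}{\alpha^2\beta^2}(1+o(1)).$$ Then $\tau_1-E$ is relatively oscillatory with respect to $\tau_0-E$ if $$\inf_{\ell>0}\limsup_{x\to\infty}\frac1\ell\int_x^{x+\ell}\left(\mu\frac{u_0(t)^2}{\alpha(t)^2}+\nu\frac{(p_0(t)u_0'(t))^2}{\alpha(t)^2}\right)dt<-\frac14$$ and relatively nonoscillatory with respect to $\tau_0-E$ if $$\sup_{\ell>0}\liminf_{x\to\infty}\frac1\ell\int_x^{x+\ell}\left(\mu\frac{u_0(t)^2}{\alpha(t)^2}+\nu\frac{(p_0(t)u_0'(t))^2}{\alpha(t)^2}\right)dt>-\frac14 .$$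
   Context: Setting: $\tau_j=\frac1r\left(-\frac{d}{dx}p_j\frac{d}{dx}+q_j\right)$, $j=0,1$, on $(a,b)$ with $a\in\mathbb R$, $b=\infty$; the coefficients are real-valued with $p_j^{-1},q_j,r\in L^1_{loc}(a,b)$ and $p_j,r>0$. Standing assumptions: for both $\tau_j$ the endpoint $a$ is regular (i.e. $q_j,p_j^{-1},r$ are integrable near $a$) and $b$ is limit point (i.e. $(\tau_j-z)u=0$ has, up to multiples, at most one solution in $L^2(r\,dx)$ near $b$). $H_0$ is a self-adjoint operator in $L^2((a,b),r\,dx)$ associated with $\tau_0$ (separated boundary conditions); the essential spectrum of $\tau_0$ means that of $H_0$. $\Delta p=\frac1{p_0}-\frac1{p_1}$, $\Delta q=q_1-q_0$. Admissibility: a boundary point $E$ of the essential spectrum of $H_0$ is admissible if there are a minimal solution $u_0$ of $(\tau_0-E)u_0=0$ (i.e. a solution with minimal growth) and a second linearly independent solution $v_0$ of $(\tau_0-E)v_0=0$ with Wronskian $W(u_0,v_0)=u_0\,p_0v_0'-p_0u_0'\,v_0=1$ such that, as $x\to\infty$, $$\begin{pmatrix}u_0\\ p_0u_0'\end{pmatrix}=O(\alpha),\qquad \begin{pmatrix}v_0\\ p_0v_0'\end{pmatrix}-\beta\begin{pmatrix}u_0\\ p_0u_0'\end{pmatrix}=o(\alpha\beta)$$ for some weight functions $\alpha>0$ and $\beta$, with either $\beta>0$ everywhere or $\beta<0$ everywhere, where $\beta$ is absolutely continuous and $\rho=\frac{\beta'}{\beta}>0$ satisfies $\rho(x)=o(1)$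 and $\frac1\ell\int_0^\ell|\rho(x+t)-\rho(x)|\,dt=o(\rho(x))$ for every $\ell>0$. Relative oscillation: for a nontrivial solution $u_j$ of $\tau_ju_j=Eu_j$ define the Prüfer angle $\theta_j$ as the continuous function with $u_j=\rho_j\sin\theta_j$, $p_ju_j'=\rho_j\cos\theta_j$, $\rho_j>0$. Put $\Delta_{1,0}=\theta_1-\theta_0$ and $\#_{(c,d)}(u_0,u_1)=\lceil\Delta_{1,0}(d)/\pi\rceil-\lfloor\Delta_{1,0}(c)/\pi\rfloor-1$. Let $\underline{\#}(u_0,u_1)$ and $\overline{\#}(u_0,u_1)$ be the $\liminf$ and $\limsup$ of $\#_{(c,d)}(u_0,u_1)$ as $d\uparrow b$, $c\downarrow a$. $\tau_1-E$ is relatively nonoscillatory with respect to $\tau_0-E$ if $\underline{\#}(u_0,u_1)$ and $\overline{\#}(u_0,u_1)$ are finite for all nontrivial solutions $\tau_ju_j=Eu_j$, $j=0,1$, and relatively oscillatory if one of them is infinite for some such solutions (this does not depend on the solutions chosen). (In this paragraph $u_0$ denotes an arbitrary solution of $\tau_0u_0=Eu_0$.) *)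

(* Defs.v *)
From HB Require Import structures.
From mathcomp Require Import all_boot all_order all_algebra.
From mathcomp Require Import all_classical all_reals all_analysis.
From mathcomp Require Import complex.

Set Implicit Arguments.
Unset Strict Implicit.
Unset Printing Implicit Defensive.

Import Order.TTheory GRing.Theory Num.Theory.
Import numFieldNormedType.Exports.

Local Open Scope classical_set_scope.
Local Open Scope ring_scope.
Local Open Scope complex_scope.

(* Functions live on (a, +oo); they are total functions R -> R whose values
   at x <= a are never used.  Coefficients, densities of absolutely
   continuous functions, and whatever is built from them are only meaningful
   up to Lebesgue null sets, so statements about them are almost everywhere
   statements. *)

Section EssentialFilter.
Context {R : realType}.
Local Notation leb := (@lebesgue_measure R).

(* "For almost every sufficiently large x": the filter behind o(1) and o(.)
   as x -> oo for functions defined up to null sets. *)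
Definition ess_pinfty : set_system R :=
  [set A | exists X : R, {ae leb, forall x, X < x -> A x}].

Global Instance ess_pinfty_filter : Filter ess_pinfty.
Proof.
split=> [|A B [X AX] [Y BY]|A B AB [X AX]].
- by exists 0; apply: aeW.
- exists (Num.max X Y); have F := ae_filter_ringOfSetsType leb.
  apply: (@filterS2 _ _ F _ _ _ _ AX BY) => x Ax Bx.
  by rewrite gt_max => /andP[/Ax ? /Bx].
- exists X; have F := ae_filter_ringOfSetsType leb.
  by apply: (@filterS _ _ F _ _ _ AX) => x Ax /Ax/AB.
Qed.

Canonical ess_pinfty_filter_on := FilterType ess_pinfty ess_pinfty_filter.

Canonical pinfty_filter_on := FilterType (pinfty_nbhs R) _.

End EssentialFilter.

Section SturmLiouville.
Context {R : realType} (a : R).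
Local Notation leb := (@lebesgue_measure R).
Local Notation C := (R[i]).
Local Notation pinfty := (pinfty_nbhs R).
Implicit Types (p q r u pu v pv h th : R -> R) (f pf g : R -> C) (z : C).

(* u belongs to AC_loc(a, +oo) and u' = du almost everywhere: u is an
   indefinite integral of the locally integrable function du. *)
Definition ac_with_derivative u du : Prop :=
  locally_integrable `]a, +oo[ du /\
  forall x y, a < x -> x <= y -> u y - u x = \int[leb]_(t in `[x, y]) du t.

(* u belongs to the domain of the differential expression
   tau = 1/r (- d/dx p d/dx + q), with pu the absolutely continuous
   representative of p u', and tau u = h almost everywhere. *)
Definition is_tau p q r u pu h : Prop :=
  exists du dpu,
    [/\ ac_with_derivative u du,
        ac_with_derivative pu dpu,
        {ae leb, forall x, a < x -> p x * du x = pu x} &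
        {ae leb, forall x, a < x -> h x = (r x)^-1 * (- dpu x + q x * u x)}].

Definition solution p q r (E : R) u pu : Prop :=
  is_tau p q r u pu (fun x => E * u x).

Definition nontrivial u : Prop := exists2 x, a < x & u x != 0.

(* The coefficients being real, tau acts separately on real and imaginary
   parts. *)
Definition is_tauC p q r f pf g : Prop :=
  is_tau p q r (fun x => complex.Re (f x)) (fun x => complex.Re (pf x)) (fun x => complex.Re (g x)) /\
  is_tau p q r (fun x => complex.Im (f x)) (fun x => complex.Im (pf x)) (fun x => complex.Im (g x)).

Definition solutionC p q r z f pf : Prop :=
  is_tauC p q r f pf (fun x => z * f x).

Definition sqnormL2 r (D : set R) f : \bar R :=
  (\int[leb]_(x in D) (r x * (complex.Re (f x) ^+ 2 + complex.Im (f x) ^+ 2))%:E)%E.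

(* L^2(D, r dx) *)
Definition inL2 r (D : set R) f : Prop :=
  [/\ measurable_fun D (fun x => complex.Re (f x)),
      measurable_fun D (fun x => complex.Im (f x)) &
      (sqnormL2 r D f < +oo)%E].

Definition coefficients p q r : Prop :=
  [/\ locally_integrable `]a, +oo[ (fun x => (p x)^-1),
      locally_integrable `]a, +oo[ q,
      locally_integrable `]a, +oo[ r &
      {ae leb, forall x, a < x -> 0 < p x /\ 0 < r x}].

Definition regular_left p q r : Prop :=
  exists2 c, a < c &
    [/\ leb.-integrable `]a, c[ (fun x => ((p x)^-1)%:E),
        leb.-integrable `]a, c[ (EFin \o q) &
        leb.-integrable `]a, c[ (EFin \o r)].

Definition limit_point_right p q r : Prop :=
  forall z f1 pf1 f2 pf2,
    solutionC p q r z f1 pf1 -> solutionC p q r z f2 pf2 ->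
    (exists2 c, a < c & inL2 r `]c, +oo[ f1) ->
    (exists2 c, a < c & inL2 r `]c, +oo[ f2) ->
    exists k1 k2 : C, (k1, k2) != (0, 0) /\
      forall x, a < x -> k1 * f1 x + k2 * f2 x = 0.

Definition standing_assumptions p q r : Prop :=
  [/\ coefficients p q r, regular_left p q r & limit_point_right p q r].

Section SelfAdjointRealization.
Variables (p q r : R -> R) (gamma : R).

(* Graph of the self-adjoint operator H in L^2((a, +oo), r dx) given by tau
   and the boundary condition cos(gamma) f(a) - sin(gamma) (p f')(a) = 0;
   when a is regular and +oo is limit point, these are, for varying gamma,
   all the self-adjoint operators associated with tau. *)
Definition operator_graph f g : Prop :=
  inL2 r `]a, +oo[ f /\ inL2 r `]a, +oo[ g /\
  exists pf, [/\ is_tauC p q r f pf g,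
    cos gamma * complex.Re (f x) - sin gamma * complex.Re (pf x) @[x --> a^'+] --> 0 &
    cos gamma * complex.Im (f x) - sin gamma * complex.Im (pf x) @[x --> a^'+] --> 0].

Definition eigenfunction z f : Prop := operator_graph f (fun x => z * f x).

(* H - z is a bijection from the domain of H onto L^2 with bounded inverse. *)
Definition resolvent_set : set C := [set z |
  (forall f, eigenfunction z f -> forall x, a < x -> f x = 0) /\
  (exists K : R, forall g, inL2 r `]a, +oo[ g ->
     exists2 f, operator_graph f (fun x => z * f x + g x) &
       (sqnormL2 r `]a, +oo[ f <= K%:E * sqnormL2 r `]a, +oo[ g)%E)].

Definition spectrum : set C := ~` resolvent_set.

(* isolated points of the spectrum that are eigenvalues of finite
   multiplicity *)
Definition discrete_spectrum : set C := [set z |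
  [/\ spectrum z,
      exists2 e : R, 0 < e &
        forall z', z' != z -> `|z' - z| < e%:C -> ~ spectrum z',
      exists2 f, eigenfunction z f & exists2 x, a < x & f x != 0 &
      exists n (e : 'I_n -> R -> C), forall f, eigenfunction z f ->
        exists c : 'I_n -> C,
          forall x, a < x -> f x = \sum_(i < n) c i * e i x]].

(* The spectrum of a self-adjoint operator is real; the essential spectrum is
   taken as a subset of R so that its boundary is the boundary in R. *)
Definition essential_spectrum : set R :=
  [set E | (spectrum `\` discrete_spectrum) E%:C].

Definition boundary_point_of_essential_spectrum (E : R) : Prop :=
  (closure essential_spectrum `\` interior essential_spectrum) E.

End SelfAdjointRealization.

(* A solution of minimal growth at +oo: it is dominated by every nontrivial
   solution.  Growth is that of the pair (u, p u'), because u itself may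
   vanish at arbitrarily large points. *)
Definition minimal_solution p q r (E : R) u pu : Prop :=
  [/\ solution p q r E u pu, nontrivial u &
      forall v pv, solution p q r E v pv -> nontrivial v ->
        (fun x => (u x, pu x)) =O_pinfty (fun x => (v x, pv x))].

(* dbeta stands for beta', and dbeta / beta for rho. *)
Record admissible p q r (gamma E : R) u0 pu0 v0 pv0
    (alpha beta dbeta : R -> R) : Prop := Admissible {
  adm_boundary : boundary_point_of_essential_spectrum p q r gamma E;
  adm_minimal : minimal_solution p q r E u0 pu0;
  adm_solution : solution p q r E v0 pv0;
  adm_wronskian : forall x, a < x -> u0 x * pv0 x - pu0 x * v0 x = 1;
  adm_alpha_measurable : measurable_fun `]a, +oo[ alpha;
  adm_alpha_gt0 : forall x, a < x -> 0 < alpha x;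
  adm_beta_sign : (forall x, a < x -> 0 < beta x) \/
                  (forall x, a < x -> beta x < 0);
  adm_beta_ac : ac_with_derivative beta dbeta;
  adm_bigO : (fun x => (u0 x, pu0 x)) =O_pinfty alpha;
  adm_littleo : (fun x => (v0 x - beta x * u0 x, pv0 x - beta x * pu0 x))
                  =o_pinfty (fun x => alpha x * beta x);
  adm_rho_gt0 : {ae leb, forall x, a < x -> 0 < dbeta x / beta x};
  adm_rho_o1 : dbeta x / beta x @[x --> ess_pinfty] --> 0;
  adm_rho_average : forall l : R, 0 < l ->
    (fun x => l^-1 * \int[leb]_(t in `[0, l])
                       `|dbeta (x + t) / beta (x + t) - dbeta x / beta x|)
      =o_ess_pinfty (fun x => dbeta x / beta x)
}.

Definition prufer_angle u pu th : Prop :=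
  (forall x, a < x -> {for x, continuous th}) /\
  exists rad : R -> R, forall x, a < x ->
    [/\ 0 < rad x, u x = rad x * sin (th x) & pu x = rad x * cos (th x)].

(* #_(c,d)(u_0, u_1) in terms of Pruefer angles th0, th1 of u_0, u_1.  Each
   angle is determined up to a multiple of 2 pi, which does not affect it. *)
Definition weighted_zeros th0 th1 (c d : R) : int :=
  Num.ceil ((th1 d - th0 d) / pi) - Num.floor ((th1 c - th0 c) / pi) - 1.

Definition weighted_zerosE th0 th1 (cd : R * R) : \bar R :=
  ((weighted_zeros th0 th1 cd.1 cd.2)%:~R)%:E.

Definition liminf_zeros th0 th1 : \bar R :=
  limf_einf (weighted_zerosE th0 th1) (filter_prod a^'+ (pinfty_nbhs R)).

Definition limsup_zeros th0 th1 : \bar R :=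
  limf_esup (weighted_zerosE th0 th1) (filter_prod a^'+ (pinfty_nbhs R)).

Definition solution_with_angle p q r (E : R) u pu th : Prop :=
  [/\ solution p q r E u pu, nontrivial u & prufer_angle u pu th].

Definition relatively_nonoscillatory p0 q0 p1 q1 r (E : R) : Prop :=
  forall u0 pu0 th0 u1 pu1 th1,
    solution_with_angle p0 q0 r E u0 pu0 th0 ->
    solution_with_angle p1 q1 r E u1 pu1 th1 ->
    liminf_zeros th0 th1 \is a fin_num /\ limsup_zeros th0 th1 \is a fin_num.

Definition relatively_oscillatory p0 q0 p1 q1 r (E : R) : Prop :=
  exists u0 pu0 th0 u1 pu1 th1,
    [/\ solution_with_angle p0 q0 r E u0 pu0 th0,
        solution_with_angle p1 q1 r E u1 pu1 th1 &
        liminf_zeros th0 th1 \isn't a fin_num \/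
        limsup_zeros th0 th1 \isn't a fin_num].

End SturmLiouville.

(* f = g (1 + o(1)) as x -> oo *)
Definition asymptotic {R : realType} (f g : R -> R) : Prop :=
  exists2 e : R -> R, e x @[x --> ess_pinfty] --> (0 : R) &
    \forall x \near ess_pinfty, f x = g x * (1 + e x).

Definition running_average {R : realType} (F : R -> R) (l x : R) : R :=
  l^-1 * \int[@lebesgue_measure R]_(t in `[x, x + l]) F t.

Definition inf_limsup_average {R : realType} (F : R -> R) : \bar R :=
  ereal_inf [set limf_esup (fun x => (running_average F l x)%:E)
                   (pinfty_nbhs R) | l in [set l : R | 0 < l]].

Definition sup_liminf_average {R : realType} (F : R -> R) : \bar R :=
  ereal_sup [set limf_einf (fun x => (running_average F l x)%:E)
                   (pinfty_nbhs R) | l in [set l : R | 0 < l]].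

(* Main.v *)
Require Import Defs.
From HB Require Import structures.
From mathcomp Require Import all_boot all_order all_algebra.
From mathcomp Require Import all_classical all_reals all_analysis.
From mathcomp Require Import measurable_realfun.
From mathcomp Require Import ring lra.

(** Let y be a solution of the perturbed equation and write it in the basis u0, v0
    of solutions of the unperturbed one as y = c1 u0 + c2 v0.  The coefficient c2 is
    the Wronskian of u0 and y, so its zeros, with signs, are what the difference of
    the Pruefer angles counts.  Since v0 is beta u0 up to a small remainder, the
    natural coordinates are X = c1 + beta c2 and D = beta c2.  With rho = beta' / beta
    and F = mu (u0 / alpha)^2 + nu (p0 u0' / alpha)^2, variation of constants gives

      X' = rho D + o(rho),    D' = rho (D + F X) + o(rho)

    relative to |X| + |D|.  As rho tends to 0 and varies slowly, the bounded function F
    acts on this system only through its running average A over a window of length l: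
    subtracting a small multiple K X from D replaces F by A (averaging_corrector,
    sheared_near_system, averaged_system).  With L = D - (K + 1/2) X the system becomes
    X' = rho (L + X / 2), L' = rho (L / 2 + (1/4 + A) X), up to small errors.

    If A >= - 1/4 + 2 kappa, then (X L)' >= rho X L: the double cone X L > 0 is
    invariant, so the direction of (X, L) is finally trapped in a half-plane
    (system_trapped), c1 has a fixed sign where c2 vanishes, and the difference of
    the Pruefer angles is bounded at infinity (trapped_difference).  At the regular
    endpoint each Pruefer angle is bounded by itself (prufer_bounded_left), and other
    solutions of the unperturbed equation wind like u0 (same_equation_bounded).

    If A <= - 1/4 - 2 kappa, then X L' - L X' <= - kappa rho (X^2 + L^2): the direction
    rotates at least at the rate kappa rho (system_rotates).  The integral of rho
    diverges, for otherwise beta would converge to some k, the solution v0 - k u0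
    would be o(alpha), by minimality u0 too, and A would tend to 0.  So the angle is
    unbounded, and the difference of the Pruefer angles follows it
    (unbounded_difference), for u0 itself and any solution y of the perturbed
    equation; one exists by linear_system_solution.

    The equations hold almost everywhere only.  Their calculus rests on ac_intro, which
    recognises the density of a function from increments with quadratic error. *)

Set Implicit Arguments.
Unset Strict Implicit.
Unset Printing Implicit Defensive.

Import Order.TTheory GRing.Theory Num.Theory.
Import numFieldNormedType.Exports.

Local Open Scope classical_set_scope.
Local Open Scope ring_scope.

(** * Integrals over compact intervals *)

Section IntegralCalculus.
Context {R : realType}.
Local Notation leb := (@lebesgue_measure R).
Implicit Types (a x y z : R) (f g h : R -> R).

Lemma ae_imply (P Q : R -> Prop) :
  (forall x, P x -> Q x) -> {ae leb, forall x, P x} -> {ae leb, forall x, Q x}.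
Proof.
have F := ae_filter_ringOfSetsType leb.
exact: (@filterS _ _ F).
Qed.

Lemma ae_imply2 (P P' Q : R -> Prop) :
  (forall x, P x -> P' x -> Q x) ->
  {ae leb, forall x, P x} -> {ae leb, forall x, P' x} -> {ae leb, forall x, Q x}.
Proof.
have F := ae_filter_ringOfSetsType leb.
exact: (@filterS2 _ _ F).
Qed.

Lemma locally_integrable_itv a f x y : locally_integrable `]a, +oo[ f ->
  a < x -> leb.-integrable `[x, y] (EFin \o f).
Proof.
move=> [mf _ If] ax; apply/integrableP; split; last first.
  apply: If; last exact: segment_compact.
  by move=> t /=; rewrite !in_itv/= andbT => /andP[xt _]; exact: lt_le_trans xt.
apply/measurable_EFinP; apply: measurable_funS mf => //.
by move=> t /=; rewrite !in_itv/= andbT => /andP[xt _]; exact: lt_le_trans xt.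
Qed.

Lemma locally_integrable_of_itv a f : measurable_fun `]a, +oo[ f ->
  (forall x y, a < x -> x <= y -> leb.-integrable `[x, y] (EFin \o f)) ->
  locally_integrable `]a, +oo[ f.
Proof.
move=> mf itvf; split => //.
move=> K Ka cK; have [->|K0] := eqVneq K set0.
  by rewrite integral_set0 ltry.
have K1 : K !=set0 by apply/set0P.
have cid : {within K, continuous (idfun : R -> R)}.
  by apply: continuous_subspaceT => t; exact: cvg_id.
have [d dK dmax] := compact_EVT_max K1 cK cid.
have [c cK' cmin] := compact_EVT_min K1 cK cid.
have ac : a < c by move: cK' => /set_mem/Ka /=; rewrite in_itv/= andbT.
have /integrableP[mcd] := itvf c d ac (dmax _ cK').
apply: le_lt_trans; apply: ge0_subset_integral => //=.
- exact: compact_measurable.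
- by do 2 apply: measurableT_comp => //; exact/measurable_EFinP.
- by move=> t tK /=; rewrite in_itv/= dmax ?cmin//; exact/mem_set.
Qed.

Lemma locally_integrable_sub a b f : a <= b ->
  locally_integrable `]a, +oo[ f -> locally_integrable `]b, +oo[ f.
Proof.
move=> ab lf; have [mf _ _] := lf; apply: locally_integrable_of_itv.
  apply: measurable_funS mf => // t /=.
  by rewrite !in_itv/= !andbT; exact: le_lt_trans.
by move=> x y bx _; apply: (locally_integrable_itv _ lf); exact: le_lt_trans bx.
Qed.

Lemma locally_integrable_mul a f g : locally_integrable `]a, +oo[ f ->
  measurable_fun `]a, +oo[ g ->
  (forall x y, a < x -> x <= y ->
     exists M, forall t, x <= t <= y -> `|g t| <= M) ->
  locally_integrable `]a, +oo[ (fun t => f t * g t).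
Proof.
move=> lf mg bg; have [mf _ _] := lf; apply: locally_integrable_of_itv.
  exact: measurable_funM.
move=> x y ax xy; have [M gM] := bg x y ax xy.
have := locally_integrable_itv y lf ax.
have sub : `[x, y]%classic `<=` `]a, +oo[%classic.
  by move=> t /=; rewrite !in_itv/= andbT => /andP[xt _]; exact: lt_le_trans xt.
move=> /(@integrableMl _ _ _ leb _ (measurable_itv _) _ g) ifg.
apply: ifg; first exact: measurable_funS mg.
exists M; split; first exact: num_real.
move=> N MN t /=; rewrite in_itv/= => txy.
by rewrite (le_trans (gM _ txy))// ltW.
Qed.

Lemma continuous_itv_bounded a g x y : (forall t, a < t -> {for t, continuous g}) ->
  a < x -> x <= y -> exists M, forall t, x <= t <= y -> `|g t| <= M.
Proof.
move=> cg ax xy.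
have cn : {within `[x, y], continuous (fun t => `|g t|)}.
  apply: continuous_in_subspaceT => t /set_mem /=; rewrite in_itv/= => /andP[xt _].
  apply: (@continuous_comp _ _ _ g Num.norm).
    by apply: cg; exact: lt_le_trans xt.
  exact: norm_continuous.
have [c _ cM] := EVT_max xy cn.
by exists `|g c| => t txy; apply: cM; rewrite in_itv.
Qed.

Lemma continuous_measurable_itv a g : (forall t, a < t -> {for t, continuous g}) ->
  measurable_fun `]a, +oo[ g.
Proof.
move=> cg; apply: subspace_continuous_measurable_fun => //.
by apply: continuous_in_subspaceT => t /set_mem /=; rewrite in_itv/= andbT => /cg.
Qed.

Lemma locally_integrable_mul_continuous a f g : locally_integrable `]a, +oo[ f ->
  (forall t, a < t -> {for t, continuous g}) ->
  locally_integrable `]a, +oo[ (fun t => f t * g t).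
Proof.
move=> lf cg; apply: locally_integrable_mul => //.
  exact: continuous_measurable_itv.
by move=> x y; exact: continuous_itv_bounded.
Qed.

Lemma locally_integrable_cst a (k : R) : locally_integrable `]a, +oo[ (fun=> k).
Proof.
apply: locally_integrable_of_itv => // x y ax xy.
apply: continuous_compact_integrable; first exact: segment_compact.
by apply: continuous_subspaceT => t; exact: cvg_cst.
Qed.

Lemma locally_integrable_continuous a g : (forall t, a < t -> {for t, continuous g}) ->
  locally_integrable `]a, +oo[ g.
Proof.
move=> cg; have := locally_integrable_mul_continuous (locally_integrable_cst a 1) cg.
by rewrite (_ : (fun t => 1 * g t) = g)//; apply/funext => t; rewrite mul1r.
Qed.

Lemma locally_integrable_norm a f : locally_integrable `]a, +oo[ f ->
  locally_integrable `]a, +oo[ (fun t => `|f t|).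
Proof.
move=> lf; have [mf _ _] := lf; apply: locally_integrable_of_itv.
  exact: measurableT_comp.
move=> x y ax xy; apply: integrable_norm.
exact: locally_integrable_itv ax.
Qed.

Lemma locally_integrable_scale a f (k : R) : locally_integrable `]a, +oo[ f ->
  locally_integrable `]a, +oo[ (fun t => k * f t).
Proof.
move=> lf; have := locally_integrable_mul_continuous lf (fun t _ => @cst_continuous _ _ k t).
by rewrite (_ : (fun t => f t * k) = fun t => k * f t)//; apply/funext => t; rewrite mulrC.
Qed.

Lemma locally_integrable_bounded a f g : locally_integrable `]a, +oo[ g ->
  measurable_fun `]a, +oo[ f ->
  (forall x, a < x -> `|f x| <= g x) -> locally_integrable `]a, +oo[ f.
Proof.
move=> lg mf fg; apply: locally_integrable_of_itv => // x y ax xy.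
have xya : `[x, y]%classic `<=` `]a, +oo[%classic.
  by move=> t /=; rewrite !in_itv/= andbT => /andP[xt _]; exact: lt_le_trans xt.
apply: le_integrable (locally_integrable_itv y lg ax) => //.
  by apply/measurable_EFinP; exact: measurable_funS mf.
move=> t txy /=; rewrite lee_fin (le_trans (fg _ _)) ?ler_norm//.
by have /xya := txy; rewrite /= in_itv/= andbT.
Qed.

Lemma ae_le_Rintegral (D : set (measurableTypeR R)) f g : measurable D ->
  leb.-integrable D (EFin \o f) -> leb.-integrable D (EFin \o g) ->
  {ae leb, forall t, D t -> f t <= g t} ->
  \int[leb]_(t in D) f t <= \int[leb]_(t in D) g t.
Proof.
move=> mD intf intg fg; rewrite -subr_ge0 -RintegralB//.
have intgf : leb.-integrable D (EFin \o (fun t => g t - f t)).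
  by have := integrableB mD intg intf; apply: eq_integrable.
suff -> : \int[leb]_(t in D) (g t - f t) = \int[leb]_(t in D) `|g t - f t|.
  exact: Rintegral_ge0.
congr fine; apply: ae_eq_integral => //.
- exact: (measurable_int leb).
- by apply: (measurable_int leb); exact: (integrable_norm intgf).
- move: fg; apply: ae_imply => t fg Dt.
  by rewrite ger0_norm// subr_ge0 fg.
Qed.

Lemma ae_eq_Rintegral (D : set (measurableTypeR R)) f g : measurable D ->
  leb.-integrable D (EFin \o f) -> leb.-integrable D (EFin \o g) ->
  {ae leb, forall t, D t -> f t = g t} ->
  \int[leb]_(t in D) f t = \int[leb]_(t in D) g t.
Proof.
move=> mD intf intg fg; apply/eqP; rewrite eq_le; apply/andP; split.
  by apply: ae_le_Rintegral => //; move: fg; apply: ae_imply => t + /[dup] => /[apply] ->.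
by apply: ae_le_Rintegral => //; move: fg; apply: ae_imply => t + /[dup] => /[apply] ->.
Qed.

Section Additivity.
Variables (a : R) (f g : R -> R).
Hypotheses (lf : locally_integrable `]a, +oo[ f) (lg : locally_integrable `]a, +oo[ g).

Lemma int_cat x y z : a < x -> x <= y -> y <= z ->
  \int[leb]_(t in `[x, z]) f t
  = \int[leb]_(t in `[x, y]) f t + \int[leb]_(t in `[y, z]) f t.
Proof.
move=> ax xy yz.
have ay : a < y by exact: lt_le_trans xy.
have := @Rintegral_itvB _ f (BLeft x) (BRight z) y (locally_integrable_itv z lf ax).
rewrite !bnd_simp => /(_ xy yz) => H.
rewrite -(@Rintegral_itv_obnd_cbnd _ y (BRight z)) -?H; first by ring.
apply: integrableS (locally_integrable_itv z lf ay) => //.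
exact: subset_itv_oc_cc.
Qed.

Lemma intD x y : a < x ->
  \int[leb]_(t in `[x, y]) (f t + g t)
  = \int[leb]_(t in `[x, y]) f t + \int[leb]_(t in `[x, y]) g t.
Proof. by move=> ax; rewrite RintegralD//; exact: (@locally_integrable_itv a). Qed.

Lemma intB x y : a < x ->
  \int[leb]_(t in `[x, y]) (f t - g t)
  = \int[leb]_(t in `[x, y]) f t - \int[leb]_(t in `[x, y]) g t.
Proof. by move=> ax; rewrite RintegralB//; exact: (@locally_integrable_itv a). Qed.

Lemma intZ (k : R) x y : a < x ->
  \int[leb]_(t in `[x, y]) (k * f t) = k * \int[leb]_(t in `[x, y]) f t.
Proof. by move=> ax; rewrite RintegralZl//; exact: (@locally_integrable_itv a). Qed.

Lemma int_le x y : a < x -> {ae leb, forall t, x <= t <= y -> f t <= g t} ->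
  \int[leb]_(t in `[x, y]) f t <= \int[leb]_(t in `[x, y]) g t.
Proof.
move=> ax fg; apply: ae_le_Rintegral => //; try exact: (@locally_integrable_itv a).
Qed.

Lemma int_norm_le x y : a < x ->
  `|\int[leb]_(t in `[x, y]) f t| <= \int[leb]_(t in `[x, y]) `|f t|.
Proof.
by move=> ax; apply: le_normr_Rintegral => //; exact: (@locally_integrable_itv a).
Qed.

Lemma int_eq x y : a < x -> {ae leb, forall t, x <= t <= y -> f t = g t} ->
  \int[leb]_(t in `[x, y]) f t = \int[leb]_(t in `[x, y]) g t.
Proof.
move=> ax fg; apply: ae_eq_Rintegral => //; try exact: (@locally_integrable_itv a).
Qed.

End Additivity.

Lemma int_cst (k x y : R) : x <= y -> \int[leb]_(t in `[x, y]) k = k * (y - x).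
Proof.
move=> xy; rewrite Rintegral_cst//= lebesgue_measure_itv/= lte_fin.
by move: xy; rewrite le_eqVlt => /predU1P[->|xy]; rewrite ?ltxx ?subrr// xy.
Qed.

Lemma int_point f x : \int[leb]_(t in `[x, x]) f t = 0.
Proof. by rewrite set_itv1 Rintegral_set1. Qed.

(** Signed, so that it is an antiderivative on both sides of x0. *)
Definition primitive (x0 : R) (f : R -> R) (x : R) : R :=
  if x0 <= x then \int[leb]_(t in `[x0, x]) f t
  else - \int[leb]_(t in `[x, x0]) f t.

Lemma primitive_ac a x0 f : a < x0 -> locally_integrable `]a, +oo[ f ->
  ac_with_derivative a (primitive x0 f) f.
Proof.
move=> ax0 lf; split => // x y ax xy; rewrite /primitive.
have [x0x|xx0] := leP x0 x.
  by rewrite (le_trans x0x xy) (@int_cat a _ lf x0 x y)//; ring.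
have [x0y|yx0] := leP x0 y.
  by rewrite (@int_cat a _ lf x x0 y)//; [ring|exact: ltW].
by rewrite (@int_cat a _ lf x y x0)//; [ring|exact: ltW].
Qed.

Lemma primitive_base x0 f : primitive x0 f x0 = 0.
Proof. by rewrite /primitive lexx int_point. Qed.

Lemma ac_continuous a u du : ac_with_derivative a u du ->
  forall x, a < x -> {for x, continuous u}.
Proof.
move=> [ldu udu] x ax.
pose c := (a + x) / 2; have ac : a < c by rewrite /c; lra.
have cx : c < x by rewrite /c; lra.
have cx1 : c <= x + 1 by lra.
have /continuous_within_itvP := @parameterized_integral_continuous R c (x + 1) du cx1
  (locally_integrable_itv (x + 1) ldu ac).
move=> /(_ _)[|+ _ _]; first by lra.
move=> /(_ x); rewrite in_itv/= cx/= ltrDl ltr01 => /(_ isT) cF.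
have E : \forall t \near x, u c + parameterized_integral leb c t du = u t.
  near=> t; rewrite /parameterized_integral -udu//; first by ring.
  by apply: ltW; near: t; exact: lt_nbhsr.
have /= Ex := nbhs_singleton E.
suff : u @ x --> u x by [].
rewrite -[X in _ --> X]Ex; apply: cvg_trans; first exact: (near_eq_cvg E).
by apply: cvgD => //; exact: cvg_cst.
Unshelve. all: by end_near. Qed.

End IntegralCalculus.


(** * Calculus of absolutely continuous functions *)

Section AbsolutelyContinuous.
Context {R : realType}.
Local Notation leb := (@lebesgue_measure R).
Implicit Types (a x y z : R) (f g h u v du dv : R -> R).

Lemma pow2_archimedean (e M : R) : (forall n, e * 2 ^+ n <= M) -> e <= 0.
Proof.
move=> Mn; rewrite leNgt; apply/negP => e0.
have /archi_boundP : 0 <= `|M / e| by [].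
set n := Num.bound _ => Mn1.
have := Mn n; rewrite mulrC -ler_pdivlMr// => hn.
have n2 : (n%:R : R) <= 2 ^+ n by rewrite -natrX ler_nat ltnW// ltn_expl.
have := lt_le_trans Mn1 n2; have := ler_norm (M / e); lra.
Qed.

(** The intermediate point z at which m is halfway between its values at x and y
    splits the increment of h into two, each bounded by a quarter of the bound
    for the whole; iterating, the increment is at most K (m y - m x)^2 / 2^n. *)
Lemma quadratic_increments_const h (m : R -> R) (c d K : R) : c <= d ->
  {within `[c, d], continuous m} ->
  (forall x y, c <= x -> x <= y -> y <= d ->
     m x <= m y /\ `|h y - h x| <= K * (m y - m x) ^+ 2) ->
  h c = h d.
Proof.
move=> cd cm H.
have step n : forall x y, c <= x -> x <= y -> y <= d ->
    `|h y - h x| <= K * (m y - m x) ^+ 2 / 2 ^+ n.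
  elim: n => [|n IH] x y cx xy yd.
    by rewrite expr0 divr1; have [] := H x y cx xy yd.
  have [mxy _] := H x y cx xy yd.
  have [z zxy mz] : exists2 z, z \in `[x, y] & m z = (m x + m y) / 2.
    apply: IVT => //.
      apply: continuous_subspaceW cm => t /=; rewrite !in_itv/= => /andP[xt ty].
      by rewrite (le_trans cx xt) (le_trans ty yd).
    by rewrite min_l// max_r//; apply/andP; split; lra.
  move: zxy; rewrite in_itv/= => /andP[xz zy].
  have h1 := IH x z cx xz (le_trans zy yd).
  have h2 := IH z y (le_trans cx xz) zy yd.
  have -> : h y - h x = (h y - h z) + (h z - h x) by ring.
  apply: (le_trans (ler_normD _ _)); apply: (le_trans (lerD h2 h1)).
  rewrite mz (exprS (2 : R) n) le_eqVlt; apply/orP; left; apply/eqP; field.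
  by rewrite expf_eq0/= pnatr_eq0 andbF.
apply/eqP/negPn/negP => hcd.
have e0 : 0 < `|h d - h c| by rewrite normr_gt0 subr_eq0 eq_sym.
set e := `|h d - h c| in e0; set M := K * (m d - m c) ^+ 2.
have Mn n : e * 2 ^+ n <= M.
  by rewrite -ler_pdivlMr ?exprn_gt0//; exact: step.
by have := pow2_archimedean Mn; rewrite leNgt e0.
Qed.

(** Replaces differentiation almost everywhere: f is a density of h as soon as the
    increments of h agree with the integrals of f up to a quadratic error, because
    h minus a primitive of f is then constant.  The rules of calculus below all
    follow from first order expansions. *)
Lemma ac_intro a h f g : locally_integrable `]a, +oo[ f ->
  locally_integrable `]a, +oo[ g -> (forall x, 0 <= g x) ->
  (forall c d, a < c -> c <= d -> exists K, forall x y, c <= x -> x <= y -> y <= d ->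
     `|h y - h x - \int[leb]_(t in `[x, y]) f t|
       <= K * (\int[leb]_(t in `[x, y]) g t) ^+ 2) ->
  ac_with_derivative a h f.
Proof.
move=> lf lg g0 H; split=> // c d ac cd.
have [K HK] := H c d ac cd.
have [_ pf] := primitive_ac ac lf; have [_ pg] := primitive_ac ac lg.
have cpg := ac_continuous (primitive_ac ac lg).
suff : h c - primitive c f c = h d - primitive c f d.
  by rewrite -(pf c d)// primitive_base; lra.
apply: (@quadratic_increments_const (fun x => h x - primitive c f x) (primitive c g) _ _ K) => //.
  apply: continuous_in_subspaceT => t /set_mem /=; rewrite in_itv/= => /andP[ct _].
  by apply: cpg; exact: lt_le_trans ct.
move=> x y cx xy yd; have ax : a < x by exact: lt_le_trans cx.
have E := pg x y ax xy; have Ef := pf x y ax xy.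
split; first by rewrite -subr_ge0 E Rintegral_ge0.
rewrite E; apply: le_trans (HK x y cx xy yd).
by rewrite le_eqVlt; apply/orP; left; apply/eqP; congr `|_|; rewrite -Ef; ring.
Qed.

Lemma ac_loc a u du : ac_with_derivative a u du -> locally_integrable `]a, +oo[ du.
Proof. by case. Qed.

Lemma ac_cst a (k : R) : ac_with_derivative a (fun=> k) (fun=> 0).
Proof.
split; first exact: locally_integrable_cst.
by move=> x y _ xy; rewrite int_cst// mul0r subrr.
Qed.

Lemma ac_add a u du v dv : ac_with_derivative a u du -> ac_with_derivative a v dv ->
  ac_with_derivative a (fun x => u x + v x) (fun x => du x + dv x).
Proof.
move=> [lu Hu] [lv Hv]; split; first exact: locally_integrableD.
by move=> x y ax xy; rewrite (intD lu lv)// -Hu// -Hv//; ring.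
Qed.

Lemma ac_scale a (k : R) u du : ac_with_derivative a u du ->
  ac_with_derivative a (fun x => k * u x) (fun x => k * du x).
Proof.
move=> [lu Hu]; split; first exact: locally_integrable_scale.
by move=> x y ax xy; rewrite (intZ lu)// -Hu//; ring.
Qed.

Lemma ac_sub a u du v dv : ac_with_derivative a u du -> ac_with_derivative a v dv ->
  ac_with_derivative a (fun x => u x - v x) (fun x => du x - dv x).
Proof.
move=> [lu Hu] [lv Hv]; split; first exact: locally_integrableB.
by move=> x y ax xy; rewrite (intB lu lv)// -Hu// -Hv//; ring.
Qed.

Lemma ac_restrict a b u du : a <= b -> ac_with_derivative a u du ->
  ac_with_derivative b u du.
Proof.
move=> ab [lu Hu]; split; first exact: locally_integrable_sub lu.
by move=> x y bx; apply: Hu; exact: le_lt_trans bx.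
Qed.

Lemma ac_ae a u du dv : ac_with_derivative a u du ->
  locally_integrable `]a, +oo[ dv -> {ae leb, forall x, a < x -> du x = dv x} ->
  ac_with_derivative a u dv.
Proof.
move=> [lu Hu] lv uv; split => // x y ax xy; rewrite Hu//.
apply: (int_eq lu lv) => //; move: uv; apply: ae_imply => t + /andP[xt _].
by apply; exact: lt_le_trans xt.
Qed.

Lemma ac_increment_le a u du g x y : ac_with_derivative a u du ->
  locally_integrable `]a, +oo[ g -> (forall t, `|du t| <= g t) -> a < x -> x <= y ->
  `|u y - u x| <= \int[leb]_(t in `[x, y]) g t.
Proof.
move=> [lu Hu] lg ug ax xy; rewrite Hu//.
apply: (le_trans (int_norm_le lu y ax)).
apply: (int_le (locally_integrable_norm lu) lg) => //.
by apply: aeW => t _.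
Qed.

Lemma ac_increment_le_sub a u du g x y s t : ac_with_derivative a u du ->
  locally_integrable `]a, +oo[ g -> (forall t, `|du t| <= g t) -> a < x ->
  x <= s -> s <= t -> t <= y ->
  `|u t - u s| <= \int[leb]_(t in `[x, y]) g t.
Proof.
move=> hu lg ug ax xs st ty.
have g0 r : 0 <= g r by exact: le_trans (ug r).
apply: (le_trans (ac_increment_le hu lg ug (lt_le_trans ax xs) st)).
rewrite (int_cat lg ax xs (le_trans st ty)) (int_cat lg (lt_le_trans ax xs) st ty).
have := @Rintegral_ge0 _ _ _ leb `[x, s]%classic g (fun r _ => g0 r).
have := @Rintegral_ge0 _ _ _ leb `[t, y]%classic g (fun r _ => g0 r).
lra.
Qed.

(** Applied to k = u - u x, this bounds the cost of freezing the factor u of an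
    integrand f * u at its value u x. *)
Lemma int_mul_le a f g (k : R -> R) (e x y : R) : locally_integrable `]a, +oo[ f ->
  locally_integrable `]a, +oo[ g ->
  locally_integrable `]a, +oo[ (fun t => f t * k t) ->
  (forall t, `|f t| <= g t) -> a < x -> (forall t, x <= t <= y -> `|k t| <= e) ->
  `|\int[leb]_(t in `[x, y]) (f t * k t)| <= e * \int[leb]_(t in `[x, y]) g t.
Proof.
move=> lf lg lfk fg ax ke.
apply: (le_trans (int_norm_le lfk y ax)); rewrite -(intZ lg)//.
apply: (int_le (locally_integrable_norm lfk)) => //.
  exact: locally_integrable_scale.
apply: aeW => t xty; rewrite normrM mulrC ler_pM//; exact: ke.
Qed.

Lemma ac_mul a u du v dv : ac_with_derivative a u du -> ac_with_derivative a v dv ->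
  ac_with_derivative a (fun x => u x * v x) (fun x => du x * v x + dv x * u x).
Proof.
move=> hu hv; have cu := ac_continuous hu; have cv := ac_continuous hv.
have [lu Hu] := hu; have [lv Hv] := hv.
have luv := locally_integrable_mul_continuous lu cv.
have lvu := locally_integrable_mul_continuous lv cu.
have lg := locally_integrableD (locally_integrable_norm lu) (locally_integrable_norm lv).
have ug t : `|du t| <= `|du t| + `|dv t| by rewrite lerDl.
have vg t : `|dv t| <= `|du t| + `|dv t| by rewrite lerDr.
apply: (ac_intro (g := fun t => `|du t| + `|dv t|)) => //.
  exact: locally_integrableD luv lvu.
(* One quadratic error for each frozen factor and one for the product of the
   increments. *)
move=> c d ac cd; exists 3 => x y cx xy yd.
have ax : a < x by exact: lt_le_trans cx.
rewrite (intD luv lvu)//.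
set G := \int[leb]_(t in `[x, y]) (`|du t| + `|dv t|).
have lkf (k : R) f (w : R -> R) : locally_integrable `]a, +oo[ f ->
   (forall t, a < t -> {for t, continuous w}) ->
   locally_integrable `]a, +oo[ (fun t => f t * (w t - k)).
  move=> lf cw; apply: (locally_integrable_mul_continuous lf) => t at_.
  by apply: cvgB; [exact: cw|exact: cvg_cst].
have E (k : R) f w : locally_integrable `]a, +oo[ f ->
   (forall t, a < t -> {for t, continuous w}) ->
   \int[leb]_(t in `[x, y]) (f t * w t) =
   k * \int[leb]_(t in `[x, y]) f t + \int[leb]_(t in `[x, y]) (f t * (w t - k)).
  move=> lf cw; rewrite -(intZ lf)// -(intD (locally_integrable_scale k lf) (lkf k f w lf cw))//.
  by apply: eq_Rintegral => t _; ring.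
rewrite (E (v x) du v)// (E (u x) dv u)// -Hu// -Hv//.
have G0 : 0 <= G by apply: Rintegral_ge0 => t _; exact: addr_ge0.
have b1 : `|\int[leb]_(t in `[x, y]) (du t * (v t - v x))| <= G * G.
  apply: (int_mul_le lu lg) => //; first exact: lkf.
  by move=> t /andP[xt ty]; apply: (ac_increment_le_sub hv lg) => //.
have b2 : `|\int[leb]_(t in `[x, y]) (dv t * (u t - u x))| <= G * G.
  apply: (int_mul_le lv lg) => //; first exact: lkf.
  by move=> t /andP[xt ty]; apply: (ac_increment_le_sub hu lg) => //.
have b3 : `|(u y - u x) * (v y - v x)| <= G * G.
  rewrite normrM ler_pM//; first exact: (ac_increment_le hu lg ug ax xy).
  exact: (ac_increment_le hv lg vg ax xy).
set A := Rintegral _ _ _ in b1 *; set B := Rintegral _ _ _ in b2 *.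
rewrite (_ : _ - _ = (u y - u x) * (v y - v x) - A - B); last by ring.
rewrite (_ : 3 * G ^+ 2 = G * G + G * G + G * G); last by ring.
apply: (le_trans (ler_normB _ _)); apply: lerD => //.
by apply: (le_trans (ler_normB _ _)); apply: lerD.
Qed.

Lemma taylor1 (phi dphi ddphi : R -> R) (M K x y : R) :
  (forall t, is_derive t (1 : R) phi (dphi t)) ->
  (forall t, is_derive t (1 : R) dphi (ddphi t)) ->
  (forall t, `|t| <= M -> `|ddphi t| <= K) -> `|x| <= M -> `|y| <= M ->
  `|dphi y - dphi x| <= K * `|y - x| /\
  `|phi y - phi x - dphi x * (y - x)| <= K * (y - x) ^+ 2.
Proof.
move=> d1 d2 bK.
have cd1 : continuous phi.
  move=> t; apply: differentiable_continuous; apply/derivable1_diffP.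
  by have [] := d1 t.
have cd2 : continuous dphi.
  move=> t; apply: differentiable_continuous; apply/derivable1_diffP.
  by have [] := d2 t.
have mono x0 y0 : x0 <= y0 -> `|x0| <= M -> `|y0| <= M ->
    `|dphi y0 - dphi x0| <= K * `|y0 - x0|.
  move=> xy xM yM.
  have [t txy ->] := @MVT_segment _ dphi ddphi x0 y0 xy (fun t _ => d2 t)
     (continuous_subspaceT cd2).
  rewrite normrM ler_wpM2r// bK//; move: txy; rewrite in_itv/= => /andP[xt ty].
  by move: xM yM; rewrite !ler_norml => /andP[? ?] /andP[? ?]; apply/andP; split; lra.
have lip x0 y0 : `|x0| <= M -> `|y0| <= M -> `|dphi y0 - dphi x0| <= K * `|y0 - x0|.
  move=> xM yM; have [xy|/ltW yx] := leP x0 y0; first exact: mono.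
  by rewrite distrC (distrC y0); exact: mono.
move=> xM yM; split; first exact: lip.
have K0 : 0 <= K by apply: le_trans (bK _ xM).
have [t [tM txy ->]] : exists t, [/\ `|t| <= M, `|t - x| <= `|y - x| &
    phi y - phi x = dphi t * (y - x)].
  have [xy|/ltW yx] := leP x y.
    have [t + ->] := @MVT_segment _ phi dphi x y xy (fun t _ => d1 t)
     (continuous_subspaceT cd1).
    rewrite in_itv/= => /andP[xt ty]; exists t; split => //.
      by move: xM yM; rewrite !ler_norml => /andP[? ?] /andP[? ?]; apply/andP; split; lra.
    by rewrite !ger0_norm; lra.
  have [t + E] := @MVT_segment _ phi dphi y x yx (fun t _ => d1 t)
     (continuous_subspaceT cd1).
  rewrite in_itv/= => /andP[xt ty]; exists t; split => //.
  - by move: xM yM; rewrite !ler_norml => /andP[? ?] /andP[? ?]; apply/andP; split; lra.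
  - by rewrite !ler0_norm; lra.
  - by rewrite -(opprB (phi x)) E; ring.
rewrite -mulrBl normrM -(real_normK (num_real (y - x))) expr2 mulrA ler_wpM2r//.
by apply: (le_trans (lip x t xM tM)); rewrite ler_wpM2l.
Qed.

(** The outer function is C^2 so that its Taylor error is quadratic, as ac_intro
    requires. *)
Lemma ac_comp a u du (phi dphi ddphi : R -> R) : ac_with_derivative a u du ->
  (forall t, is_derive t (1 : R) phi (dphi t)) ->
  (forall t, is_derive t (1 : R) dphi (ddphi t)) -> continuous ddphi ->
  ac_with_derivative a (fun x => phi (u x)) (fun x => du x * dphi (u x)).
Proof.
move=> hu d1 d2 cd3; have cu := ac_continuous hu; have [lu Hu] := hu.
have cd2 : continuous dphi.
  move=> t; apply: differentiable_continuous; apply/derivable1_diffP.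
  by have [] := d2 t.
have cphiu t : a < t -> {for t, continuous (fun x => dphi (u x))}.
  by move=> at_; apply: (@continuous_comp _ _ _ u dphi); [exact: cu|exact: cd2].
have lup := locally_integrable_mul_continuous lu cphiu.
have lg := locally_integrable_norm lu.
have ug t : `|du t| <= `|du t| by [].
apply: (ac_intro (g := fun t => `|du t|)) => //.
move=> c d ac cd; have [M uM] := continuous_itv_bounded cu ac cd.
have M0 : 0 <= M by apply: le_trans (uM c _); rewrite ?lexx.
have [K bK] : exists K, forall t, `|t| <= M -> `|ddphi t| <= K.
  have MM : - M <= M by lra.
  have [K HK] := continuous_itv_bounded (a := - M - 1) (fun t _ => cd3 t)
    (ltac:(lra) : - M - 1 < - M) MM.
  by exists K => t; rewrite ler_norml => /HK.
have K0 : 0 <= K by apply: le_trans (bK 0 _); rewrite ?normr0.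
exists (2 * K) => x y cx xy yd.
have ax : a < x by exact: lt_le_trans cx.
set G := \int[leb]_(t in `[x, y]) `|du t|.
have G0 : 0 <= G by apply: Rintegral_ge0.
have uxM : `|u x| <= M by apply: uM; rewrite cx (le_trans xy).
have lkf : locally_integrable `]a, +oo[ (fun t => du t * (dphi (u t) - dphi (u x))).
  apply: (locally_integrable_mul_continuous lu) => t at_.
  by apply: cvgB; [exact: cphiu|exact: cvg_cst].
have -> : \int[leb]_(t in `[x, y]) (du t * dphi (u t)) =
   dphi (u x) * (u y - u x) + \int[leb]_(t in `[x, y]) (du t * (dphi (u t) - dphi (u x))).
  rewrite Hu// -(intZ lu)// -(intD (locally_integrable_scale (dphi (u x)) lu) lkf)//.
  by apply: eq_Rintegral => t _; ring.
have b1 : `|\int[leb]_(t in `[x, y]) (du t * (dphi (u t) - dphi (u x)))| <= K * G * G.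
  apply: (int_mul_le lu lg) => // t /andP[xt ty].
  have utM : `|u t| <= M by apply: uM; rewrite (le_trans cx xt) (le_trans ty yd).
  have [+ _] := taylor1 d1 d2 bK uxM utM; move/le_trans; apply.
  by rewrite ler_wpM2l//; apply: (ac_increment_le_sub hu lg).
have uyM : `|u y| <= M by apply: uM; rewrite (le_trans cx xy).
have [_ b2] := taylor1 d1 d2 bK uxM uyM.
have b3 : K * (u y - u x) ^+ 2 <= K * G * G.
  rewrite -mulrA ler_wpM2l// -real_normK ?num_real// expr2 ler_pM//;
    exact: (ac_increment_le hu lg).
set A := Rintegral _ _ _ in b1 *.
rewrite (_ : _ - _ = (phi (u y) - phi (u x) - dphi (u x) * (u y - u x)) - A); last by ring.
apply: (le_trans (ler_normB _ _)).
apply: (le_trans (lerD (le_trans b2 b3) b1)).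
by rewrite le_eqVlt; apply/orP; left; apply/eqP; ring.
Qed.

Lemma ac_sin a u du : ac_with_derivative a u du ->
  ac_with_derivative a (fun x => sin (u x)) (fun x => du x * cos (u x)).
Proof.
move=> hu; apply: (ac_comp (dphi := cos) (ddphi := fun x => - sin x) hu) => //.
by move=> t; apply: cvgN; exact: continuous_sin.
Qed.

Lemma ac_cos a u du : ac_with_derivative a u du ->
  ac_with_derivative a (fun x => cos (u x)) (fun x => du x * - sin (u x)).
Proof.
move=> hu; apply: (ac_comp (dphi := fun x => - sin x) (ddphi := fun x => - cos x) hu).
by move=> t; apply: cvgN; exact: continuous_cos.
Qed.

Lemma ac_expR a u du : ac_with_derivative a u du ->
  ac_with_derivative a (fun x => expR (u x)) (fun x => du x * expR (u x)).
Proof.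
move=> hu; apply: (ac_comp (dphi := expR) (ddphi := expR) hu) => //.
exact: continuous_expR.
Qed.

Lemma ac_const a u x y : ac_with_derivative a u (fun=> 0) -> a < x -> a < y -> u x = u y.
Proof.
move=> [_ H] ax ay; wlog xy : x y ax ay / x <= y.
  by move=> W; case/orP: (le_total x y) => [/W|/W/esym]; exact.
by have := H x y ax xy; rewrite int_cst// mul0r => /eqP; rewrite subr_eq0 => /eqP.
Qed.

(** The integrating factor expR (- L) turns u into a constant. *)
Lemma ac_linear a u du L lam : ac_with_derivative a u du ->
  ac_with_derivative a L lam -> {ae leb, forall x, a < x -> du x = lam x * u x} ->
  forall x y, a < x -> a < y -> expR (- L x) * u x = expR (- L y) * u y.
Proof.
move=> hu hL E x y ax ay.
have hNL := ac_scale (-1) hL; have he := ac_expR hNL.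
have hm := ac_mul he hu.
pose w t := expR (-1 * L t) * u t.
have : ac_with_derivative a w (fun=> 0).
  apply: (ac_ae hm); first exact: locally_integrable_cst.
  by move: E; apply: ae_imply => t + at_ => /(_ at_) ->; ring.
by move=> /ac_const /(_ ax ay); rewrite /w !mulN1r.
Qed.

Lemma ac_monotone a u du x y : ac_with_derivative a u du ->
  {ae leb, forall t, x <= t <= y -> 0 <= du t} -> a < x -> x <= y -> u x <= u y.
Proof.
move=> [lu Hu] d0 ax xy; rewrite -subr_ge0 Hu//.
rewrite (_ : 0 = \int[leb]_(t in `[x, y]) (0 : R)); last by rewrite int_cst// mul0r.
apply: (int_le (locally_integrable_cst a 0) lu) => //.
Qed.

End AbsolutelyContinuous.


(** * Translation of integrals *)

Section Translation.
Context {R : realType}.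
Local Notation leb := (@lebesgue_measure R).
Variable s : R.

Let shift (t : measurableTypeR R) : measurableTypeR R := t + s.

Let measurable_shift : measurable_fun setT shift.
Proof. by apply: measurable_funD. Qed.

Let shift_itv (b0 b1 : bool) (x y : R) :
  shift @^-1` [set` Interval (BSide b0 (x + s)) (BSide b1 (y + s))]
  = [set` Interval (BSide b0 x) (BSide b1 y)].
Proof.
by apply/seteqP; split => t /=; rewrite !in_itv/= /shift; case: b0 b1 => -[];
  rewrite /= ?lerD2r ?ltrD2r.
Qed.

Let lebesgue_measure_shift (A : set (measurableTypeR R)) : measurable A ->
  pushforward leb shift A = leb A.
Proof.
move=> mA; apply/esym/lebesgue_measure_unique => //= _ [[a b]] _ <-.
have := shift_itv false false (a - s) (b - s); rewrite !subrK => E.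
rewrite /pushforward E /=.
by rewrite !lebesgue_measure_itv/= !lte_fin ltrD2r -!EFinB; case: ifP => // _; congr EFin; ring.
Qed.

Let ge0_integral_shift (x y : R) (g : R -> \bar R) :
  measurable_fun `[x + s, y + s] g -> (forall t, (0 <= g t)%E) ->
  (\int[leb]_(t in `[(x + s)%R, (y + s)%R]) g t = \int[leb]_(t in `[x, y]) g (t + s)%R)%E.
Proof.
move=> mg g0; rewrite -(shift_itv true false) -ge0_integral_pushforward//=.
by apply: eq_measure_integral => //= A mA AS; exact/esym/lebesgue_measure_shift.
Qed.

Lemma int_shift_measurable (x y : R) (f : R -> R) :
  measurable_fun `[x + s, y + s] f ->
  measurable_fun `[x, y] (fun t => f (t + s)).
Proof.
move=> mf; apply: (measurable_comp (F := `[x + s, y + s]) _ _ mf) => //.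
- by move=> _ [t + <-] /=; rewrite !in_itv/= !lerD2r.
- by apply: measurable_funD.
Qed.

Lemma int_shift (x y : R) (f : R -> R) :
  measurable_fun `[x + s, y + s] f ->
  \int[leb]_(t in `[x + s, y + s]) f t = \int[leb]_(t in `[x, y]) f (t + s).
Proof.
move=> mf; congr fine; rewrite integralE [RHS]integralE.
have mF : measurable_fun `[x + s, y + s] (fun t => (f t)%:E) by exact/measurable_EFinP.
rewrite !ge0_integral_shift//.
- by rewrite !funepos.unlock !funeneg.unlock.
- exact: measurable_funeneg.
- exact: measurable_funepos.
Qed.

Lemma integrable_shift (x y : R) (f : R -> R) :
  leb.-integrable `[x + s, y + s] (EFin \o f) ->
  leb.-integrable `[x, y] (EFin \o (fun t => f (t + s))).
Proof.
move=> /integrableP[/measurable_EFinP mf foo]; apply/integrableP; split.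
  by apply/measurable_EFinP; exact: int_shift_measurable.
apply: le_lt_trans foo; rewrite (ge0_integral_shift (g := fun t => `|(f t)%:E|%E))//.
by apply/measurable_EFinP; exact: measurableT_comp.
Qed.

Lemma ac_shift (a : R) (u du : R -> R) : 0 <= s ->
  ac_with_derivative a u du ->
  ac_with_derivative a (fun x => u (x + s)) (fun x => du (x + s)).
Proof.
move=> s0 [lu Hu].
have aS x : a < x -> a < x + s by move=> ax; rewrite (lt_le_trans ax)// lerDl.
split; last first.
  move=> x y ax xy; rewrite Hu ?lerD2r ?aS// int_shift//.
  by have /integrableP[/measurable_EFinP] := locally_integrable_itv (y + s) lu (aS _ ax).
apply: locally_integrable_of_itv.
  have [mf _ _] := lu; apply: (measurable_comp (F := `]a, +oo[) _ _ mf) => //.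
  - move=> _ [t + <-] /=; rewrite !in_itv/= !andbT.
    by rewrite in_itv/= andbT; exact: aS.
  - by apply: measurable_funD.
move=> x y ax xy; apply: integrable_shift; exact: locally_integrable_itv lu (aS _ ax).
Qed.

End Translation.

(** * Polar angles of plane curves *)

Section Angles.
Context {R : realType}.
Local Notation leb := (@lebesgue_measure R).
Implicit Types (a x y : R) (f g h df dg : R -> R).

Lemma cosDint (t : R) (k : int) : cos (t + k%:~R * (pi *+ 2)) = cos t.
Proof.
have N (n : nat) (v : R) : cos (v + n%:R * (pi *+ 2)) = cos v.
  by rewrite mulr_natl; exact: (periodicn (@cosD2pi R)).
case: k => n; first by rewrite N.
by rewrite NegzE mulrNz mulNr -(N n.+1) subrK.
Qed.

(** An angle that avoids a residue class modulo 2 pi is confined, by the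
    intermediate value theorem, to one of the gaps between its members. *)
Lemma avoid_residue_bounded h (v x y : R) : x <= y ->
  (forall t, x <= t <= y -> {for t, continuous h}) ->
  (forall t, x <= t <= y -> cos (h t - v) != 1) ->
  `|h y - h x| <= pi *+ 2.
Proof.
move=> xy ch hv; rewrite leNgt; apply/negP => big.
have cw : {within `[x, y], continuous h}.
  by apply: continuous_in_subspaceT => t /set_mem /=; rewrite in_itv/=; exact: ch.
set m := Num.min (h x) (h y).
have pi2 : 0 < pi *+ 2 :> R by rewrite mulrn_wgt0// pi_gt0.
pose k := Num.floor ((m - v) / (pi *+ 2)) + 1.
have k1 : (m - v) / (pi *+ 2) < k%:~R.
  by rewrite /k; exact: floorD1_gt.
have k2 : k%:~R <= (m - v) / (pi *+ 2) + 1.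
  by rewrite /k intrD lerD2r; exact: floor_le.
rewrite ltr_pdivrMr// in k1.
rewrite -(lerD2r (-1)) addrK ler_pdivlMr// in k2.
have [t] : exists2 t, t \in `[x, y] & h t = v + k%:~R * (pi *+ 2).
  apply: IVT => //; rewrite -/m; apply/andP; split; first by lra.
  rewrite le_max; move: k2 big; rewrite /m; have [hxy|hyx] := leP (h x) (h y).
    by rewrite ger0_norm ?subr_ge0// => ? ?; apply/orP; right; lra.
  have hyx' := ltW hyx.
  by rewrite ler0_norm ?subr_le0// => ? ?; apply/orP; left; lra.
rewrite in_itv/= => /hv + ht.
by rewrite ht addrAC subrr cosDint cos0 eqxx.
Qed.

Lemma polar_angle (f g : R) : 0 < f ^+ 2 + g ^+ 2 ->
  exists t, f = Num.sqrt (f ^+ 2 + g ^+ 2) * sin t /\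
            g = Num.sqrt (f ^+ 2 + g ^+ 2) * cos t.
Proof.
move=> fg0; set r := Num.sqrt _.
have r0 : 0 < r by rewrite sqrtr_gt0.
have r2 : r ^+ 2 = f ^+ 2 + g ^+ 2 by rewrite sqr_sqrtr// ltW.
have gr : -1 <= g / r <= 1.
  rewrite -ler_norml normrM normfV (gtr0_norm r0) ler_pdivrMr// mul1r.
  rewrite -[leRHS](gtr0_norm r0) -ler_sqr ?nnegrE// !real_normK ?num_real// r2.
  by rewrite lerDr sqr_ge0.
have ck : cos (acos (g / r)) = g / r by rewrite acosK// in_itv.
have s2 : 1 - (g / r) ^+ 2 = (f / r) ^+ 2.
  rewrite !expr_div_n r2; field; exact: lt0r_neq0.
have sk : r * sin (acos (g / r)) = `|f|.
  by rewrite sin_acos// s2 sqrtr_sqr normrM normfV (gtr0_norm r0) mulrC divfK// gt_eqF.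
case: (lerP 0 f) => f0.
  exists (acos (g / r)); rewrite sk ck ger0_norm//; split => //.
  by rewrite mulrC divfK// gt_eqF.
exists (- acos (g / r)); rewrite sinN cosN mulrN sk ck ltr0_norm// opprK; split => //.
by rewrite mulrC divfK// gt_eqF.
Qed.

(** The angle is the integral of (f' g - f g') / (f^2 + g^2).  In the frame that
    rotates with it, one coordinate p of the curve solves a homogeneous linear
    equation with initial value zero, so the curve stays on an axis of that frame. *)
Lemma ac_angle a f df g dg : ac_with_derivative a f df -> ac_with_derivative a g dg ->
  (forall x, a < x -> 0 < f x ^+ 2 + g x ^+ 2) ->
  exists th, ac_with_derivative a th
      (fun x => (df x * g x - f x * dg x) / (f x ^+ 2 + g x ^+ 2)) /\
    exists rad : R -> R, forall x, a < x ->
      [/\ 0 < rad x, f x = rad x * sin (th x) & g x = rad x * cos (th x)].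
Proof.
move=> hf hg fg0; have [lf _] := hf; have [lg _] := hg.
have cf := ac_continuous hf; have cg := ac_continuous hg.
pose r2 x := f x ^+ 2 + g x ^+ 2.
have cr2 x : a < x -> {for x, continuous r2}.
  move=> ax; rewrite (_ : r2 = fun t => f t * f t + g t * g t); last first.
    by apply/funext => t; rewrite -!expr2.
  by apply: cvgD; apply: cvgM; (exact: cf || exact: cg).
have cV x : a < x -> {for x, continuous (fun t => (r2 t)^-1)}.
  by move=> ax; apply: continuousV; [rewrite gt_eqF// fg0|exact: cr2].
have cM h x : a < x -> {for x, continuous h} -> {for x, continuous (fun t => h t * (r2 t)^-1)}.
  by move=> ax ch; apply: continuousM => //; exact: cV.
pose dth x := (df x * g x - f x * dg x) / r2 x.
pose lam x := (df x * f x + dg x * g x) / r2 x.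
have ldth : locally_integrable `]a, +oo[ dth.
  have := locally_integrableB
   (locally_integrable_mul_continuous lf (fun x ax => cM g x ax (cg x ax)))
   (locally_integrable_mul_continuous lg (fun x ax => cM f x ax (cf x ax))).
  by congr locally_integrable; apply/funext => x; rewrite /dth/=; ring.
have llam : locally_integrable `]a, +oo[ lam.
  have := locally_integrableD
   (locally_integrable_mul_continuous lf (fun x ax => cM f x ax (cf x ax)))
   (locally_integrable_mul_continuous lg (fun x ax => cM g x ax (cg x ax))).
  by congr locally_integrable; apply/funext => x; rewrite /lam/=; ring.
pose x0 := a + 1; have ax0 : a < x0 by rewrite /x0; lra.
have [t0] := polar_angle (fg0 x0 ax0).
have : 0 < Num.sqrt (f x0 ^+ 2 + g x0 ^+ 2) by rewrite sqrtr_gt0 fg0.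
move: (Num.sqrt _) => rr rr0 [ft0 gt0].
have hth := ac_add (ac_cst a t0) (primitive_ac ax0 ldth).
set th := (fun x => t0 + primitive x0 dth x) in hth.
have {}hth : ac_with_derivative a th dth.
  by apply: (ac_ae hth) => //; apply: aeW => x _; rewrite add0r.
have th0 : th x0 = t0 by rewrite /th primitive_base addr0.
exists th; split=> //.
have hs := ac_sin hth; have hc := ac_cos hth.
pose p x := f x * cos (th x) - g x * sin (th x).
pose q x := f x * sin (th x) + g x * cos (th x).
have hp := ac_sub (ac_mul hf hc) (ac_mul hg hs); rewrite -/p in hp.
have hL := primitive_ac ax0 llam.
have p0 x : a < x -> p x = 0.
  move=> ax.
  have : {ae leb, forall t, a < t ->
      df t * cos (th t) + dth t * - sin (th t) * f t -
      (dg t * sin (th t) + dth t * cos (th t) * g t) = lam t * p t}.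
    apply: aeW => {ax}t at_; rewrite /p /dth /lam /r2; field.
    exact: lt0r_neq0 (fg0 _ at_).
  move=> /(ac_linear hp hL)/(_ x x0 ax ax0).
  have -> : p x0 = 0 by rewrite /p th0 ft0 gt0; ring.
  by rewrite mulr0 => /eqP; rewrite mulf_eq0 gt_eqF ?expR_gt0//= => /eqP.
have pq x : p x ^+ 2 + q x ^+ 2 = r2 x.
  rewrite /p /q /r2 -[RHS]mulr1 -(cos2Dsin2 (th x)); ring.
have fE x : f x = p x * cos (th x) + q x * sin (th x).
  rewrite /p /q -[LHS]mulr1 -(cos2Dsin2 (th x)); ring.
have gE x : g x = q x * cos (th x) - p x * sin (th x).
  rewrite /p /q -[LHS]mulr1 -(cos2Dsin2 (th x)); ring.
exists q => x ax.
split; last 2 first.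
- by rewrite {1}fE p0// mul0r add0r.
- by rewrite {1}gE p0// mul0r subr0.
have qn t : a < t -> q t != 0.
  move=> at_; have := fg0 t at_; rewrite -/(r2 t) -pq p0// expr0n/= add0r.
  by rewrite exprn_even_gt0.
have cq t : a < t -> {for t, continuous q}.
  exact: (ac_continuous (ac_add (ac_mul hf hs) (ac_mul hg hc))).
have q0 : 0 < q x0.
  suff -> : q x0 = rr by [].
  by rewrite /q th0 ft0 gt0 -[RHS]mulr1 -(cos2Dsin2 t0); ring.
rewrite ltNge; apply/negP => qx.
have I (s t : R) : a < s -> s <= t -> {within `[s, t], continuous q}.
  move=> as_ st; apply: continuous_in_subspaceT => z /set_mem /=.
  by rewrite in_itv/= => /andP[sz _]; apply: cq; exact: lt_le_trans sz.
have q0' := ltW q0.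
case: (leP x0 x) => [|/ltW] xx.
  have [t] : exists2 t, t \in `[x0, x] & q t = 0.
    by apply: IVT; [|exact: I|rewrite ge_min le_max qx q0' orbT].
  by rewrite in_itv/= => /andP[ut _] /eqP; rewrite (negbTE (qn t _))//; exact: lt_le_trans ut.
have [t] : exists2 t, t \in `[x, x0] & q t = 0.
  by apply: IVT; [|exact: I|rewrite ge_min le_max qx q0' orbT].
by rewrite in_itv/= => /andP[ut _] /eqP; rewrite (negbTE (qn t _))//; exact: lt_le_trans ut.
Qed.

End Angles.


(** * Linear systems with locally integrable coefficients *)

Section LinearSystems.
Context {R : realType}.
Local Notation leb := (@lebesgue_measure R).
Implicit Types (a x y : R) (f g h : R -> R).

Lemma ac_eq a u v du : {in `]a, +oo[, u =1 v} -> ac_with_derivative a u du ->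
  ac_with_derivative a v du.
Proof.
move=> uv [lu Hu]; split => // x y ax xy.
by rewrite -!uv ?Hu// in_itv/= andbT//; exact: lt_le_trans xy.
Qed.

(** Subtracting and adding the remaining budget 2 c / 2^n makes the sequence
    monotone; the supremum of the lower sequence is the limit. *)
Lemma geometric_limit (u : nat -> R) (c : R) :
  (forall n, `|u n.+1 - u n| <= c / 2 ^+ n) ->
  exists l, forall n, `|l - u n| <= 2 * c / 2 ^+ n.
Proof.
move=> H; pose e n := 2 * c / 2 ^+ n.
have c0 : 0 <= c by have := H 0%N; rewrite expr0 divr1; exact: le_trans.
have eS n : e n = e n.+1 + c / 2 ^+ n.
  by rewrite /e exprS; field; rewrite expf_neq0.
have e0 n : 0 <= e n by rewrite /e divr_ge0 ?mulr_ge0 ?exprn_ge0.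
have lo n m : u n - e n <= u (n + m)%N - e (n + m)%N.
  elim: m => [|m IH]; first by rewrite addn0.
  apply: (le_trans IH); rewrite addnS (eS (n + m)%N).
  by have := H (n + m)%N; rewrite ler_norml => /andP[]; lra.
have hi n m : u (n + m)%N + e (n + m)%N <= u n + e n.
  elim: m => [|m IH]; first by rewrite addn0.
  apply: le_trans IH; rewrite addnS (eS (n + m)%N).
  by have := H (n + m)%N; rewrite ler_norml => /andP[]; lra.
have lohi n m : u n - e n <= u m + e m.
  have := lo n m; have := hi m n; rewrite addnC.
  by have := e0 (n + m)%N; lra.
pose A := range (fun n => u n - e n).
have ubA m : ubound A (u m + e m) by move=> _ [n _ <-]; exact: lohi.
have hA : has_sup A by split; [exists (u 0%N - e 0%N); exists 0%N|exists (u 0%N + e 0%N)].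
exists (sup A) => n; rewrite -/(e n).
have h1 : u n - e n <= sup A by apply: sup_upper_bound => //; exists n.
have h2 : sup A <= u n + e n by apply: ge_sup => //; exists (u 0%N - e 0%N); exists 0%N.
by rewrite ler_norml; apply/andP; split; lra.
Qed.

Lemma primitive_norm_le a x0 x f g : a < x0 -> a < x ->
  locally_integrable `]a, +oo[ f -> locally_integrable `]a, +oo[ g ->
  (forall t, a < t -> `|f t| <= g t) -> `|primitive x0 f x| <= `|primitive x0 g x|.
Proof.
move=> ax0 ax lf lg fg; rewrite /primitive.
have L y z : a < y -> `|\int[leb]_(t in `[y, z]) f t| <= `|\int[leb]_(t in `[y, z]) g t|.
  move=> ay; apply: (le_trans (int_norm_le lf z ay)); apply: le_trans (ler_norm _).
  apply: (int_le (locally_integrable_norm lf) lg) => //.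
  by apply: aeW => t /andP[yt _]; apply: fg; exact: lt_le_trans yt.
by case: ifP => _; rewrite ?normrN ?normrN; exact: L.
Qed.

Lemma primitiveZ a x0 x f (k : R) : a < x0 -> a < x ->
  locally_integrable `]a, +oo[ f ->
  primitive x0 (fun t => k * f t) x = k * primitive x0 f x.
Proof.
move=> ax0 ax lf; rewrite /primitive.
by case: ifP => _; rewrite (intZ lf)// mulrN.
Qed.

Lemma primitiveB a x0 x f g : a < x0 -> a < x ->
  locally_integrable `]a, +oo[ f -> locally_integrable `]a, +oo[ g ->
  primitive x0 (fun t => f t - g t) x = primitive x0 f x - primitive x0 g x.
Proof.
move=> ax0 ax lf lg; rewrite /primitive.
by case: ifP => _; rewrite (intB lf lg)//; ring.
Qed.

Section Picard.
Variables (a : R) (P Q : R -> R).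
Hypotheses (lP : locally_integrable `]a, +oo[ P) (lQ : locally_integrable `]a, +oo[ Q).
Variables (y0 z0 : R).

Let x0 := a + 1.
Let ax0 : a < x0. Proof. by rewrite /x0; lra. Qed.

Let picard n : (R -> R) * (R -> R) :=
  iter n (fun yz => (fun x => y0 + primitive x0 (fun t => P t * yz.2 t) x,
                     fun x => z0 + primitive x0 (fun t => Q t * yz.1 t) x))
         (fun=> 0, fun=> 0).

Let g t := `|P t| + `|Q t|.
Let lg : locally_integrable `]a, +oo[ g.
Proof. exact: locally_integrableD (locally_integrable_norm lP) (locally_integrable_norm lQ). Qed.
Let g0 t : 0 <= g t. Proof. exact: addr_ge0. Qed.

Let G := primitive x0 g.
Let hG : ac_with_derivative a G g. Proof. exact: primitive_ac. Qed.

(** In the norm weighted by W the Picard map is a contraction with factor 1/2 on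
    the whole half-line: g * W has the antiderivative V, and |V| <= W / 2.  The two
    exponentials serve the two sides of the base point. *)
Let W x := expR (2 * G x) + expR (- 2 * G x).
Let V x := 2^-1 * (expR (2 * G x) - expR (- 2 * G x)).

Let W_ge1 x : 1 <= W x.
Proof.
rewrite /W; have [G0|G0] := leP 0 (G x).
  by have := expR_ge1Dx (2 * G x); have := expR_ge0 (- 2 * G x); lra.
by have := expR_ge1Dx (- 2 * G x); have := expR_ge0 (2 * G x); lra.
Qed.

Let cW x : a < x -> {for x, continuous W}.
Proof.
exact: (ac_continuous (ac_add (ac_expR (ac_scale 2 hG)) (ac_expR (ac_scale (- 2) hG)))).
Qed.

Let lgW : locally_integrable `]a, +oo[ (fun t => g t * W t).
Proof. exact: locally_integrable_mul_continuous lg cW. Qed.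

Let hV : ac_with_derivative a V (fun t => g t * W t).
Proof.
have h := ac_scale 2^-1 (ac_sub (ac_expR (ac_scale 2 hG)) (ac_expR (ac_scale (- 2) hG))).
by apply: (ac_ae h lgW); apply: aeW => t _; rewrite /W; field.
Qed.

Let primitive_gW x : a < x -> `|primitive x0 (fun t => g t * W t) x| <= W x / 2.
Proof.
move=> ax.
have h := ac_sub hV (primitive_ac ax0 lgW).
have h0 : ac_with_derivative a (fun x => V x - primitive x0 (fun t => g t * W t) x) (fun=> 0).
  apply: (ac_ae h); first exact: locally_integrable_cst.
  by apply: aeW => t _; rewrite subrr.
have := ac_const h0 ax ax0; rewrite primitive_base.
have -> : V x0 = 0 by rewrite /V /G primitive_base !mulr0 subrr mulr0.
rewrite subr0 => /eqP; rewrite subr_eq0 => /eqP <-.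
rewrite /V /W ler_norml; have := expR_ge0 (2 * G x); have := expR_ge0 (- 2 * G x).
by move=> ? ?; apply/andP; split; lra.
Qed.

Let primitive_step P' h k : locally_integrable `]a, +oo[ P' ->
  (forall t, `|P' t| <= g t) -> locally_integrable `]a, +oo[ (fun t => P' t * h t) ->
  0 <= k -> (forall t, a < t -> `|h t| <= k * W t) ->
  forall x, a < x -> `|primitive x0 (fun t => P' t * h t) x| <= k * W x / 2.
Proof.
move=> lP' P'g lPh k0 hk x ax.
have hle t : a < t -> `|P' t * h t| <= k * (g t * W t).
  by move=> at_; rewrite normrM mulrCA ler_pM//; exact: hk.
apply: (le_trans (primitive_norm_le ax0 ax lPh (locally_integrable_scale k lgW) hle)).
rewrite (primitiveZ _ ax0 ax lgW) normrM (ger0_norm k0) -mulrA ler_wpM2l//.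
exact: primitive_gW.
Qed.

Let C := `|y0| + `|z0|.
Let C0 : 0 <= C. Proof. exact: addr_ge0. Qed.

Let Pg t : `|P t| <= g t. Proof. by rewrite lerDl. Qed.
Let Qg t : `|Q t| <= g t. Proof. by rewrite lerDr. Qed.

Let picard_continuous n : (forall x, a < x -> {for x, continuous (picard n).1}) /\
  (forall x, a < x -> {for x, continuous (picard n).2}).
Proof.
elim: n => [|n [IH1 IH2]]; first by split => x ax; exact: cst_continuous.
have l1 := locally_integrable_mul_continuous lP IH2.
have l2 := locally_integrable_mul_continuous lQ IH1.
by split => x ax; apply: cvgD; try exact: cvg_cst;
  apply: (ac_continuous (primitive_ac ax0 _) ax).
Qed.

Let locP h : (forall x, a < x -> {for x, continuous h}) ->
  locally_integrable `]a, +oo[ (fun t => P t * h t).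
Proof. exact: locally_integrable_mul_continuous. Qed.
Let locQ h : (forall x, a < x -> {for x, continuous h}) ->
  locally_integrable `]a, +oo[ (fun t => Q t * h t).
Proof. exact: locally_integrable_mul_continuous. Qed.

Let picard_steps n x : a < x ->
  `|(picard n.+1).1 x - (picard n).1 x| <= C * W x / 2 ^+ n /\
  `|(picard n.+1).2 x - (picard n).2 x| <= C * W x / 2 ^+ n.
Proof.
elim: n x => [|n IH] x ax.
  have Z P' : primitive x0 (fun t => P' t * 0) x = 0.
    rewrite /primitive; case: ifP => _; rewrite (_ : (fun t => P' t * 0) = cst 0).
    - by rewrite /Rintegral integral0.
    - by apply/funext => t; rewrite mulr0.
    - by rewrite /Rintegral integral0 oppr0.
    - by apply/funext => t; rewrite mulr0.
  rewrite /= !Z !addr0 !subr0 expr0 divr1; have W1 := W_ge1 x.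
  have CW : C <= C * W x by rewrite ler_peMr.
  by split; apply: le_trans CW; rewrite ?lerDl ?lerDr.
have [c1 c2] := picard_continuous n; have [c3 c4] := picard_continuous n.+1.
have e : C * W x / 2 ^+ n.+1 = C / 2 ^+ n * W x / 2.
  by rewrite exprS; field; rewrite expf_neq0.
have k0 : 0 <= C / 2 ^+ n by rewrite divr_ge0// exprn_ge0.
split.
- have -> : (picard n.+2).1 x - (picard n.+1).1 x =
     primitive x0 (fun t => P t * ((picard n.+1).2 t - (picard n).2 t)) x.
    rewrite [LHS](_ : _ = primitive x0 (fun t => P t * (picard n.+1).2 t) x
       - primitive x0 (fun t => P t * (picard n).2 t) x); last by rewrite /=; ring.
    rewrite -(primitiveB ax0 ax (locP c4) (locP c2)).
    by congr (primitive x0 _ x); apply/funext => t; ring.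
  rewrite e; apply: (primitive_step lP) => //.
    by apply: locP => t at_; apply: cvgB; [exact: c4|exact: c2].
  by move=> t at_; rewrite mulrAC; exact: (IH t at_).2.
- have -> : (picard n.+2).2 x - (picard n.+1).2 x =
     primitive x0 (fun t => Q t * ((picard n.+1).1 t - (picard n).1 t)) x.
    rewrite [LHS](_ : _ = primitive x0 (fun t => Q t * (picard n.+1).1 t) x
       - primitive x0 (fun t => Q t * (picard n).1 t) x); last by rewrite /=; ring.
    rewrite -(primitiveB ax0 ax (locQ c3) (locQ c1)).
    by congr (primitive x0 _ x); apply/funext => t; ring.
  rewrite e; apply: (primitive_step lQ) => //.
    by apply: locQ => t at_; apply: cvgB; [exact: c3|exact: c1].
  by move=> t at_; rewrite mulrAC; exact: (IH t at_).1.
Qed.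

Let limit_measurable (h : nat -> R -> R) l (K : R -> R) :
  (forall n x, a < x -> {for x, continuous (h n)}) ->
  (forall n x, a < x -> `|l x - h n x| <= K x / 2 ^+ n) ->
  measurable_fun `]a, +oo[ l.
Proof.
move=> ch hl; apply: (measurable_fun_cvg (h := h)).
  by move=> n; exact: continuous_measurable_itv (ch n).
move=> x /=; rewrite in_itv/= andbT => ax.
have h2 : `|2^-1 : R| < 1 by rewrite ger0_norm ?invr_ge0 ?invf_lt1 ?ltr1n.
have /cvgrPdist_le H := @cvg_geometric R (K x) 2^-1 h2.
apply/cvgrPdist_le => e e0; near=> n.
apply: (le_trans (hl n x ax)).
have : `|0 - geometric (K x) 2^-1 n| <= e by near: n; exact: H e0.
rewrite sub0r normrN /geometric/= exprVn; apply: le_trans; exact: ler_norm.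
Unshelve. all: by end_near. Qed.

(** The Picard iterates converge pointwise with error C W / 2^n; the limit
    satisfies the integral equation because the iterates satisfy it up to errors of
    the same size. *)
Lemma linear_system_solution : exists y z : R -> R,
  [/\ ac_with_derivative a y (fun t => P t * z t),
      ac_with_derivative a z (fun t => Q t * y t), y x0 = y0 & z x0 = z0].
Proof.
have Hy x : exists l, a < x -> forall n, `|l - (picard n).1 x| <= 2 * (C * W x) / 2 ^+ n.
  have [ax|_] := ltP a x; last by exists 0.
  have [n|l hl] := @geometric_limit (fun n => (picard n).1 x) (C * W x).
    by have [] := picard_steps n ax.
  by exists l => _.
have [y {}Hy] := choice Hy.
have Hz x : exists l, a < x -> forall n, `|l - (picard n).2 x| <= 2 * (C * W x) / 2 ^+ n.
  have [ax|_] := ltP a x; last by exists 0.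
  have [n|l hl] := @geometric_limit (fun n => (picard n).2 x) (C * W x).
    by have [] := picard_steps n ax.
  by exists l => _.
have [z {}Hz] := choice Hz.
have my : measurable_fun `]a, +oo[ y.
  apply: (@limit_measurable (fun n => (picard n).1) _ (fun x => 2 * (C * W x))).
    by move=> n; have [] := picard_continuous n.
  by move=> n x ax; exact: Hy.
have mz : measurable_fun `]a, +oo[ z.
  apply: (@limit_measurable (fun n => (picard n).2) _ (fun x => 2 * (C * W x))).
    by move=> n; have [] := picard_continuous n.
  by move=> n x ax; exact: Hz.
have bounded h : (forall x, a < x -> `|h x - 0| <= 2 * (C * W x) / 2 ^+ 0) ->
    forall x t, a < x -> x <= t -> exists M, forall s, x <= s <= t -> `|h s| <= M.
  move=> hW x t ax xt; have [M HM] := continuous_itv_bounded cW ax xt.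
  exists (2 * (C * M)) => s xst.
  have as_ : a < s by case/andP: xst => /(lt_le_trans ax).
  have := hW s as_; rewrite subr0 expr0 divr1 => /le_trans; apply.
  by rewrite !ler_wpM2l// (le_trans (ler_norm _))// HM.
have lPz : locally_integrable `]a, +oo[ (fun t => P t * z t).
  apply: (locally_integrable_mul lP mz); apply: bounded => x ax; exact: (Hz x ax 0%N).
have lQy : locally_integrable `]a, +oo[ (fun t => Q t * y t).
  apply: (locally_integrable_mul lQ my); apply: bounded => x ax; exact: (Hy x ax 0%N).
have small (e c : R) : (forall n, `|e| <= c / 2 ^+ n) -> e = 0.
  move=> H; apply/eqP; rewrite -normr_le0; apply: (@pow2_archimedean _ _ c) => n.
  by rewrite -ler_pdivlMr ?exprn_gt0.
have key P' (h : nat -> R -> R) l : locally_integrable `]a, +oo[ P' ->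
    (forall t, `|P' t| <= g t) -> locally_integrable `]a, +oo[ (fun t => P' t * l t) ->
    (forall n x, a < x -> {for x, continuous (h n)}) ->
    (forall x, a < x -> forall n, `|l x - h n x| <= 2 * (C * W x) / 2 ^+ n) ->
    forall x, a < x -> forall n,
      `|primitive x0 (fun t => P' t * l t) x - primitive x0 (fun t => P' t * h n t) x|
      <= C * W x / 2 ^+ n.
  move=> lP' P'g lPl ch hl x ax n.
  have lPh := locally_integrable_mul_continuous lP' (ch n).
  rewrite -(primitiveB ax0 ax lPl lPh).
  rewrite (_ : C * W x / 2 ^+ n = (2 * C / 2 ^+ n) * W x / 2); last first.
    by field; rewrite expf_neq0.
  have E : (fun t => P' t * l t - P' t * h n t) = (fun t => P' t * (l t - h n t)).
    by apply/funext => t; ring.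
  rewrite E; apply: (primitive_step lP') => //.
  - by rewrite -E; exact: locally_integrableB lPl lPh.
  - by rewrite divr_ge0 ?mulr_ge0 ?exprn_ge0.
  - move=> t at_; apply: (le_trans (hl t at_ n)); rewrite le_eqVlt; apply/orP; left.
    by apply/eqP; field; rewrite expf_neq0.
have yE x : a < x -> y x = y0 + primitive x0 (fun t => P t * z t) x.
  move=> ax; apply/eqP; rewrite -subr_eq0; apply/eqP.
  apply: (@small _ (2 * (C * W x))) => n.
  have h1 := Hy x ax n.+1; have h2 := key P _ z lP Pg lPz (fun n => (picard_continuous n).2) Hz x ax n.
  rewrite (_ : _ - _ = (y x - (picard n.+1).1 x)
     - (primitive x0 (fun t => P t * z t) x - primitive x0 (fun t => P t * (picard n).2 t) x));
    last by rewrite /=; ring.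
  apply: (le_trans (ler_normB _ _)); apply: (le_trans (lerD h1 h2)).
  by rewrite exprS le_eqVlt; apply/orP; left; apply/eqP; field; rewrite expf_neq0.
have zE x : a < x -> z x = z0 + primitive x0 (fun t => Q t * y t) x.
  move=> ax; apply/eqP; rewrite -subr_eq0; apply/eqP.
  apply: (@small _ (2 * (C * W x))) => n.
  have h1 := Hz x ax n.+1; have h2 := key Q _ y lQ Qg lQy (fun n => (picard_continuous n).1) Hy x ax n.
  rewrite (_ : _ - _ = (z x - (picard n.+1).2 x)
     - (primitive x0 (fun t => Q t * y t) x - primitive x0 (fun t => Q t * (picard n).1 t) x));
    last by rewrite /=; ring.
  apply: (le_trans (ler_normB _ _)); apply: (le_trans (lerD h1 h2)).
  by rewrite exprS le_eqVlt; apply/orP; left; apply/eqP; field; rewrite expf_neq0.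
exists y, z; split.
- have h := ac_add (ac_cst a y0) (primitive_ac ax0 lPz).
  apply: (ac_eq (u := fun x => y0 + primitive x0 (fun t => P t * z t) x)).
    by move=> x; rewrite in_itv/= andbT => /yE.
  by apply: (ac_ae h lPz); apply: aeW => t _; rewrite add0r.
- have h := ac_add (ac_cst a z0) (primitive_ac ax0 lQy).
  apply: (ac_eq (u := fun x => z0 + primitive x0 (fun t => Q t * y t) x)).
    by move=> x; rewrite in_itv/= andbT => /zE.
  by apply: (ac_ae h lQy); apply: aeW => t _; rewrite add0r.
- by rewrite yE// primitive_base addr0.
- by rewrite zE// primitive_base addr0.
Qed.

End Picard.
End LinearSystems.


(** * Weighted zeros and differences of Pruefer angles *)

Section WeightedZeros.
Context {R : realType}.
Implicit Types (a x y : R) (th : R -> R).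

Lemma limf_esup_fin_num {T : choiceType} {X : filteredType T} (f : X -> \bar R)
    (F : set_system X) {FF : ProperFilter F} (M N : R) :
  F [set t | (M%:E <= f t <= N%:E)%E] -> limf_esup f F \is a fin_num.
Proof.
move=> FN; rewrite fin_numElt; apply/andP; split.
- apply: (@lt_le_trans _ _ M%:E); first exact: ltNyr.
  apply: le_ereal_inf_tmp => _ [V FV <-].
  have [t [Vt /= /andP[lo _]]] := filter_ex (@filterI _ F _ _ _ FV FN).
  by apply: (le_trans lo); apply: ereal_sup_ubound; exists t.
- apply: (@le_lt_trans _ _ N%:E); last exact: ltry.
  apply: (@le_trans _ _ (ereal_sup (f @` [set t | (M%:E <= f t <= N%:E)%E]))).
    by apply: ereal_inf_lbound; exists [set t | (M%:E <= f t <= N%:E)%E].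
  by apply: ge_ereal_sup => _ [t /= /andP[_ hi] <-].
Qed.

Lemma limf_esup_pinfty {T : choiceType} {X : filteredType T} (f : X -> \bar R)
    (F : set_system X) :
  (forall V (M : R), F V -> exists2 t, V t & (M%:E <= f t)%E) -> limf_esup f F = +oo%E.
Proof.
move=> H; apply/eqP; rewrite eq_le leey/=; apply: le_ereal_inf_tmp => _ [V FV <-].
rewrite leye_eq; apply/eqP; apply/eqyP => M M0.
have [t Vt Mt] := H V M FV; apply: (le_trans Mt).
by apply: ereal_sup_ubound; exists t.
Qed.

Lemma weighted_zeros_bounds (th0 th1 : R -> R) c d :
  (th1 d - th0 d) / pi - (th1 c - th0 c) / pi - 1
    <= (weighted_zeros th0 th1 c d)%:~R :> R /\
  (weighted_zeros th0 th1 c d)%:~R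
    <= (th1 d - th0 d) / pi - (th1 c - th0 c) / pi + 1 :> R.
Proof.
rewrite /weighted_zeros; set D := _ / pi; set C := (_ - _) / pi.
rewrite !intrD !intrN /=.
have h1 := ceil_ge D; have h2 := ceilB1_lt D; have h3 := floor_le C.
have h4 := floorD1_gt C.
by rewrite !intrD !intrN in h2 h4; split; lra.
Qed.

Lemma bounded_difference_fin_num a (th0 th1 : R -> R) (M c0 X : R) : a < c0 ->
  (forall x, a < x -> x <= c0 -> `|th1 x - th0 x| <= M) ->
  (forall x, X < x -> `|th1 x - th0 x| <= M) ->
  liminf_zeros a th0 th1 \is a fin_num /\ limsup_zeros a th0 th1 \is a fin_num.
Proof.
move=> ac Hc HX.
have pi0 := pi_gt0 R.
have FN : filter_prod a^'+ (pinfty_nbhs R)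
   [set cd | ((- (2 * (M / pi) + 1))%:E <= weighted_zerosE th0 th1 cd
                <= (2 * (M / pi) + 1)%:E)%E].
  exists ([set x | a < x <= c0], [set x | X < x]) => /=.
    split; last by exists X; split => //; exact: num_real.
    by near=> x => /=; apply/andP; split; near: x; [exact: nbhs_right_gt|exact: nbhs_right_le].
  move=> [c d] /= [/andP[ax xc] Xd].
  have [h1 h2] := weighted_zeros_bounds th0 th1 c d.
  have h3 := Hc c ax xc; have h4 := HX d Xd.
  have B z : `|z| <= M -> - (M / pi) <= z / pi <= M / pi.
    by rewrite ler_norml -mulNr !ler_pM2r ?invr_gt0.
  have /andP[? ?] := B _ h3; have /andP[? ?] := B _ h4.
  by rewrite !lee_fin; apply/andP; split; lra.
split; last exact: limf_esup_fin_num FN.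
rewrite /liminf_zeros /limf_einf fin_numN.
apply: (limf_esup_fin_num (M := - (2 * (M / pi) + 1)) (N := 2 * (M / pi) + 1)).
apply: filterS FN => cd /= /andP[]; rewrite /weighted_zerosE => h1 h2.
rewrite !lee_fin in h1 h2 *; apply/andP; split; lra.
Unshelve. all: by end_near. Qed.

Lemma unbounded_difference_not_fin_num a (th0 th1 : R -> R) :
  (forall M, exists X, forall d, X < d -> M <= th1 d - th0 d) \/
  (forall M, exists X, forall d, X < d -> th1 d - th0 d <= M) ->
  liminf_zeros a th0 th1 \isn't a fin_num \/ limsup_zeros a th0 th1 \isn't a fin_num.
Proof.
have pi0 := pi_gt0 R.
have pick V : filter_prod a^'+ (pinfty_nbhs R) V ->
    exists c, forall Y, exists2 d, V (c, d) & Y < d.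
  move=> [[A B] /= [aA [Z [_ ZB]]] AB].
  have [c Ac] := filter_ex aA; exists c => Y.
  exists (Num.max Z Y + 1); last by rewrite ltr_pwDr// le_max lexx orbT.
  by apply: AB; split => //=; apply: ZB; rewrite ltr_pwDr// le_max lexx.
move=> [H|H]; [right|left].
- rewrite /limsup_zeros limf_esup_pinfty// => V M FV.
  have [c Vc] := pick V FV.
  have [X HX] := H (pi * (M + 1 + (th1 c - th0 c) / pi)).
  have [d Vd Xd] := Vc X; exists (c, d) => //=; rewrite lee_fin.
  have [h1 _] := weighted_zeros_bounds th0 th1 c d.
  have := HX d Xd; rewrite mulrC -ler_pdivlMr// => h2; apply: le_trans h1 => /=; lra.
- rewrite /liminf_zeros /limf_einf limf_esup_pinfty// => V M FV.
  have [c Vc] := pick V FV.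
  have [X HX] := H (pi * (- M - 1 + (th1 c - th0 c) / pi)).
  have [d Vd Xd] := Vc X; exists (c, d) => //=; rewrite lee_fin.
  have [_ h1] := weighted_zeros_bounds th0 th1 c d.
  have := HX d Xd; rewrite mulrC -ler_pdivrMr// => h2 /=; lra.
Qed.

Lemma antiparallel (s t : R) : cos (s - t) = -1 -> sin s = - sin t /\ cos s = - cos t.
Proof.
rewrite cosB => H.
have E : (sin s + sin t) ^+ 2 + (cos s + cos t) ^+ 2 = 0.
  have h1 := cos2Dsin2 s; have h2 := cos2Dsin2 t; lra.
have : (sin s + sin t) ^+ 2 = 0 /\ (cos s + cos t) ^+ 2 = 0.
  by have := sqr_ge0 (sin s + sin t); have := sqr_ge0 (cos s + cos t); split; lra.
by move=> [/eqP + /eqP]; rewrite !expf_eq0/= !addr_eq0 => /eqP -> /eqP ->.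
Qed.

(** Meant for h a difference of two angles: directions that never are opposite
    wind around the origin together. *)
Lemma never_opposite_bounded (h : R -> R) x y : x <= y ->
  (forall t, x <= t <= y -> {for t, continuous h}) ->
  (forall t, x <= t <= y -> cos (h t) != -1) -> `|h y - h x| <= pi *+ 2.
Proof.
move=> xy ch hn; apply: (avoid_residue_bounded (v := pi)) => // t xty.
by rewrite cosB cospi sinpi mulr0 addr0 mulrN1 eqr_oppLR hn.
Qed.

End WeightedZeros.

(** * Solutions of the Sturm-Liouville equations *)

Section Solutions.
Context {R : realType} (a : R).
Local Notation leb := (@lebesgue_measure R).
Implicit Types (x y : R) (p q r u pu v pv : R -> R).

Lemma wronskian_ac (P0 Q0 P1 Q1 u pu v pv : R -> R) :
  ac_with_derivative a u (fun x => P0 x * pu x) ->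
  ac_with_derivative a pu (fun x => Q0 x * u x) ->
  ac_with_derivative a v (fun x => P1 x * pv x) ->
  ac_with_derivative a pv (fun x => Q1 x * v x) ->
  ac_with_derivative a (fun x => u x * pv x - pu x * v x)
    (fun x => (Q1 x - Q0 x) * (u x * v x) + (P0 x - P1 x) * (pu x * pv x)).
Proof.
move=> hu hpu hv hpv.
have := ac_sub (ac_mul hu hpv) (ac_mul hpu hv).
by congr ac_with_derivative; apply/funext => x; ring.
Qed.

Lemma wronskian_const (P Q u pu v pv : R -> R) :
  ac_with_derivative a u (fun x => P x * pu x) ->
  ac_with_derivative a pu (fun x => Q x * u x) ->
  ac_with_derivative a v (fun x => P x * pv x) ->
  ac_with_derivative a pv (fun x => Q x * v x) ->
  forall x y, a < x -> a < y -> u x * pv x - pu x * v x = u y * pv y - pu y * v y.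
Proof.
move=> hu hpu hv hpv x y ax ay.
apply: (ac_const (a := a) (u := fun x => u x * pv x - pu x * v x)) => //.
have := wronskian_ac hu hpu hv hpv.
by congr ac_with_derivative; apply/funext => t; ring.
Qed.

Lemma solution_ac p q r (E : R) u pu : coefficients a p q r -> solution a p q r E u pu ->
  ac_with_derivative a u (fun x => (p x)^-1 * pu x) /\
  ac_with_derivative a pu (fun x => (q x - E * r x) * u x).
Proof.
move=> [lp lq lr pr0] [du [dpu [hu hpu Hp Hr]]].
have cu := ac_continuous hu; have cpu := ac_continuous hpu.
split.
- apply: (ac_ae hu); first exact: locally_integrable_mul_continuous.
  apply: ae_imply2 pr0 Hp => x H1 H2 ax; have [p0 _] := H1 ax.
  by rewrite -H2// mulKf// gt_eqF.
- apply: (ac_ae hpu).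
    apply: locally_integrable_mul_continuous => //.
    by apply: locally_integrableB lq _; exact: locally_integrable_scale.
  apply: ae_imply2 pr0 Hr => x H1 H2 ax; have [_ r0] := H1 ax.
  have := H2 ax => /(congr1 (fun z => r x * z)); rewrite mulVKf ?gt_eqF//.
  by move=> H; lra.
Qed.

Lemma ac_solution p q r (E : R) u pu : coefficients a p q r ->
  ac_with_derivative a u (fun x => (p x)^-1 * pu x) ->
  ac_with_derivative a pu (fun x => (q x - E * r x) * u x) ->
  solution a p q r E u pu.
Proof.
move=> [lp lq lr pr0] hu hpu; do 2 eexists; split; [exact: hu|exact: hpu|..].
- by apply: ae_imply pr0 => x H ax; have [p0 _] := H ax; rewrite mulVKf// gt_eqF.
- apply: ae_imply pr0 => x H ax; have [_ r0] := H ax.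
  by field; exact: lt0r_neq0.
Qed.

(** The Wronskian with a second solution, normalised to 1 at one point, shows that
    (u, pu) never vanishes. *)
Lemma solution_exists p q r (E : R) : coefficients a p q r ->
  exists u pu, [/\ solution a p q r E u pu, nontrivial a u &
    forall x, a < x -> 0 < u x ^+ 2 + pu x ^+ 2].
Proof.
move=> C; have [lp lq lr _] := C.
have lQ : locally_integrable `]a, +oo[ (fun x => q x - E * r x).
  by apply: locally_integrableB lq _; exact: locally_integrable_scale.
have [u [pu [hu hpu u1 pu0]]] := linear_system_solution lp lQ 1 0.
have [v [pv [hv hpv v0 pv1]]] := linear_system_solution lp lQ 0 1.
have a1 : a < a + 1 by rewrite ltrDl.
exists u, pu; split.
- exact: ac_solution.
- by exists (a + 1) => //; rewrite u1 oner_neq0.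
move=> x ax; have := wronskian_const hu hpu hv hpv ax a1.
rewrite u1 pu0 v0 pv1 mulr1 mulr0 subr0 => W.
rewrite lt0r addr_ge0 ?sqr_ge0// andbT paddr_eq0 ?sqr_ge0// !expf_eq0/=.
by apply/negP => /andP[/eqP ux /eqP pux]; move/eqP: W; rewrite ux pux !mul0r subr0 eq_sym oner_eq0.
Qed.

Lemma solution_angle p q r (E : R) u pu : coefficients a p q r ->
  solution a p q r E u pu -> (forall x, a < x -> 0 < u x ^+ 2 + pu x ^+ 2) ->
  exists th, prufer_angle a u pu th.
Proof.
move=> C S n0; have [hu hpu] := solution_ac C S.
have [th [hth [rad Hr]]] := ac_angle hu hpu n0.
exists th; split; first exact: ac_continuous hth.
by exists rad.
Qed.

(** The coefficients are integrable up to a, so (u, pu) on (a, c0] stays within a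
    third of its value at c0 when c0 is close to a.  Its direction there is never
    opposite to the one at c0. *)
Lemma prufer_bounded_left p q r (E : R) u pu th : coefficients a p q r ->
  regular_left a p q r -> solution a p q r E u pu -> prufer_angle a u pu th ->
  exists2 c0, a < c0 & exists M, forall x, a < x -> x <= c0 -> `|th x| <= M.
Proof.
move=> C [c1 ac1 [ip iq ir]] S [cth [rad Hrad]].
have [hu hpu] := solution_ac C S.
have [lp lq lr _] := C.
have lQ : locally_integrable `]a, +oo[ (fun x => q x - E * r x).
  by apply: locally_integrableB lq _; exact: locally_integrable_scale.
pose g x := `|(p x)^-1| + `|q x - E * r x|.
have lg : locally_integrable `]a, +oo[ g.
  exact: locally_integrableD (locally_integrable_norm lp) (locally_integrable_norm lQ).
have mI : measurable (`]a, c1[%classic : set (measurableTypeR R)) by [].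
have ig : leb.-integrable `]a, c1[ (EFin \o g).
  have iQ : leb.-integrable `]a, c1[ (EFin \o (fun x => q x - E * r x)).
    have iEr : leb.-integrable `]a, c1[ (fun x => E%:E * (r x)%:E)%E.
      by apply: integrableZl.
    by have := integrableB mI iq iEr; apply: eq_integrable.
  have ip' : leb.-integrable `]a, c1[ (EFin \o (fun x => (p x)^-1)) by [].
  have := integrableD mI (integrable_norm ip') (integrable_norm iQ).
  by apply: eq_integrable.
pose h := g \_ `]a, c1[.
have h0 t : 0 <= h t by rewrite /h patchE; case: ifP => // _; exact: addr_ge0.
have ih : leb.-integrable `[a, c1] (EFin \o h).
  rewrite -restrict_EFin; apply/integrable_restrict => //=.
  by rewrite setIidr//; exact: subset_itv_oo_cc.
have [c0 /andP[ac0 c01] Hc0] : exists2 c0, a < c0 < c1 &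
    forall x, a < x -> x <= c0 -> \int[leb]_(t in `[x, c0]) g t <= 1 / 4.
  have e0 : 0 < 1 / 4 :> R by lra.
  have near0 := parameterized_integral_near_left ac1 e0 ih.
  have [d /= d0 Hd] := near0.
  pose c0 := a + Num.min (d / 2) ((c1 - a) / 2).
  have m0 : 0 < Num.min (d / 2) ((c1 - a) / 2).
    by rewrite lt_min; apply/andP; split; lra.
  have m1 : Num.min (d / 2) ((c1 - a) / 2) <= d / 2 by rewrite ge_min lexx.
  have m2 : Num.min (d / 2) ((c1 - a) / 2) <= (c1 - a) / 2 by rewrite ge_min lexx orbT.
  exists c0; first by rewrite /c0; apply/andP; split; lra.
  move=> x ax xc.
  have c0c1 : c0 < c1 by rewrite /c0; lra.
  have ac0 : a <= c0 by rewrite /c0; lra.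
  have bc0 : ball_ Num.norm a d c0.
    by rewrite /ball_/= /c0 opprD addrA subrr sub0r normrN gtr0_norm//; lra.
  have := Hd c0 bc0 ac0; rewrite /parameterized_integral => hI.
  apply: le_trans (le_trans (ler_norm _) (ltW hI)).
  have -> : \int[leb]_(t in `[x, c0]) g t = \int[leb]_(t in `[x, c0]) h t.
    apply: eq_Rintegral => t /set_mem /=; rewrite in_itv/= => /andP[xt tc].
    rewrite /h patchE ifT//; apply/mem_set; rewrite /= in_itv/=.
    by rewrite (lt_le_trans ax xt) (le_lt_trans tc c0c1).
  have ihS : leb.-integrable `[a, c0] (EFin \o h).
    apply: integrableS ih => //; apply: subset_itvl; rewrite bnd_simp; exact: ltW.
  rewrite /Rintegral fine_le//.
  - apply: integrable_fin_num => //; apply: integrableS ihS => //.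
    by apply: subset_itvr; rewrite bnd_simp; exact: ltW.
  - exact: integrable_fin_num.
  apply: ge0_subset_integral => //.
  - exact: measurable_int ihS.
  - by move=> t _; rewrite lee_fin.
  - by apply: subset_itvr; rewrite bnd_simp; exact: ltW.
have [rc uc puc] := Hrad _ ac0.
(* With n t maximal on [x, c0], the increments over [t, c0] are at most n t / 4;
   hence n t <= 4/3 n c0. *)
pose n t := Num.max `|u t| `|pu t|.
have n0 : 0 < n c0.
  rewrite lt_max !normr_gt0 uc puc !mulf_eq0 gt_eqF//=.
  rewrite -negb_and; apply/negP => /andP[/eqP s0 /eqP c0'].
  by have := cos2Dsin2 (th c0); rewrite s0 c0' expr0n/= addr0 => /eqP; rewrite eq_sym oner_eq0.
have close x : a < x -> x <= c0 -> `|u x - u c0| <= n c0 / 3 /\ `|pu x - pu c0| <= n c0 / 3.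
  move=> ax xc.
  have cn : {within `[x, c0], continuous n}.
    apply: continuous_in_subspaceT => t /set_mem /=; rewrite in_itv/= => /andP[xt _].
    have at_ := lt_le_trans ax xt.
    apply: (@continuous_max _ _ (fun t => `|u t|) (fun t => `|pu t|)).
      by apply: (@continuous_comp _ _ _ u Num.norm); [exact: (ac_continuous hu)|exact: norm_continuous].
    by apply: (@continuous_comp _ _ _ pu Num.norm); [exact: (ac_continuous hpu)|exact: norm_continuous].
  have [t + tmax] := EVT_max xc cn; rewrite in_itv/= => /andP[xt tc].
  have N0 : 0 <= n t by rewrite le_max normr_ge0.
  have step s : x <= s -> s <= c0 ->
      `|u s - u c0| <= n t / 4 /\ `|pu s - pu c0| <= n t / 4.
    move=> xs sc; have as_ := lt_le_trans ax xs.
    have I4 := Hc0 s as_ sc.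
    have B k v f : ac_with_derivative a v (fun z => k z * f z) ->
        locally_integrable `]a, +oo[ k ->
        (forall z, `|k z| <= g z) -> (forall z, s <= z <= c0 -> `|f z| <= n t) ->
        `|v s - v c0| <= n t / 4.
      move=> [lkf Hv] lk kg fn; rewrite distrC Hv//.
      apply: (le_trans (int_mul_le lk lg lkf kg as_ fn)).
      by rewrite ler_wpM2l// (le_trans I4)//; lra.
    split; [apply: (B _ _ _ hu lp)|apply: (B _ _ _ hpu lQ)].
    - by move=> z; rewrite /g lerDl.
    - move=> z /andP[sz zc]; apply: le_trans (tmax z _); first by rewrite le_max lexx orbT.
      by rewrite in_itv/= (le_trans xs sz).
    - by move=> z; rewrite /g lerDr.
    - move=> z /andP[sz zc]; apply: le_trans (tmax z _); first by rewrite le_max lexx.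
      by rewrite in_itv/= (le_trans xs sz).
  have nt : n t <= n c0 + n t / 4.
    have [h1 h2] := step t xt tc.
    have E1 : `|u t| <= `|u c0| + n t / 4.
      by rewrite -(subrK (u c0) (u t)) addrC (le_trans (ler_normD _ _))// lerD2l.
    have E2 : `|pu t| <= `|pu c0| + n t / 4.
      by rewrite -(subrK (pu c0) (pu t)) addrC (le_trans (ler_normD _ _))// lerD2l.
    rewrite {1}/n ge_max; apply/andP; split.
      by apply: (le_trans E1); rewrite lerD2r le_max lexx.
    by apply: (le_trans E2); rewrite lerD2r le_max lexx orbT.
  have [h1 h2] := step x (lexx _) xc.
  by split; [apply: (le_trans h1)|apply: (le_trans h2)]; lra.
exists c0 => //; exists (`|th c0| + pi *+ 2) => x ax xc.
have : `|(th c0 - th c0) - (th x - th c0)| <= pi *+ 2.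
  apply: (never_opposite_bounded (h := fun t => th t - th c0)) => //.
    move=> t /andP[xt _]; apply: cvgB; last exact: cvg_cst.
    by apply: cth; exact: lt_le_trans xt.
  move=> t /andP[xt tc]; apply/eqP => /antiparallel[s1 s2].
  have at_ := lt_le_trans ax xt.
  have [rt ut put] := Hrad t at_.
  have [h1 h2] := close t at_ tc.
  have k0 : 0 < rad t / rad c0 by exact: divr_gt0.
  have D1 : u t - u c0 = - (1 + rad t / rad c0) * u c0.
    by rewrite ut s1 uc; field; exact: lt0r_neq0.
  have D2 : pu t - pu c0 = - (1 + rad t / rad c0) * pu c0.
    by rewrite put s2 puc; field; exact: lt0r_neq0.
  have kk : `|- (1 + rad t / rad c0)| = 1 + rad t / rad c0.
    by rewrite normrN ger0_norm//; lra.
  have F (z : R) : `|- (1 + rad t / rad c0) * z| <= n c0 / 3 -> `|z| <= n c0 / 3.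
    by rewrite normrM kk; apply: le_trans; rewrite ler_peMl//; lra.
  have : n c0 <= n c0 / 3.
    by rewrite {1}/n ge_max; apply/andP; split; apply: F; rewrite -?D1 -?D2.
  lra.
rewrite subrr sub0r normrN => H.
by rewrite -(subrK (th c0) (th x)) addrC (le_trans (ler_normD _ _))// lerD2l.
Qed.

End Solutions.


(** * Planar systems with a common rate *)

Section SlowSystems.
Context {R : realType}.
Local Notation leb := (@lebesgue_measure R).

Lemma continuous_sign b (f : R -> R) : (forall x, b < x -> {for x, continuous f}) ->
  (forall x, b < x -> f x != 0) ->
  exists s : R, forall x, b < x -> 0 < s * f x.
Proof.
move=> cf f0.
have same x y : b < x -> x <= y -> ~ (f x * f y < 0).
  move=> bx xy neg.
  have cxy : {within `[x, y], continuous f}.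
    apply: continuous_in_subspaceT => t /set_mem /=; rewrite in_itv/= => /andP[xt _].
    by apply: cf; exact: lt_le_trans xt.
  have [t] : exists2 t, t \in `[x, y] & f t = 0.
    apply: IVT => //; rewrite ge_min le_max.
    have [fx|/ltW fx] := leP (f x) 0; have [fy|/ltW fy] := leP (f y) 0.
    - by move: neg; rewrite ltNge mulr_le0.
    - by rewrite fy orbT.
    - by rewrite fx orbT.
    - by move: neg; rewrite ltNge mulr_ge0.
  rewrite in_itv/= => /andP[xt _] /eqP.
  by rewrite (negbTE (f0 t (lt_le_trans bx xt))).
have b1 : b < b + 1 by rewrite ltrDl.
exists (f (b + 1)) => x bx.
rewrite lt_neqAle eq_sym mulf_neq0 ?f0//= leNgt; apply/negP => neg.
have [xb|/ltW xb] := leP x (b + 1).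
  by apply: (same x (b + 1)) => //; rewrite mulrC.
exact: (same (b + 1) x).
Qed.

(** The system X' = rho D, D' = rho (D + A X) in the coordinates X, L = D - X / 2,
    up to an error of relative size eps.  In these coordinates the trace acts as
    the scalar rho / 2, and the sign of 1/4 + A decides between rotation and
    hyperbolic motion. *)
Definition near_system (rho A eps X L dX dL : R) : Prop :=
  [/\ 0 < rho, `|dX - rho * (L + X / 2)| <= rho * (eps * (`|X| + `|L|)) &
      `|dL - rho * (L / 2 + (1 / 4 + A) * X)| <= rho * (eps * (`|X| + `|L|))].

(** Bounds the contribution of the errors e1 of X' and e2 of L' to the derivative
    of any quadratic form X L' +- L X'. *)
Lemma cross_error (rho eps X L e1 e2 : R) : 0 < rho -> 0 <= eps ->
  `|e1| <= rho * (eps * (`|X| + `|L|)) -> `|e2| <= rho * (eps * (`|X| + `|L|)) ->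
  `|X| * `|e2| + `|L| * `|e1| <= rho * (2 * eps * (X ^+ 2 + L ^+ 2)).
Proof.
move=> r0 e0 h1 h2.
have X0 := normr_ge0 X; have L0 := normr_ge0 L.
have k1 := ler_wpM2l L0 h1; have k2 := ler_wpM2l X0 h2.
apply: (le_trans (lerD k2 k1)).
rewrite -(real_normK (num_real X)) -(real_normK (num_real L)).
apply: (@le_trans _ _ (rho * (eps * (`|X| + `|L|) ^+ 2))).
  by rewrite le_eqVlt; apply/orP; left; apply/eqP; ring.
rewrite (ler_wpM2l (ltW r0))// (mulrC 2) -mulrA ler_wpM2l//.
have := sqr_ge0 (`|X| - `|L|); lra.
Qed.

Lemma rotation_rate (rho A eps kappa X L dX dL : R) : 0 <= eps -> 2 * eps <= kappa ->
  2 * kappa <= 1 -> A <= - (1 / 4) - 2 * kappa ->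
  near_system rho A eps X L dX dL ->
  dL * X - L * dX <= - kappa * rho * (X ^+ 2 + L ^+ 2).
Proof.
move=> e0 ek k1 Ak [r0 h1 h2].
set e1 := dX - _ in h1; set e2 := dL - _ in h2.
have ce := cross_error r0 e0 h1 h2.
have n1 : X * e2 - L * e1 <= `|X| * `|e2| + `|L| * `|e1|.
  rewrite -!normrM; have := ler_norm (X * e2); have := ler_norm (- (L * e1)).
  by rewrite normrN; lra.
have -> : dL * X - L * dX = rho * ((1 / 4 + A) * X ^+ 2 - L ^+ 2) + (X * e2 - L * e1).
  by rewrite /e1 /e2; field.
have X2 := sqr_ge0 X; have L2 := sqr_ge0 L.
have p1 : rho * (2 * eps * (X ^+ 2 + L ^+ 2)) <= rho * (kappa * (X ^+ 2 + L ^+ 2)).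
  by rewrite (ler_wpM2l (ltW r0))// ler_wpM2r// addr_ge0.
have p2 : (1 / 4 + A) * X ^+ 2 <= (- (2 * kappa)) * X ^+ 2 by rewrite ler_wpM2r//; lra.
have p3 : - L ^+ 2 <= - (2 * kappa) * L ^+ 2.
  by rewrite -mulN1r ler_wpM2r//; lra.
have p4 : rho * ((1 / 4 + A) * X ^+ 2 - L ^+ 2)
    <= rho * (- (2 * kappa) * (X ^+ 2 + L ^+ 2)).
  by rewrite (ler_wpM2l (ltW r0))// mulrDr; lra.
apply: (le_trans (lerD p4 (le_trans n1 (le_trans ce p1)))).
by rewrite le_eqVlt; apply/orP; left; apply/eqP; ring.
Qed.

Lemma product_growth (rho A eps kappa X L dX dL : R) : 0 <= eps -> 2 * eps <= kappa ->
  2 * kappa <= 1 -> - (1 / 4) + 2 * kappa <= A ->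
  near_system rho A eps X L dX dL ->
  rho * (X * L) <= dX * L + dL * X.
Proof.
move=> e0 ek k1 Ak [r0 h1 h2].
set e1 := dX - _ in h1; set e2 := dL - _ in h2.
have ce := cross_error r0 e0 h1 h2.
have n1 : - (`|X| * `|e2| + `|L| * `|e1|) <= X * e2 + L * e1.
  rewrite -!normrM; have := ler_norm (- (X * e2)); have := ler_norm (- (L * e1)).
  by rewrite !normrN; lra.
have -> : dX * L + dL * X = rho * (X * L) + rho * ((1 / 4 + A) * X ^+ 2 + L ^+ 2)
     + (X * e2 + L * e1).
  by rewrite /e1 /e2; field.
have X2 := sqr_ge0 X; have L2 := sqr_ge0 L.
have p1 : rho * (2 * eps * (X ^+ 2 + L ^+ 2)) <= rho * (kappa * (X ^+ 2 + L ^+ 2)).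
  by rewrite (ler_wpM2l (ltW r0))// ler_wpM2r// addr_ge0.
have p2 : kappa * X ^+ 2 <= (1 / 4 + A) * X ^+ 2 by rewrite ler_wpM2r//; lra.
have p3 : kappa * L ^+ 2 <= L ^+ 2 by rewrite ler_piMl//; lra.
have p4 : rho * (kappa * (X ^+ 2 + L ^+ 2)) <= rho * ((1 / 4 + A) * X ^+ 2 + L ^+ 2).
  by rewrite (ler_wpM2l (ltW r0))// mulrDr; lra.
have := le_trans ce p1; lra.
Qed.

Section System.
Variables (b : R) (rho A X L dX dL : R -> R) (eps kappa : R).
Hypotheses (lrho : locally_integrable `]b, +oo[ rho)
  (hX : ac_with_derivative b X dX) (hL : ac_with_derivative b L dL)
  (XL0 : forall x, b < x -> 0 < L x ^+ 2 + X x ^+ 2)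
  (eps0 : 0 <= eps) (epsk : 2 * eps <= kappa) (kappa1 : 2 * kappa <= 1)
  (sys : {ae leb, forall x, b < x ->
     near_system (rho x) (A x) eps (X x) (L x) (dX x) (dL x)}).

(** X L' - L X' is at most - kappa rho (X^2 + L^2), so the angle of (L, X) decreases
    at the rate kappa rho. *)
Lemma system_rotates : (forall x, b < x -> A x <= - (1 / 4) - 2 * kappa) ->
  exists phi rad : R -> R,
    [/\ forall x, b < x -> {for x, continuous phi},
        forall x, b < x -> [/\ 0 < rad x, L x = rad x * sin (phi x) &
                               X x = rad x * cos (phi x)] &
        forall x y, b < x -> x <= y ->
          phi y - phi x <= - kappa * \int[leb]_(t in `[x, y]) rho t].
Proof.
move=> Ak; have [phi [hphi [rad Hrad]]] := ac_angle hL hX XL0.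
exists phi, rad; split => //; first exact: ac_continuous hphi.
move=> x y bx xy; have [lphi Hphi] := hphi; rewrite Hphi// -(intZ lrho)//.
apply: (int_le lphi (locally_integrable_scale _ lrho)) => //.
move: sys; apply: ae_imply => t + /andP[xt _]; have bt := lt_le_trans bx xt.
move=> /(_ bt)/(rotation_rate eps0 epsk kappa1 (Ak t bt)) H.
by rewrite ler_pdivrMr ?XL0// (addrC (L t ^+ 2)).
Qed.

(** (X L)' >= rho X L, so the double cone X L > 0 cannot be left.  Either the
    curve enters it, and X keeps its sign from then on (k = 0), or it stays in the
    complementary double cone, and X - L keeps its sign (k = 1). *)
Lemma system_trapped : (forall x, b < x -> - (1 / 4) + 2 * kappa <= A x) ->
  exists x0 s k : R, [/\ b <= x0, 0 <= k &
    forall x, x0 < x -> 0 < s * (X x - k * L x)].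
Proof.
move=> Ak; pose x1 := b + 1; have bx1 : b < x1 by rewrite ltrDl.
have hT := primitive_ac bx1 lrho; set T := primitive x1 rho in hT.
have hQ := ac_mul (ac_expR (ac_scale (-1) hT)) (ac_mul hX hL).
have cX := ac_continuous hX; have cL := ac_continuous hL.
have mono x y : b < x -> x <= y ->
    expR (-1 * T x) * (X x * L x) <= expR (-1 * T y) * (X y * L y).
  move=> bx xy; apply: (ac_monotone hQ) => //.
  move: sys; apply: ae_imply => t + /andP[xt _]; have bt := lt_le_trans bx xt.
  move=> /(_ bt)/(product_growth eps0 epsk kappa1 (Ak t bt)) H.
  rewrite (_ : _ + _ = expR (-1 * T t) * (dX t * L t + dL t * X t - rho t * (X t * L t)));
    last by ring.
  by rewrite mulr_ge0 ?expR_ge0// subr_ge0.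
have [[x0 bx0 Q0]|Qneg] := pselect (exists2 x0, b < x0 & 0 < X x0 * L x0).
  have Xn x : x0 < x -> X x != 0.
    move=> x0x; have := mono x0 x bx0 (ltW x0x).
    have : 0 < expR (-1 * T x0) * (X x0 * L x0) by rewrite mulr_gt0 ?expR_gt0.
    move=> /lt_le_trans/[apply]; rewrite pmulr_rgt0 ?expR_gt0//.
    by apply: contraTN => /eqP ->; rewrite mul0r ltxx.
  have [s Hs] := continuous_sign (fun x x0x => cX x (lt_trans bx0 x0x)) Xn.
  exists x0, s, 0; split => //; first exact: ltW.
  by move=> x x0x; rewrite mul0r subr0 Hs.
have XLn x : b < x -> X x - L x != 0.
  move=> bx; apply/negP; rewrite subr_eq0 => /eqP E; apply: Qneg; exists x => //.
  by have := XL0 bx; rewrite E -expr2; have := sqr_ge0 (L x); lra.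
have [s Hs] := continuous_sign
  (fun x bx => cvgB (cX x bx) (cL x bx)) XLn.
by exists b, s, 1; split => // x bx; rewrite mul1r Hs.
Qed.

End System.
End SlowSystems.


(** * Error terms of the perturbation and averaging *)

Section Coupling.
Context {R : realType}.

(** One of the two terms of the perturbation: f stands for u0 or pu0, w for the
    remainder of v0 - beta u0 or of its quasi-derivative, and Y for the solution.
    In terms of f / al, of size M, and of w / (al * be), of size eta, all powers of
    al and be cancel. *)
Lemma coupling_error (M eta mu rho al be f w X c e : R) : 1 <= M -> 0 <= eta -> eta <= 1 ->
  0 < al -> be != 0 -> 0 <= rho -> `|f| <= M * al -> `|w| <= eta * (al * `|be|) ->
  `|e| <= eta ->
  let Delta := mu * (rho * be / (al ^+ 2 * be ^+ 2)) * (1 + e) in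
  let Y := X * f + c * w in
  `|Delta * (w * Y)| <= rho * (2 * `|mu| * M ^+ 2 * eta * (`|X| + `|be * c|)) /\
  `|be * (Delta * (f * Y)) - rho * (mu * (f ^+ 2 / al ^+ 2) * X)|
    <= rho * (3 * `|mu| * M ^+ 2 * eta * (`|X| + `|be * c|)).
Proof.
move=> M1 eta0 eta1 al0 be0 rho0 fM wM ee Delta Y.
have al1 := lt0r_neq0 al0.
pose phi := f / al; pose om := w / (al * be).
have phiM : `|phi| <= M.
  by rewrite /phi normrM normfV (gtr0_norm al0) ler_pdivrMr.
have omM : `|om| <= eta.
  rewrite /om normrM normfV normrM (gtr0_norm al0) ler_pdivrMr//.
  by rewrite mulr_gt0// normr_gt0.
have M0 : 0 <= M by lra.
have e1 : `|1 + e| <= 2.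
  by apply: (le_trans (ler_normD _ _)); rewrite normr1; lra.
set D := be * c.
have -> : Delta * (w * Y) = rho * (mu * (1 + e) * om * (X * phi + D * om)).
  by rewrite /Delta /Y /D /om /phi; field; rewrite al1 be0.
have -> : be * (Delta * (f * Y)) - rho * (mu * (f ^+ 2 / al ^+ 2) * X)
   = rho * (mu * (e * phi ^+ 2 * X + (1 + e) * phi * om * D)).
  by rewrite /Delta /Y /D /om /phi; field; rewrite al1 be0.
clearbody phi om D.
have YB : `|X * phi + D * om| <= M * (`|X| + `|D|).
  apply: (le_trans (ler_normD _ _)); rewrite !normrM mulrDr (mulrC M) (mulrC M).
  apply: lerD; first by rewrite ler_wpM2l.
  by rewrite ler_wpM2l//; apply: (le_trans omM); lra.
rewrite !(normrM rho) (ger0_norm rho0); split; rewrite ler_wpM2l//.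
  have MT0 : 0 <= M * (`|X| + `|D|) by rewrite mulr_ge0// addr_ge0.
  apply: (@le_trans _ _ (`|mu| * (2 * (eta * (M * (M * (`|X| + `|D|))))))).
    rewrite !normrM -!mulrA ler_wpM2l//; apply: ler_pM => //.
    by apply: ler_pM => //; apply: (le_trans YB); rewrite ler_peMl.
  by rewrite le_eqVlt; apply/orP; left; apply/eqP; ring.
apply: (@le_trans _ _ (`|mu| * (3 * M ^+ 2 * eta * (`|X| + `|D|)))); last first.
  by rewrite le_eqVlt; apply/orP; left; apply/eqP; ring.
rewrite normrM.
rewrite ler_wpM2l//; apply: (le_trans (ler_normD _ _)).
rewrite !normrM.
have h1 : `|e| * (`|phi| * `|phi|) * `|X| <= eta * M ^+ 2 * `|X|.
  by rewrite ler_wpM2r// ler_pM// ?mulr_ge0// expr2 ler_pM.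
have h2 : `|1 + e| * `|phi| * `|om| * `|D| <= 2 * M ^+ 2 * eta * `|D|.
  rewrite ler_wpM2r// ler_pM// ?mulr_ge0// ler_pM//.
  by apply: (le_trans phiM); rewrite expr2 ler_peMl.
apply: (le_trans (lerD h1 h2)); rewrite -subr_ge0.
have : 0 <= M ^+ 2 * eta * `|X| by rewrite !mulr_ge0.
have : 0 <= M ^+ 2 * eta * `|D| by rewrite !mulr_ge0.
lra.
Qed.

End Coupling.


Section Averaging.
Context {R : realType}.
Local Notation leb := (@lebesgue_measure R).

Lemma measurable_inv_pos (a : R) (f : R -> R) : measurable_fun `]a, +oo[ f ->
  (forall x, a < x -> 0 < f x) -> measurable_fun `]a, +oo[ (fun x => (f x)^-1).
Proof.
move=> mf f0.
have minv : measurable_fun `](0 : R), +oo[ (fun z : R => z^-1).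
  apply: continuous_measurable_itv => t t0.
  by apply: inv_continuous; rewrite gt_eqF.
apply: (measurable_comp (F := `](0 : R), +oo[) _ _ minv mf) => //.
move=> _ [t + <-] /=; rewrite !in_itv/= !andbT.
by rewrite in_itv/= andbT; exact: f0.
Qed.

(** With H' = rho F, let K be H minus its running average.  Then K' is rho F minus
    the running average of rho F, and the latter is rho times the running average of
    F up to an error controlled by the oscillation of rho on [x, x + l].  K is small
    because H varies by at most C times the integral of rho on such an interval. *)
Lemma averaging_corrector (b l C e : R) (rho F : R -> R) : 0 < l -> 0 <= C -> 0 < e ->
  locally_integrable `]b, +oo[ rho -> measurable_fun `]b, +oo[ F ->
  (forall x, b < x -> `|F x| <= C) ->
  {ae leb, forall x, b < x -> 0 < rho x} ->
  {ae leb, forall x, b < x -> rho x <= e / (C + 1) / l} ->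
  {ae leb, forall x, b < x ->
     l^-1 * \int[leb]_(t in `[0, l]) `|rho (x + t) - rho x| <= e / (C + 1) * rho x} ->
  exists K dK, [/\ ac_with_derivative b K dK, forall x, b < x -> `|K x| <= e &
    {ae leb, forall x, b < x ->
       `|rho x * F x - dK x - rho x * running_average F l x| <= rho x * e}].
Proof.
move=> l0 C0 e0 lr mFb FCb rho0 S2 S3.
have C1 : 0 < C + 1 by lra.
have CeC : C * (e / (C + 1)) <= e.
  by rewrite mulrA ler_pdivrMr// mulrC; apply: ler_wpM2l; [exact: ltW|lra].
have bl x : b < x -> b < x + l by move=> bx; exact: (lt_trans bx (ltr_pwDr l0 (lexx x))).
have xl x : x <= x + l by rewrite lerDl ltW.
have lF : locally_integrable `]b, +oo[ F.
  exact: (locally_integrable_bounded (locally_integrable_cst b C) mFb).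
have lrF : locally_integrable `]b, +oo[ (fun t => rho t * F t).
  apply: (locally_integrable_mul lr mFb) => x z bx xz.
  by exists C => t /andP[xt _]; apply: FCb; exact: lt_le_trans xt.
have bb1 : b < b + 1 by rewrite ltrDl.
pose H := primitive (b + 1) (fun t => rho t * F t).
have hH : ac_with_derivative b H (fun t => rho t * F t) by exact: primitive_ac.
have lH := locally_integrable_continuous (ac_continuous hH).
pose S := primitive (b + 1) H.
have hS : ac_with_derivative b S H by exact: primitive_ac.
have [_ HE] := hH; have [_ SE] := hS.
exists (fun x => H x - l^-1 * (S (x + l) - S x)).
exists (fun x => rho x * F x - l^-1 * (H (x + l) - H x)).
split; first exact: ac_sub hH (ac_scale l^-1 (ac_sub (ac_shift (ltW l0) hS) hS)).
- move=> x bx.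
  have HB t : x <= t -> t <= x + l -> `|H t - H x| <= e.
    move=> xt tl; rewrite HE//.
    apply: (le_trans (int_norm_le lrF t bx)).
    apply: (@le_trans _ _ (\int[leb]_(s in `[x, t]) (e / l))); last first.
      rewrite int_cst// mulrAC ler_pdivrMr//; apply: ler_wpM2l; first exact: ltW.
      by rewrite lerBlDl.
    apply: (int_le (locally_integrable_norm lrF) (locally_integrable_cst b _)) => //.
    apply: ae_imply2 rho0 S2 => s r0 rs /andP[xs _]; have bs := lt_le_trans bx xs.
    have {}r0 := r0 bs; have {}rs := rs bs.
    rewrite normrM (gtr0_norm r0).
    apply: (@le_trans _ _ (e / (C + 1) / l * C)).
      by apply: ler_pM => //; [exact: ltW|exact: FCb].
    by rewrite mulrAC ler_wpM2r ?invr_ge0 ?(ltW l0)// mulrC.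
  rewrite (SE x (x + l) bx (xl x)).
  have lHx : locally_integrable `]b, +oo[ (fun t => H x - H t).
    exact: locally_integrableB (locally_integrable_cst b (H x)) lH.
  have -> : H x - l^-1 * \int[leb]_(t in `[x, x + l]) H t
      = l^-1 * \int[leb]_(t in `[x, x + l]) (H x - H t).
    rewrite (intB (locally_integrable_cst b (H x)) lH)// int_cst//.
    by rewrite mulrBr (addrC x l) addrK mulrCA mulVf ?mulr1// gt_eqF.
  rewrite normrM normfV (gtr0_norm l0) ler_pdivrMl//.
  apply: (le_trans (int_norm_le lHx _ bx)).
  have -> : l * e = \int[leb]_(t in `[x, x + l]) e.
    by rewrite int_cst// (addrC x l) addrK mulrC.
  apply: (int_le (locally_integrable_norm lHx) (locally_integrable_cst b _)) => //.
  by apply: aeW => t /andP[xt tl]; rewrite distrC HB.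
apply: ae_imply2 rho0 S3 => x r0 s3 bx; have {}r0 := r0 bx; have {}s3 := s3 bx.
rewrite opprB addrCA subrr addr0 (HE x (x + l) bx (xl x)) /running_average.
have lrF2 := locally_integrable_scale (rho x) lF.
rewrite mulrCA -mulrBr -(intZ lF)// -(intB lrF lrF2)//.
rewrite normrM normfV (gtr0_norm l0).
have ldiff : locally_integrable `]b, +oo[ (fun t => rho t - rho x).
  exact: locally_integrableB lr (locally_integrable_cst b _).
have ldF := locally_integrableB lrF lrF2.
have step : `|\int[leb]_(t in `[x, x + l]) (rho t * F t - rho x * F t)|
    <= C * \int[leb]_(t in `[x, x + l]) `|rho t - rho x|.
  apply: (le_trans (int_norm_le ldF _ bx)).
  rewrite -(intZ (locally_integrable_norm ldiff))//.
  apply: (int_le (locally_integrable_norm ldF)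
    (locally_integrable_scale C (locally_integrable_norm ldiff))) => //.
  apply: aeW => t /andP[xt _] /=; rewrite -mulrBl normrM mulrC ler_wpM2r//.
  by apply: FCb; exact: lt_le_trans xt.
have shiftE : \int[leb]_(t in `[x, x + l]) `|rho t - rho x|
    = \int[leb]_(t in `[0, l]) `|rho (x + t) - rho x|.
  have := @int_shift R x 0 l (fun t => `|rho t - rho x|).
  rewrite add0r (addrC l) => ->.
    by apply: eq_Rintegral => t _; rewrite (addrC t).
  have [mn _ _] := locally_integrable_norm ldiff.
  apply: measurable_funS mn => // t /=; rewrite !in_itv/= andbT => /andP[xt _].
  exact: lt_le_trans xt.
rewrite shiftE in step.
have l1 : 0 <= l^-1 by rewrite invr_ge0 ltW.
apply: (le_trans (ler_wpM2l l1 step)); rewrite mulrCA.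
apply: (le_trans (ler_wpM2l C0 s3)).
by rewrite mulrA mulrC ler_wpM2l// ltW.
Qed.

(** The shear L = D - (K + 1/2) X absorbs K', that is, the rapidly varying part of
    rho F; the additional terms contain K itself and are errors.  The derivative of
    L is written in the form delivered by the product rule. *)
Lemma sheared_near_system (rho e eps X D K dX dD dK F A : R) :
  0 < rho -> 0 < e -> e <= 1 / 4 -> 8 * e <= eps -> `|K| <= e ->
  `|dX - rho * D| <= rho * (e * (`|X| + `|D|)) ->
  `|dD - rho * (D + F * X)| <= rho * (e * (`|X| + `|D|)) ->
  `|rho * F - dK - rho * A| <= rho * e ->
  near_system rho A eps X (D - (K + 1 / 2) * X) dX
    (dD - ((dK + 0) * X + dX * (K + 1 / 2))).
Proof.
move=> r0 e0 e4 e8 Ke; set L := D - (K + 1 / 2) * X.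
have DE : D = L + (K + 1 / 2) * X by rewrite /L; ring.
rewrite DE; clearbody L; clear D DE; move: (e0) (r0) => /ltW e0' /ltW r0'.
set D := L + _; set d1 := dX - _; set d2 := dD - _; set kap := _ - _ - _ => E1 E2 KA.
pose T := `|X| + `|L|.
have T0 : 0 <= T by rewrite addr_ge0.
have K2 : `|K + 1 / 2| <= 3 / 4.
  apply: (le_trans (ler_normD _ _)); rewrite [X in _ + X]ger0_norm ?divr_ge0//.
  by move: Ke e4; clear; lra.
have DT : `|X| + `|D| <= 2 * T.
  have : `|D| <= `|L| + 3 / 4 * `|X|.
    by apply: (le_trans (ler_normD _ _)); rewrite lerD2l normrM ler_wpM2r.
  by have := normr_ge0 X; have := normr_ge0 L; rewrite /T; clear; lra.
have D1 : `|D| <= 2 * T by apply: le_trans DT; rewrite lerDr.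
have XT : `|X| <= 1 * T by rewrite mul1r lerDl.
have B z n : z <= n * T -> rho * (e * z) <= rho * (e * T) * n.
  move=> zn; rewrite -mulrA ler_wpM2l// -mulrA ler_wpM2l//.
  by rewrite mulrC.
have E1' := le_trans E1 (B _ _ DT); have E2' := le_trans E2 (B _ _ DT).
have KB z n : `|z| <= n * T -> `|rho * (K * z)| <= rho * (e * T) * n.
  move=> zn; apply: le_trans (B _ _ zn).
  by rewrite normrM (gtr0_norm r0) ler_wpM2l// normrM ler_wpM2r.
have fin : rho * (e * T) * 8 <= rho * (eps * T).
  by rewrite -mulrA ler_wpM2l// mulrAC ler_wpM2r// mulrC.
have ReT : 0 <= rho * (e * T) by rewrite !mulr_ge0.
set G := rho * (e * T) in B E1' E2' KB fin ReT.
have kapX : `|kap * X| <= G * 1.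
  apply: le_trans (B _ _ XT); rewrite normrM mulrA ler_wpM2r//.
have t2 : `|(K + 1 / 2) * d1| <= G * 2.
  by apply: le_trans E1'; rewrite normrM ler_piMl//; apply: (le_trans K2); lra.
have t3 := KB _ _ D1; have t4 := KB _ _ XT.
split => //.
- have -> : dX - rho * (L + X / 2) = d1 + rho * (K * X) by rewrite /d1 /D; field.
  apply: le_trans fin; apply: (le_trans (ler_normD _ _)).
  by move: E1' t4 ReT; clear; lra.
- have -> : dD - ((dK + 0) * X + dX * (K + 1 / 2)) - rho * (L / 2 + (1 / 4 + A) * X)
    = d2 - (K + 1 / 2) * d1 + kap * X - rho * (K * D) + rho * (K * X) / 2.
    by rewrite /d2 /d1 /kap /D; field.
  have t4' : `|rho * (K * X) / 2| <= G * 1.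
    by apply: le_trans t4; rewrite [leLHS]normrM ler_piMr// ger0_norm ?invr_ge0// invf_le1// ler1n.
  apply: le_trans fin.
  apply: (@le_trans _ _ (G * 2 + G * 2 + G * 1 + G * 2 + G * 1)); last by lra.
  apply: (le_trans (ler_normD _ _)); apply: lerD => //.
  apply: (le_trans (ler_normB _ _)); apply: lerD => //.
  apply: (le_trans (ler_normD _ _)); apply: lerD => //.
  by apply: (le_trans (ler_normB _ _)); apply: lerD.
Qed.

End Averaging.


(** * The perturbed solution in the basis u0, v0 *)

Section Asymptotics.
Context {R : realType}.
Local Notation leb := (@lebesgue_measure R).

Variables (a : R) (P0 Q0 P1 Q1 u0 pu0 v0 pv0 y py alpha beta dbeta : R -> R).
Variables (mu nu M : R).

Let rho x := dbeta x / beta x.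
Let w x := v0 x - beta x * u0 x.
Let pw x := pv0 x - beta x * pu0 x.

Hypotheses
  (hu0 : ac_with_derivative a u0 (fun x => P0 x * pu0 x))
  (hpu0 : ac_with_derivative a pu0 (fun x => Q0 x * u0 x))
  (hv0 : ac_with_derivative a v0 (fun x => P0 x * pv0 x))
  (hpv0 : ac_with_derivative a pv0 (fun x => Q0 x * v0 x))
  (hy : ac_with_derivative a y (fun x => P1 x * py x))
  (hpy : ac_with_derivative a py (fun x => Q1 x * y x))
  (wronskian1 : forall x, a < x -> u0 x * pv0 x - pu0 x * v0 x = 1)
  (y_neq0 : forall x, a < x -> 0 < y x ^+ 2 + py x ^+ 2)
  (malpha : measurable_fun `]a, +oo[ alpha)
  (alpha0 : forall x, a < x -> 0 < alpha x)
  (beta0 : forall x, a < x -> beta x != 0)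
  (hbeta : ac_with_derivative a beta dbeta)
  (M1 : 1 <= M)
  (u0_bigO : exists X, forall x, X < x ->
     `|u0 x| <= M * alpha x /\ `|pu0 x| <= M * alpha x)
  (w_littleo : forall eta : R, 0 < eta -> exists X, forall x, X < x ->
     `|w x| <= eta * (alpha x * `|beta x|) /\ `|pw x| <= eta * (alpha x * `|beta x|))
  (rho0 : {ae leb, forall x, a < x -> 0 < rho x})
  (rho_o1 : forall eta : R, 0 < eta -> exists X, {ae leb, forall x, X < x -> rho x <= eta})
  (rho_average : forall l eta : R, 0 < l -> 0 < eta -> exists X, {ae leb, forall x, X < x ->
     l^-1 * \int[leb]_(t in `[0, l]) `|rho (x + t) - rho x| <= eta * rho x})
  (Delta_q : forall eta : R, 0 < eta -> exists X, {ae leb, forall x, X < x ->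
     exists2 e, `|e| <= eta &
       Q1 x - Q0 x = mu * (dbeta x / (alpha x ^+ 2 * beta x ^+ 2)) * (1 + e)})
  (Delta_p : forall eta : R, 0 < eta -> exists X, {ae leb, forall x, X < x ->
     exists2 e, `|e| <= eta &
       P0 x - P1 x = nu * (dbeta x / (alpha x ^+ 2 * beta x ^+ 2)) * (1 + e)}).

(** The solution y is c1 u0 + c2 v0, and X u0 + c2 w once v0 is split into
    beta u0 + w.  The weighted coefficients X and D = beta c2 move at the rate rho,
    and X' = rho D, D' = rho (D + F X) up to o(rho). *)
Let c2 x := u0 x * py x - pu0 x * y x.
Let c1 x := pv0 x * y x - v0 x * py x.
Let X x := c1 x + beta x * c2 x.
Let D x := beta x * c2 x.
Let F t := mu * (u0 t ^+ 2 / alpha t ^+ 2) + nu * (pu0 t ^+ 2 / alpha t ^+ 2).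

Let dX x := dbeta x * c2 x
  - ((Q1 x - Q0 x) * (w x * y x) + (P0 x - P1 x) * (pw x * py x)).
Let dD x := dbeta x * c2 x
  + beta x * ((Q1 x - Q0 x) * (u0 x * y x) + (P0 x - P1 x) * (pu0 x * py x)).

Let y_E x : a < x -> y x = X x * u0 x + c2 x * w x.
Proof.
move=> ax; rewrite -[LHS]mulr1 -(wronskian1 ax) /X /c1 /c2 /w; ring.
Qed.

Let py_E x : a < x -> py x = X x * pu0 x + c2 x * pw x.
Proof.
move=> ax; rewrite -[LHS]mulr1 -(wronskian1 ax) /X /c1 /c2 /pw; ring.
Qed.

Let hc2 := wronskian_ac hu0 hpu0 hy hpy.

Let hD : ac_with_derivative a D dD.
Proof.
have := ac_mul hbeta hc2.
by congr ac_with_derivative; apply/funext => x; rewrite /dD /c2; ring.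
Qed.

Let hX : ac_with_derivative a X dX.
Proof.
have := ac_add (ac_scale (-1) (wronskian_ac hv0 hpv0 hy hpy)) hD.
congr ac_with_derivative; apply/funext => x; first by rewrite /X /D /c1 /c2; ring.
by rewrite /dX /dD /w /pw; ring.
Qed.

Let lrho : locally_integrable `]a, +oo[ rho.
Proof.
apply: (locally_integrable_mul_continuous (ac_loc hbeta)) => t at_.
by apply: continuousV; [exact: beta0|exact: (ac_continuous hbeta)].
Qed.

Let XD_system eps : 0 < eps -> exists2 b, a <= b & {ae leb, forall x, b < x ->
  `|dX x - rho x * D x| <= rho x * (eps * (`|X x| + `|D x|)) /\
  `|dD x - rho x * (D x + F x * X x)| <= rho x * (eps * (`|X x| + `|D x|))}.
Proof.
move=> eps0; pose C := 3 * (`|mu| + `|nu|) * M ^+ 2.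
have C0 : 0 <= C by rewrite /C mulr_ge0 ?sqr_ge0// mulr_ge0// addr_ge0.
pose eta := Num.min 1 (eps / (C + 1)).
have eta0 : 0 < eta by rewrite lt_min ltr01 divr_gt0//; lra.
have eta1 : eta <= 1 by rewrite ge_min lexx.
have etaC : C * eta <= eps.
  have : eta <= eps / (C + 1) by rewrite ge_min lexx orbT.
  have C1 : 0 < C + 1 by lra.
  by rewrite ler_pdivlMr//; lra.
have [X1 H1] := u0_bigO; have [X2 H2] := w_littleo eta0.
have [X3 H3] := Delta_q eta0; have [X4 H4] := Delta_p eta0.
pose b := Num.max a (Num.max (Num.max X1 X2) (Num.max X3 X4)).
exists b; first by rewrite le_max lexx.
have := ae_imply2 (fun x => @conj _ _) H3 H4.
apply: ae_imply2 rho0 => x rx [h3 h4] bx.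
have : [/\ a < x, X1 < x, X2 < x, X3 < x & X4 < x].
  by move: bx; rewrite !gt_max => /and3P[-> /andP[-> ->] /andP[-> ->]].
move=> [ax x1 x2 x3 x4].
have r0 := rx ax; have [f1 f2] := H1 x x1; have [w1 w2] := H2 x x2.
have [eq eq_eta Eq] := h3 x3; have [ep ep_eta Ep] := h4 x4.
have dbE : dbeta x = rho x * beta x by rewrite /rho divfK// beta0.
rewrite dbE in Eq Ep.
have [A1 A2] := coupling_error mu (X x) (c2 x) M1 (ltW eta0) eta1 (alpha0 ax) (beta0 ax)
  (ltW r0) f1 w1 eq_eta.
have [B1 B2] := coupling_error nu (X x) (c2 x) M1 (ltW eta0) eta1 (alpha0 ax) (beta0 ax)
  (ltW r0) f2 w2 ep_eta.
rewrite -Eq -y_E// in A1 A2; rewrite -Ep -py_E// in B1 B2.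
rewrite -/(D x) in A1 A2 B1 B2.
set S := `|X x| + `|D x| in A1 A2 B1 B2 *.
have S0 : 0 <= S by rewrite addr_ge0.
have fin : rho x * (3 * `|mu| * M ^+ 2 * eta * S) + rho x * (3 * `|nu| * M ^+ 2 * eta * S)
    <= rho x * (eps * S).
  rewrite -mulrDr (ler_wpM2l (ltW r0))// -mulrDl ler_wpM2r//.
  by apply: le_trans etaC; rewrite /C le_eqVlt; apply/orP; left; apply/eqP; ring.
have two (m : R) : rho x * (2 * `|m| * M ^+ 2 * eta * S) <= rho x * (3 * `|m| * M ^+ 2 * eta * S).
  rewrite (ler_wpM2l (ltW r0))// (ler_wpM2r S0)// (ler_wpM2r (ltW eta0))//.
  by rewrite (ler_wpM2r (sqr_ge0 M))// ler_wpM2r//; lra.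
split; apply: le_trans fin.
- have -> : dX x - rho x * D x
    = - ((Q1 x - Q0 x) * (w x * y x)) - (P0 x - P1 x) * (pw x * py x).
    by rewrite /dX /D dbE; ring.
  apply: (le_trans (ler_normB _ _)); rewrite normrN.
  by apply: lerD; [exact: (le_trans A1 (two mu))|exact: (le_trans B1 (two nu))].
- have -> : dD x - rho x * (D x + F x * X x)
    = (beta x * ((Q1 x - Q0 x) * (u0 x * y x)) - rho x * (mu * (u0 x ^+ 2 / alpha x ^+ 2) * X x))
    + (beta x * ((P0 x - P1 x) * (pu0 x * py x)) - rho x * (nu * (pu0 x ^+ 2 / alpha x ^+ 2) * X x)).
    by rewrite /dD /D /F dbE; ring.
  by apply: (le_trans (ler_normD _ _)); exact: lerD.
Qed.

Let F_bounded : exists b C, [/\ a <= b, 0 <= C & forall x, b < x -> `|F x| <= C].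
Proof.
have [X1 H1] := u0_bigO.
exists (Num.max a X1), ((`|mu| + `|nu|) * M ^+ 2); split.
- by rewrite le_max lexx.
- by rewrite mulr_ge0 ?sqr_ge0// addr_ge0.
move=> x; rewrite gt_max => /andP[ax /H1[h1 h2]].
have al0 := alpha0 ax.
have B f : `|f| <= M * alpha x -> `|f ^+ 2 / alpha x ^+ 2| <= M ^+ 2.
  move=> fM; have M0 := le_trans ler01 M1.
  rewrite -expr_div_n normrX lerXn2r ?nnegrE//.
  by rewrite normrM normfV (gtr0_norm al0) ler_pdivrMr.
rewrite mulrDl; apply: (le_trans (ler_normD _ _)); rewrite !normrM.
by rewrite -!normrM; apply: lerD; rewrite normrM ler_wpM2l// B.
Qed.

Let mF : measurable_fun `]a, +oo[ F.
Proof.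
have ma : measurable_fun `]a, +oo[ (fun x => (alpha x ^+ 2)^-1).
  apply: measurable_inv_pos; first exact: measurable_funX.
  by move=> x ax; rewrite exprn_gt0// alpha0.
have mc f df : ac_with_derivative a f df -> measurable_fun `]a, +oo[ f.
  by move=> h; apply: continuous_measurable_itv; exact: ac_continuous h.
by apply: measurable_funD; apply: measurable_funM => //; apply: measurable_funM => //;
  apply: measurable_funX; [exact: mc hu0|exact: mc hpu0].
Qed.

(** L is D plus a multiple of X, so the directions of (X, L) and (X, D) are never
    opposite and passing to L does not change the winding by more than a turn. *)
Let averaged_system l eps : 0 < l -> 0 < eps ->
  exists b K L dL, [/\ a <= b,
    ac_with_derivative b X dX /\ ac_with_derivative b L dL,
    forall x, b < x -> `|K x| <= 1 / 4 /\ L x = D x - (K x + 1 / 2) * X x,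
    forall x, b < x -> 0 < L x ^+ 2 + X x ^+ 2 &
    {ae leb, forall x, b < x ->
       near_system (rho x) (running_average F l x) eps (X x) (L x) (dX x) (dL x)}].
Proof.
move=> l0 eps0.
have [b0 [C [ab0 C0 FC]]] := F_bounded.
pose e1 := Num.min (1 / 4) (eps / 8).
have e10 : 0 < e1 by rewrite lt_min !divr_gt0.
have e14 : e1 <= 1 / 4 by rewrite ge_min lexx.
have e18 : 8 * e1 <= eps by rewrite mulrC -ler_pdivlMr// ge_min lexx orbT.
have eC0 : 0 < e1 / (C + 1) by rewrite divr_gt0// ltr_wpDl.
have [b1 ab1 S1] := XD_system e10.
have [b2 S2] := rho_o1 (divr_gt0 eC0 l0).
have [b3 S3] := rho_average l0 eC0.
pose b := Num.max (Num.max b0 b1) (Num.max b2 b3).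
have [b0b b1b b2b b3b] : [/\ b0 <= b, b1 <= b, b2 <= b & b3 <= b].
  by rewrite /b !le_max !lexx !orbT.
have ab : a <= b by exact: le_trans ab0 b0b.
have mFb : measurable_fun `]b, +oo[ F.
  apply: measurable_funS mF => // t /=; rewrite !in_itv/= !andbT; exact: le_lt_trans.
have FCb x : b < x -> `|F x| <= C by move=> bx; apply: FC; exact: le_lt_trans bx.
have late (b' : R) (P : R -> Prop) : b' <= b -> {ae leb, forall x, b' < x -> P x} ->
    {ae leb, forall x, b < x -> P x}.
  by move=> bb; apply: ae_imply => x + bx; apply; exact: le_lt_trans bx.
have [K [dK [hK Ksmall KA]]] := averaging_corrector l0 C0 e10
  (locally_integrable_sub ab lrho) mFb FCb (late _ _ ab rho0) (late _ _ b2b S2)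
  (late _ _ b3b S3).
have hDb := ac_restrict ab hD; have hXb := ac_restrict ab hX.
pose L x := D x - (K x + 1 / 2) * X x.
have hL := ac_sub hDb (ac_mul (ac_add hK (ac_cst b (1 / 2))) hXb).
exists b, K, L; eexists; split => //; first by split; [exact: hXb|exact: hL].
- by move=> x bx; split => //; apply: le_trans e14; exact: Ksmall.
- move=> x bx; have ax := le_lt_trans ab bx.
  rewrite lt0r addr_ge0 ?sqr_ge0// andbT paddr_eq0 ?sqr_ge0// !expf_eq0/=.
  apply/negP => /andP[/eqP Lx /eqP Xx].
  have c20 : c2 x = 0.
    move: Lx; rewrite /L Xx mulr0 subr0 /D => /eqP.
    by rewrite mulf_eq0 (negbTE (beta0 ax)) => /eqP.
  by have := y_neq0 ax; rewrite y_E// py_E// Xx c20 !mul0r addr0 expr0n addr0 ltxx.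
apply: ae_imply2 (late _ _ ab rho0) (ae_imply2 (fun x => @conj _ _) (late _ _ b1b S1) KA).
move=> x r0 [s1 kA] bx; have [E1 E2] := s1 bx.
exact: sheared_near_system (r0 bx) e10 e14 e18 (Ksmall x bx) E1 E2 (kA bx).
Qed.

Section Differences.
Variables (l kappa : R) (th th1 : R -> R).
Hypotheses (l0 : 0 < l) (kappa0 : 0 < kappa) (kappa1 : 2 * kappa <= 1)
  (angle0 : prufer_angle a u0 pu0 th) (angle1 : prufer_angle a y py th1).

Let Delta t := th1 t - th t.

Let cDelta x : a < x -> {for x, continuous Delta}.
Proof.
by move=> ax; apply: cvgB; [exact: angle1.1|exact: angle0.1].
Qed.

(** The Wronskian c2 of u0 and y has the sign of - sin Delta; where it vanishes,
    y = c1 u0, and c1 has the sign of cos Delta. *)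
Let Delta_direction x : a < x -> exists r r' : R, [/\ 0 < r, 0 < r',
  c2 x = - (r * sin (Delta x)) & c2 x = 0 -> r * cos (Delta x) = r' * c1 x].
Proof.
move=> ax; have [_ [rad0 H0]] := angle0; have [_ [rad1 H1]] := angle1.
have [r00 ru rpu] := H0 x ax; have [r10 ry rpy] := H1 x ax.
exists (rad0 x * rad1 x), (rad0 x ^+ 2); split.
- exact: mulr_gt0.
- exact: exprn_gt0.
- by rewrite /c2 /Delta ru rpu ry rpy sinB; ring.
move=> c20; have Ey := y_E ax; have Epy := py_E ax.
rewrite /X c20 mulr0 addr0 mul0r addr0 in Ey Epy.
rewrite /Delta cosB.
have -> : rad0 x * rad1 x * (cos (th1 x) * cos (th x) + sin (th1 x) * sin (th x))
   = u0 x * y x + pu0 x * py x by rewrite ru rpu ry rpy; ring.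
rewrite {1}Ey {1}Epy.
rewrite (_ : _ + _ = c1 x * (u0 x ^+ 2 + pu0 x ^+ 2)); last by ring.
rewrite ru rpu mulrC; congr (_ * _); rewrite -[RHS]mulr1 -(cos2Dsin2 (th x)); ring.
Qed.

(** The trapping functional X - k L is a positive multiple of c1 where c2 vanishes.
    So c1 has a fixed sign there, and Delta avoids either pi or 0 modulo 2 pi. *)
Lemma trapped_difference :
  (exists X0, forall x, X0 < x -> - (1 / 4) + 2 * kappa <= running_average F l x) ->
  exists X0 N, forall x, X0 < x -> `|th1 x - th x| <= N.
Proof.
move=> [X0 HA].
have k2 : 0 < kappa / 2 by rewrite divr_gt0.
have [b [K [L [dL [ab [hXb hLb] HKL n0 sys]]]]] := averaged_system l0 k2.
pose b' := Num.max b X0.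
have bb' : b <= b' by rewrite le_max lexx.
have X0b' : X0 <= b' by rewrite le_max lexx orbT.
have sys' : {ae leb, forall x, b' < x ->
    near_system (rho x) (running_average F l x) (kappa / 2) (X x) (L x) (dX x) (dL x)}.
  by apply: ae_imply sys => x + bx; apply; exact: le_lt_trans bx.
have n0' x : b' < x -> 0 < L x ^+ 2 + X x ^+ 2.
  by move=> bx; apply: n0; exact: le_lt_trans bx.
have HA' x : b' < x -> - (1 / 4) + 2 * kappa <= running_average F l x.
  by move=> bx; apply: HA; exact: le_lt_trans bx.
have lr := locally_integrable_sub (le_trans ab bb') lrho.
have ke : 2 * (kappa / 2) <= kappa by rewrite mulrCA divff ?mulr1.
have [x0 [s [k [bx0 k0 Hs]]]] := system_trapped lr (ac_restrict bb' hXb)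
  (ac_restrict bb' hLb) n0' (ltW k2) ke kappa1 sys' HA'.
have ax0 : a <= x0 by exact: le_trans ab (le_trans bb' bx0).
have sgn x : x0 < x -> c2 x = 0 -> 0 < s * c1 x.
  move=> x0x c20; have := Hs x x0x.
  have [Kx ->] := HKL x (le_lt_trans (le_trans bb' bx0) x0x).
  rewrite /X /D c20 mulr0 addr0 sub0r.
  rewrite (_ : s * _ = s * c1 x * (1 + k * (K x + 1 / 2))); last by ring.
  rewrite pmulr_lgt0//; move: Kx; rewrite ler_norml => /andP[Kx _].
  have : 0 <= k * (K x + 1 / 2) by rewrite mulr_ge0//; lra.
  lra.
have x01 : x0 < x0 + 1 by lra.
have bounded v : (forall x, x0 < x -> cos (Delta x - v) != 1) ->
    exists X0 N, forall x, X0 < x -> `|th1 x - th x| <= N.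
  move=> Hv; exists (x0 + 1), (`|Delta (x0 + 1)| + pi *+ 2) => x x1x.
  rewrite -/(Delta x) -(subrK (Delta (x0 + 1)) (Delta x)) addrC.
  apply: (le_trans (ler_normD _ _)); rewrite lerD2l.
  apply: (avoid_residue_bounded (v := v)); first exact: ltW.
    by move=> t /andP[xt _]; apply: cDelta; lra.
  by move=> t /andP[xt _]; apply: Hv; lra.
have dir (e : R) x : x0 < x -> e ^+ 2 = 1 -> cos (Delta x) = e -> 0 < s * e.
  move=> x0x e1 ce; have [r [r' [r0 r'0 cE cc]]] := Delta_direction (le_lt_trans ax0 x0x).
  have sE : sin (Delta x) = 0.
    have := cos2Dsin2 (Delta x); rewrite ce e1 -[RHS]addr0 => /addrI/eqP.
    by rewrite expf_eq0 => /eqP.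
  have c20 : c2 x = 0 by rewrite cE sE mulr0 oppr0.
  have := sgn x x0x c20; have := cc c20; rewrite ce => E.
  have -> : s * c1 x = s * e * (r / r').
    by rewrite -mulrA (mulrA e) (mulrC e) E mulrC; field; exact: lt0r_neq0.
  by rewrite pmulr_lgt0// divr_gt0.
have [s0|s0] := leP s 0.
  apply: (bounded 0) => x x0x; rewrite subr0; apply/eqP => ce.
  by have := dir 1 x x0x (expr1n _ _) ce; rewrite mulr1; lra.
apply: (bounded pi) => x x0x; rewrite cosB cospi sinpi mulr0 addr0 mulrN1.
apply/eqP => ce; have ce' : cos (Delta x) = -1 by lra.
by have := dir (-1) x x0x _ ce'; rewrite sqrrN expr1n => /(_ erefl); lra.
Qed.

(** Minimality of u0, for the competitors v0 - k u0. *)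
Let dominated := forall k, exists C X, forall x, X < x ->
  `|u0 x| <= C * Num.max `|v0 x - k * u0 x| `|pv0 x - k * pu0 x| /\
  `|pu0 x| <= C * Num.max `|v0 x - k * u0 x| `|pv0 x - k * pu0 x|.

(** If rho is integrable at infinity then beta has a finite limit k, and
    v0 - k u0 = o(alpha): a minimal solution is then o(alpha) as well. *)
Let minimal_small (B eps : R) :
  dominated ->
  (forall x, a + 1 <= x -> \int[leb]_(t in `[a + 1, x]) rho t <= B) -> 0 < eps ->
  exists X, forall x, X < x -> `|u0 x| <= eps * alpha x /\ `|pu0 x| <= eps * alpha x.
Proof.
move=> Hmin TB eps0.
have a1 : a < a + 1 by lra.
have hT := primitive_ac a1 lrho; set T := primitive (a + 1) rho in hT.
have TE x : a + 1 <= x -> T x = \int[leb]_(t in `[a + 1, x]) rho t.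
  by rewrite /T /primitive => ->.
have Tmono x z : a < x -> x <= z -> T x <= T z.
  move=> ax xz; apply: (ac_monotone hT) => //.
  apply: ae_imply rho0 => t r0 /andP[xt _]; apply/ltW/r0; exact: lt_le_trans xt.
pose A := [set T x | x in [set x | a + 1 <= x]].
have hA : has_sup A.
  split; first by exists (T (a + 1)); exists (a + 1) => //=.
  by exists B => _ [x /= x1 <-]; rewrite TE// TB.
have Tsup x : a + 1 <= x -> T x <= sup A.
  by move=> x1; apply: sup_upper_bound => //; exists x.
have betaE x : a < x -> beta x = beta (a + 1) * expR (T x).
  move=> ax.
  have : {ae leb, forall x, a < x -> dbeta x = rho x * beta x}.
    by apply: aeW => t at_; rewrite /rho divfK// beta0.
  move=> /(ac_linear hbeta hT)/(_ x (a + 1) ax a1).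
  rewrite {2}/T primitive_base oppr0 expR0 mul1r => <-.
  by rewrite mulrAC -expRD addNr expR0 mul1r.
pose k := beta (a + 1) * expR (sup A).
have k0 : 0 < `|k| by rewrite normr_gt0 mulf_neq0 ?beta0// gt_eqF// expR_gt0.
have kbeta x : a + 1 <= x -> `|beta x| <= `|k|.
  move=> x1; rewrite betaE; last by lra.
  rewrite /k !normrM ler_wpM2l// !ger0_norm ?expR_ge0// ler_expR; exact: Tsup.
have [C [X1 HC]] := Hmin k.
pose C' := `|C| + 1; have C'0 : 0 < C' by rewrite /C'; have := normr_ge0 C; lra.
pose e := eps / C' / 2; have e0 : 0 < e by rewrite /e !divr_gt0.
have eta0 : 0 < e / `|k| by exact: divr_gt0.
have [X2 H2] := w_littleo eta0; have [X3 H3] := u0_bigO.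
have M0 : 0 < M by exact: lt_le_trans M1.
have [x4 x41 Hx4] : exists2 x4, a + 1 <= x4 & forall x, x4 <= x -> `|beta x - k| <= e / M.
  have cexp : {for sup A, continuous (@expR R)} by exact: continuous_expR.
  have d0 : 0 < e / M / `|beta (a + 1)| by rewrite !divr_gt0// normr_gt0 beta0.
  move/cvgrPdist_lt : cexp => /(_ _ d0)[d /= d1 Hd].
  have [_ [x4 /= x41 <-] Tx4] := sup_adherent d1 hA.
  exists x4 => // x x4x; have ax : a < x by lra.
  rewrite betaE// /k -mulrBr normrM distrC.
  have := Hd (T x); rewrite /ball_/=.
  have Tx : T x <= sup A by apply: Tsup; lra.
  have Tx' : T x4 <= T x by apply: Tmono => //; lra.
  rewrite ger0_norm; last by lra.
  move=> /(_ _)/ltW; rewrite ler_pdivlMr ?normr_gt0 ?beta0// mulrC; apply; lra.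
exists (Num.max (Num.max X1 X2) (Num.max X3 x4)) => x.
rewrite !gt_max => /andP[/andP[x1 x2] /andP[x3 x4x]].
have ax : a < x by lra.
have al0 := alpha0 ax; have ax1 : a + 1 <= x by lra.
have [w1 w2] := H2 x x2; have [f1 f2] := H3 x x3.
have small f z : `|z| <= e / `|k| * (alpha x * `|beta x|) -> `|f| <= M * alpha x ->
    `|z + (beta x - k) * f| <= 2 * e * alpha x.
  move=> zz ff; apply: (le_trans (ler_normD _ _)).
  have t1 : `|z| <= e * alpha x.
    apply: (le_trans zz); rewrite -mulrA ler_pM2l// mulrC ler_pdivrMr//.
    by rewrite ler_pM2l// kbeta.
  have t2 : `|(beta x - k) * f| <= e * alpha x.
    rewrite normrM; apply: (@le_trans _ _ (e / M * (M * alpha x))).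
      by apply: ler_pM => //; apply: Hx4; exact: ltW.
    by rewrite mulrA divfK// gt_eqF.
  lra.
have m : Num.max `|v0 x - k * u0 x| `|pv0 x - k * pu0 x| <= 2 * e * alpha x.
  rewrite ge_max; apply/andP; split.
    rewrite (_ : v0 x - _ = w x + (beta x - k) * u0 x); last by rewrite /w; ring.
    exact: small.
  rewrite (_ : pv0 x - _ = pw x + (beta x - k) * pu0 x); last by rewrite /pw; ring.
  exact: small.
have fin z : `|z| <= C * Num.max `|v0 x - k * u0 x| `|pv0 x - k * pu0 x| ->
    `|z| <= eps * alpha x.
  move=> /le_trans; apply.
  have CC : C <= C' by rewrite /C'; have := ler_norm C; lra.
  have mx0 : 0 <= Num.max `|v0 x - k * u0 x| `|pv0 x - k * pu0 x|.
    by rewrite le_max normr_ge0.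
  apply: (@le_trans _ _ (C' * (2 * e * alpha x))).
    by apply: (le_trans (ler_wpM2r mx0 CC)); rewrite ler_pM2l.
  rewrite le_eqVlt; apply/orP; left; apply/eqP; rewrite /e; field; exact: lt0r_neq0.
by have [h1 h2] := HC x x1; split; exact: fin.
Qed.

(** Otherwise u0 would be o(alpha), so F and its averages would tend to 0 and not
    stay below - 1/4. *)
Let integral_rho_unbounded X0 : dominated ->
  (forall x, X0 < x -> running_average F l x <= - (1 / 4) - 2 * kappa) ->
  forall B, exists2 x, a + 1 <= x & B < \int[leb]_(t in `[a + 1, x]) rho t.
Proof.
move=> Hmin HA B.
apply: contrapT => nB.
have TB x : a + 1 <= x -> \int[leb]_(t in `[a + 1, x]) rho t <= B.
  by move=> x1; rewrite leNgt; apply/negP => H; apply: nB; exists x.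
pose m := `|mu| + `|nu| + 1.
have m0 : 0 < m by rewrite /m; have := normr_ge0 mu; have := normr_ge0 nu; lra.
pose e := Num.min 1 (1 / 8 / m).
have e0 : 0 < e by rewrite lt_min ltr01/= !divr_gt0.
have e1 : e <= 1 by rewrite ge_min lexx.
have em : m * e <= 1 / 8.
  have : e <= 1 / 8 / m by rewrite ge_min lexx orbT.
  by rewrite ler_pdivlMr// mulrC.
have [X1 H1] := minimal_small Hmin TB e0.
pose x := Num.max a (Num.max X0 X1) + 1.
have [ax x0 x1] : [/\ a < x, X0 < x & X1 < x].
  by rewrite /x; split; rewrite ltr_pwDr// !le_max lexx ?orbT.
have Fe t : x <= t -> `|F t| <= 1 / 8.
  move=> xt; have at_ : a < t by lra.
  have al0 := alpha0 at_; have [f1 f2] := H1 t (lt_le_trans x1 xt).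
  have sq f : `|f| <= e * alpha t -> `|f ^+ 2 / alpha t ^+ 2| <= e.
    move=> fe; rewrite -expr_div_n normrX.
    have fe' : `|f / alpha t| <= e.
      by rewrite normrM normfV (gtr0_norm al0) ler_pdivrMr.
    apply: (@le_trans _ _ (e * 1)); last by rewrite mulr1.
    by rewrite expr2 ler_pM//; exact: le_trans e1.
  apply: (le_trans (ler_normD _ _)); apply: le_trans em.
  have k1 : `|mu * (u0 t ^+ 2 / alpha t ^+ 2)| <= `|mu| * e.
    by rewrite normrM ler_wpM2l// sq.
  have k2 : `|nu * (pu0 t ^+ 2 / alpha t ^+ 2)| <= `|nu| * e.
    by rewrite normrM ler_wpM2l// sq.
  by rewrite /m; lra.
have := HA x x0; rewrite /running_average.
have : - (l / 8) <= \int[leb]_(t in `[x, x + l]) F t.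
  have xl : x <= x + l by rewrite lerDl ltW.
  rewrite (_ : - (l / 8) = \int[leb]_(t in `[x, x + l]) (- (1 / 8))); last first.
    by rewrite int_cst//; ring.
  have iF : leb.-integrable `[x, x + l] (EFin \o F).
    apply: measurable_bounded_integrable => //.
    - by rewrite /= lebesgue_measure_itv/=; case: ifP => _; rewrite ?ltry// -EFinB ltry.
    - apply: measurable_funS mF => // t /=; rewrite !in_itv/= andbT => /andP[xt _].
      exact: lt_le_trans xt.
    - exists (1 / 8); split; first exact: num_real.
      move=> N N8 t /=; rewrite in_itv/= => /andP[xt _].
      by apply: (le_trans (Fe t xt)); exact: ltW.
  apply: le_Rintegral => //.
    exact: locally_integrable_itv (locally_integrable_cst a _) ax.
  move=> t /=; rewrite in_itv/= => /andP[xt _].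
  by have := Fe t xt; rewrite ler_norml => /andP[].
move=> h1; rewrite mulrC ler_pdivrMr// => h2.
by have := l0; have : 0 < kappa * l by [exact: mulr_gt0]; lra.
Qed.

(** The angle phi of (L, X) decreases to - oo because rho is not integrable.  The
    angle psi of (D, X) follows phi, because D is L plus a multiple of X; and
    Delta follows psi or - psi, according to the sign of beta, by
    Delta_direction. *)
Lemma unbounded_difference :
  (forall x, a < x -> 0 < beta x) \/ (forall x, a < x -> beta x < 0) ->
  dominated ->
  (exists X0, forall x, X0 < x -> running_average F l x <= - (1 / 4) - 2 * kappa) ->
  (forall N, exists X0, forall x, X0 < x -> N <= th1 x - th x) \/
  (forall N, exists X0, forall x, X0 < x -> th1 x - th x <= N).
Proof.
move=> beta_sign Hmin [X0 HA].
have Tinf := integral_rho_unbounded Hmin HA.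
have k2 : 0 < kappa / 2 by rewrite divr_gt0.
have [b [K [L [dL [ab [hXb hLb] HKL n0 sys]]]]] := averaged_system l0 k2.
pose b' := Num.max b X0.
have bb' : b <= b' by rewrite le_max lexx.
have X0b' : X0 <= b' by rewrite le_max lexx orbT.
have ab' := le_trans ab bb'.
have sys' : {ae leb, forall x, b' < x ->
    near_system (rho x) (running_average F l x) (kappa / 2) (X x) (L x) (dX x) (dL x)}.
  by apply: ae_imply sys => x + bx; apply; exact: le_lt_trans bx.
have n0' x : b' < x -> 0 < L x ^+ 2 + X x ^+ 2.
  by move=> bx; apply: n0; exact: le_lt_trans bx.
have HA' x : b' < x -> running_average F l x <= - (1 / 4) - 2 * kappa.
  by move=> bx; apply: HA; exact: le_lt_trans bx.
have lr := locally_integrable_sub ab' lrho.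
have ke : 2 * (kappa / 2) <= kappa by rewrite mulrCA divff ?mulr1.
have [phi [rad [cphi radE phi_dec]]] := system_rotates lr (ac_restrict bb' hXb)
  (ac_restrict bb' hLb) n0' (ltW k2) ke kappa1 sys' HA'.
have nD x : b' < x -> 0 < D x ^+ 2 + X x ^+ 2.
  move=> bx; have ax := le_lt_trans ab' bx; have := n0' x bx.
  have [_ ->] := HKL x (le_lt_trans bb' bx) => h.
  rewrite lt0r addr_ge0 ?sqr_ge0// andbT paddr_eq0 ?sqr_ge0// !expf_eq0/=.
  by apply: contraTN h => /andP[/eqP -> /eqP ->]; rewrite mulr0 subr0 expr0n addr0 ltxx.
have [psi [hpsi [rad' rad'E]]] := ac_angle (ac_restrict ab' hD) (ac_restrict ab' hX) nD.
have cpsi := ac_continuous hpsi.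
pose x1 := b' + 1; have bx1 : b' < x1 by rewrite ltrDl.
have ax1 : a < x1 by exact: le_lt_trans bx1.
(* Opposite directions force both coordinates to vanish. *)
have zero (r r' s : R) : 0 < r -> 0 < r' -> r * s = - (r' * s) -> s = 0.
  move=> r0 r'0 E; have : (r + r') * s = 0 by rewrite mulrDl E; ring.
  by move/eqP; rewrite mulf_eq0 gt_eqF ?addr_gt0//= => /eqP.
have no_zero t : sin t = 0 -> cos t = 0 -> False.
  move=> s0 c0; have := cos2Dsin2 t; rewrite s0 c0 expr0n addr0 => /eqP.
  by rewrite eq_sym oner_eq0.
have phi_psi x : x1 <= x -> `|(phi x - psi x) - (phi x1 - psi x1)| <= pi *+ 2.
  move=> x1x; apply: (never_opposite_bounded (h := fun t => phi t - psi t)) => //.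
    by move=> t /andP[xt _]; apply: cvgB; [apply: cphi|apply: cpsi]; lra.
  move=> t /andP[xt _]; have bt : b' < t by lra.
  apply/eqP => /antiparallel[s1 s2].
  have [r0 LE XE] := radE t bt; have [r'0 DE XE'] := rad'E t bt.
  have c0 : cos (psi t) = 0.
    by apply: (zero _ _ _ r'0 r0); rewrite -XE' XE s2 mulrN.
  have [_ LK] := HKL t (le_lt_trans bb' bt).
  have s0 : sin (psi t) = 0.
    apply: (zero _ _ _ r'0 r0).
    by rewrite -DE -mulrN -s1 -LE LK XE' c0; ring.
  exact: no_zero s0 c0.
have opposite x sg : b' < x -> (0 < - sg * beta x) -> sin (psi x) = sg * - sin (Delta x) ->
    cos (psi x) = - cos (Delta x) -> False.
  move=> bx sb s1 s2; have ax := le_lt_trans ab' bx.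
  have [r [r' [r0 r'0 cE cc]]] := Delta_direction ax.
  have [R0 DE XE] := rad'E x bx.
  have sgn0 : sg != 0.
    by apply/eqP => sg0; move: sb; rewrite sg0 oppr0 mul0r ltxx.
  have s0 : sin (Delta x) = 0.
    have : sg * (rad' x + (- sg * beta x) * (r / sg ^+ 2)) * sin (Delta x) = 0.
      have E : beta x * c2 x = rad' x * (sg * - sin (Delta x)) by rewrite -s1 -DE.
      rewrite cE in E.
      have -> : sg * (rad' x + - sg * beta x * (r / sg ^+ 2)) * sin (Delta x)
         = - (rad' x * (sg * - sin (Delta x))) - beta x * r * sin (Delta x).
        by field.
      by rewrite -E; ring.
    move/eqP; rewrite !mulf_eq0 (negbTE sgn0)/= gt_eqF/=; first by move/eqP.
    by rewrite addr_gt0// mulr_gt0// divr_gt0// exprn_even_gt0.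
  have c20 : c2 x = 0 by rewrite cE s0 mulr0 oppr0.
  have c1E := cc c20.
  have Xc : X x = c1 x by rewrite /X c20 mulr0 addr0.
  suff c0 : cos (Delta x) = 0 by exact: no_zero s0 c0.
  apply: (@zero (r / r') (rad' x)) => //; first exact: divr_gt0.
  by rewrite -mulrN -s2 -XE Xc mulrAC c1E; field; exact: lt0r_neq0.
have phi_infty N : exists X0, forall x, X0 < x -> phi x <= N.
  pose I0 := \int[leb]_(t in `[a + 1, x1]) rho t.
  have [x2 x21 Hx2] := Tinf (`|I0| + (`|phi x1| + `|N|) / kappa).
  exists (Num.max x1 x2) => x; rewrite gt_max => /andP[xx1 xx2].
  have := phi_dec x1 x bx1 (ltW xx1).
  have a1x1 : a + 1 <= x1 by rewrite /x1; lra.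
  have a1 : a < a + 1 by lra.
  have C1 := int_cat lrho a1 a1x1 (ltW xx1).
  have C2 := int_cat lrho a1 x21 (ltW xx2).
  have I20 : 0 <= \int[leb]_(t in `[x2, x]) rho t.
    rewrite (_ : 0 = \int[leb]_(t in `[x2, x]) (0 : R)); last by rewrite int_cst ?mul0r// ltW.
    apply: (int_le (locally_integrable_cst a 0) lrho); first by lra.
    by apply: ae_imply rho0 => t r0 /andP[xt _]; apply/ltW/r0; lra.
  set I := \int[leb]_(t in `[x1, x]) rho t in C1 *.
  rewrite -/I0 in C1.
  have : (`|phi x1| + `|N|) / kappa <= I by have := ler_norm I0; lra.
  rewrite ler_pdivrMr// => h1 h2.
  by have := ler_norm (phi x1); have := ler_norm (- N); rewrite normrN; lra.
have close (g : R -> R) : (forall t, b' < t -> {for t, continuous g}) ->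
    (forall t, b' < t -> cos (psi t - g t) != -1) ->
    forall N, exists X0, forall x, X0 < x -> g x <= N.
  move=> cg g1 N.
  have [X2 HX2] := phi_infty (N - 4 * pi + (phi x1 - psi x1) + (psi x1 - g x1)).
  exists (Num.max X2 x1) => x; rewrite gt_max => /andP[x2x x1x].
  have := HX2 x x2x.
  have := phi_psi x (ltW x1x).
  have : `|(psi x - g x) - (psi x1 - g x1)| <= pi *+ 2.
    apply: (never_opposite_bounded (h := fun t => psi t - g t)); first exact: ltW.
      by move=> t /andP[xt _]; apply: cvgB; [apply: cpsi|apply: cg]; lra.
    by move=> t /andP[xt _]; apply: g1; lra.
  rewrite !ler_norml !mulr2n => /andP[h1 h2] /andP[h3 h4] h5; lra.
case: beta_sign => sb.
- left => N.
  have [|t bt|X2 HX2] := close (fun t => - Delta t) _ _ (- N).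
  + by move=> t bt; apply: cvgN; apply: cDelta; lra.
  + apply/eqP => /antiparallel[]; rewrite sinN cosN opprK => s1 s2.
    apply: (opposite t (-1) bt); rewrite ?opprK ?mul1r ?mulN1r ?opprK//.
    by apply: sb; lra.
  + by exists X2 => x /HX2; rewrite lerN2.
- right; apply: (close Delta).
  + by move=> t bt; apply: cDelta; lra.
  + move=> t bt; apply/eqP => /antiparallel[s1 s2].
    apply: (opposite t 1 bt); rewrite ?mul1r//.
    by rewrite mulN1r oppr_gt0; apply: sb; lra.
Qed.

End Differences.
End Asymptotics.


(** * Eventual bounds behind the asymptotic hypotheses *)

Section EventualBounds.
Context {R : realType}.
Local Notation leb := (@lebesgue_measure R).
Local Notation pinfty := (pinfty_nbhs R).

Lemma near_pinfty_ex (P : R -> Prop) : (\forall x \near pinfty_nbhs R, P x) ->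
  exists X, forall x, X < x -> P x.
Proof. by move=> [X [_ HX]]; exists X. Qed.

Lemma pair_norm_le (x y c : R) : `|(x, y)| <= c -> `|x| <= c /\ `|y| <= c.
Proof. by rewrite prod_normE/= ge_max => /andP. Qed.

Lemma eqO_pair (W : normedModType R) (f g : R -> R) (h : R -> W) :
  (fun x => (f x, g x)) =O_pinfty h ->
  exists M, 1 <= M /\ exists X, forall x, X < x ->
    `|f x| <= M * `|h x| /\ `|g x| <= M * `|h x|.
Proof.
move=> /eqOP [M0 [_ HM]]; pose M := Num.max 1 (M0 + 1).
exists M; split; first by rewrite le_max lexx.
have /HM/near_pinfty_ex[X HX] : M0 < M by rewrite lt_max ltrDl ltr01 orbT.
by exists X => x /HX/pair_norm_le.
Qed.

Lemma eqo_pair (f g h : R -> R) (eta : R) : 0 < eta ->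
  (fun x => (f x, g x)) =o_pinfty h ->
  exists X, forall x, X < x -> `|f x| <= eta * `|h x| /\ `|g x| <= eta * `|h x|.
Proof.
move=> eta0 /eqoP/(_ _ eta0)/near_pinfty_ex[X HX].
by exists X => x /HX/pair_norm_le.
Qed.

(** The gap below c is returned as 2 * kappa with kappa at most 1/2, the form in
    which it enters the estimates of the planar system. *)
Lemma limf_esup_lt_eventually (f : R -> R) (c : R) :
  (limf_esup (fun x => (f x)%:E) (pinfty_nbhs R) < c%:E)%E ->
  exists kappa, [/\ 0 < kappa, 2 * kappa <= 1 &
    exists X, forall x, X < x -> f x <= c - 2 * kappa].
Proof.
move=> /ereal_inf_lt[_ [V [X [_ XV]] <-]] supV.
have fV x : X < x -> ((f x)%:E <= ereal_sup ((fun x => (f x)%:E) @` V))%E.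
  by move=> /XV Vx; apply: ereal_sup_ubound; exists x.
move: supV fV; case: (ereal_sup _) => [s||] //.
- rewrite lte_fin => sc fV; pose k := Num.min (1 / 2) ((c - s) / 2).
  have k1 : k <= 1 / 2 by rewrite ge_min lexx.
  have k2 : k <= (c - s) / 2 by rewrite ge_min lexx orbT.
  exists k; split; first by rewrite lt_min !divr_gt0// subr_gt0.
    by lra.
  by exists X => x /fV; rewrite lee_fin => ?; lra.
- move=> _ fV; exists (1 / 2); split; [by lra|by lra|].
  by exists X => x /fV; rewrite leeNy_eq.
Qed.

Lemma limf_einf_gt_eventually (f : R -> R) (c : R) :
  (c%:E < limf_einf (fun x => (f x)%:E) (pinfty_nbhs R))%E ->
  exists kappa, [/\ 0 < kappa, 2 * kappa <= 1 &
    exists X, forall x, X < x -> c + 2 * kappa <= f x].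
Proof.
rewrite /limf_einf lteNr -EFinN => H.
have [k [k0 k1 [X HX]]] := @limf_esup_lt_eventually (fun x => - f x) (- c) H.
by exists k; split => //; exists X => x /HX; lra.
Qed.

Lemma asymptotic_eventually (f g : R -> R) (k eta : R) : asymptotic f (fun x => k * g x) ->
  0 < eta -> exists X, {ae leb, forall x, X < x ->
    exists2 e, `|e| <= eta & f x = k * g x * (1 + e)}.
Proof.
move=> [e e0 [X1 H1]] eta0.
have [X2 H2] : ess_pinfty [set x | `|e x| <= eta].
  move/cvgrPdist_le : e0 => /(_ _ eta0).
  by apply: filterS => x /=; rewrite sub0r normrN.
exists (Num.max X1 X2); apply: ae_imply2 H1 H2 => x h1 h2.
by rewrite gt_max => /andP[/h1 ? /h2 ?]; exists (e x).
Qed.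

Lemma int_gt0 (a : R) (f : R -> R) x y : locally_integrable `]a, +oo[ f ->
  {ae leb, forall t, a < t -> 0 < f t} -> a < x -> x < y ->
  0 < \int[leb]_(t in `[x, y]) f t.
Proof.
move=> lf f0 ax xy; rewrite lt_neqAle; apply/andP; split; last first.
  rewrite (_ : 0 = \int[leb]_(t in `[x, y]) (0 : R)); last by rewrite int_cst ?mul0r// ltW.
  apply: (int_le (locally_integrable_cst a 0) lf) => //.
  by apply: ae_imply f0 => t ft /andP[xt _]; apply/ltW/ft; exact: lt_le_trans xt.
apply/eqP => I0.
have ifxy := locally_integrable_itv y lf ax.
have : \int[leb]_(t in `[x, y]) `|f t| = 0.
  rewrite I0; apply: (int_eq (locally_integrable_norm lf) lf) => //.
  by apply: ae_imply f0 => t ft /andP[xt _]; rewrite gtr0_norm// ft// (lt_le_trans ax).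
rewrite /Rintegral => /eqP; rewrite fine_eq0; last first.
  by apply: integrable_fin_num => //; exact: integrable_norm ifxy.
move=> /eqP A0.
have mI : measurable (`[x, y]%classic : set (measurableTypeR R)) by [].
have [z0' _] := ae_eq_integral_abs leb mI (measurable_int leb ifxy).
have z0 := z0' A0; have [N [mN N0 sub]] : {ae leb, forall t, ~ `[x, y]%classic t}.
  apply: ae_imply2 f0 z0 => t ft zt xyt; have := zt xyt => /= -[] ft0.
  have : a < t by move: xyt => /=; rewrite in_itv/= => /andP[xt _]; exact: lt_le_trans xt.
  by move=> /ft; rewrite ft0 ltxx.
have : (leb `[x, y] <= leb N)%E.
  apply: le_measure; rewrite ?inE//.
  by move=> t xyt; apply: sub => /=; exact.
by rewrite N0 lebesgue_measure_itv/= lte_fin xy -EFinB lee_fin subr_le0 leNgt xy.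
Qed.

End EventualBounds.

(** * Comparison of solutions of one equation *)

Section SameEquation.
Context {R : realType} (a : R) (P Q u pu v pv : R -> R).
Hypotheses
  (hu : ac_with_derivative a u (fun x => P x * pu x))
  (hpu : ac_with_derivative a pu (fun x => Q x * u x))
  (hv : ac_with_derivative a v (fun x => P x * pv x))
  (hpv : ac_with_derivative a pv (fun x => Q x * v x)).

(** The Wronskian of the two solutions is constant and equals the product of
    the radii times the sine of the angle difference.  If it does not vanish,
    the difference never is a multiple of pi; if it does, the difference is
    always one and so avoids pi / 2. *)
Lemma same_equation_bounded thu thv :
  prufer_angle a u pu thu -> prufer_angle a v pv thv ->
  exists X N, forall x, X < x -> `|thu x - thv x| <= N.
Proof.
move=> [cu [ru Hu]] [cv [rv Hv]].
pose h t := thu t - thv t.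
have ch t : a < t -> {for t, continuous h}.
  by move=> at_; apply: cvgB; [exact: cu|exact: cv].
have sh t : a < t -> u t * pv t - pu t * v t = ru t * rv t * sin (h t).
  move=> at_; have [_ -> ->] := Hu t at_; have [_ -> ->] := Hv t at_.
  by rewrite /h sinB; ring.
have [w hw] : exists w, forall t, a < t -> cos (h t - w) != 1.
  have a1 : a < a + 1 by rewrite ltrDl.
  have W := fun t at_ => wronskian_const hu hpu hv hpv (x := t) at_ a1.
  have [c0|c0] := eqVneq (u (a + 1) * pv (a + 1) - pu (a + 1) * v (a + 1)) 0.
    exists (pi / 2) => t at_; rewrite cosB cos_pihalf sin_pihalf mulr0 add0r mulr1.
    have [r0 _ _] := Hu t at_; have [r1 _ _] := Hv t at_.
    have := W t at_; rewrite c0 sh// => /eqP.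
    by rewrite mulf_eq0 gt_eqF ?mulr_gt0//= => /eqP ->; rewrite eq_sym oner_eq0.
  exists 0 => t at_; rewrite subr0; apply/eqP => c1.
  have s0 : sin (h t) = 0.
    have := cos2Dsin2 (h t); rewrite c1 expr1n -[RHS]addr0 => /addrI/eqP.
    by rewrite expf_eq0 => /eqP.
  by move: c0; rewrite -(W t at_) sh// s0 mulr0 eqxx.
exists (a + 1), (`|h (a + 1)| + pi *+ 2) => x x1.
rewrite -/(h x) -(subrK (h (a + 1)) (h x)) addrC.
apply: (le_trans (ler_normD _ _)); rewrite lerD2l.
apply: (avoid_residue_bounded (v := w)); first exact: ltW.
  by move=> t /andP[t1 _]; apply: ch; rewrite (lt_le_trans _ t1)// ltrDl.
by move=> t /andP[t1 _]; apply: hw; rewrite (lt_le_trans _ t1)// ltrDl.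
Qed.

End SameEquation.

(** Every v - k * u is a nontrivial solution, so the minimal solution u can be
    compared with it.  If its first component vanished identically, its second
    one would be a constant c, nonzero by the Wronskian, and the first one would
    grow with the rate c / p, where 1 / p is positive almost everywhere. *)
Lemma shifted_solution {R : realType} (a : R) p q r (E : R) u pu v pv (k : R) :
  coefficients a p q r -> solution a p q r E u pu -> solution a p q r E v pv ->
  (forall x, a < x -> u x * pv x - pu x * v x = 1) ->
  solution a p q r E (fun x => v x - k * u x) (fun x => pv x - k * pu x) /\
  nontrivial a (fun x => v x - k * u x).
Proof.
move=> C Su Sv W; have [hu hpu] := solution_ac C Su; have [hv hpv] := solution_ac C Sv.
have [lp _ _ pr0] := C.
have hw : ac_with_derivative a (fun x => v x - k * u x)
    (fun x => (p x)^-1 * (pv x - k * pu x)).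
  have := ac_sub hv (ac_scale k hu).
  by congr ac_with_derivative; apply/funext => x; ring.
have hpw : ac_with_derivative a (fun x => pv x - k * pu x)
    (fun x => (q x - E * r x) * (v x - k * u x)).
  have := ac_sub hpv (ac_scale k hpu).
  by congr ac_with_derivative; apply/funext => x; ring.
split; first exact: ac_solution.
apply: contrapT => triv.
have w0 x : a < x -> v x - k * u x = 0.
  by move=> ax; apply/eqP/negPn/negP => wx; apply: triv; exists x.
have W' x : a < x -> u x * (pv x - k * pu x) = 1.
  by move=> ax; rewrite -(W x ax) -{1}(subrK (k * u x) (v x)) w0//; ring.
have a1 : a < a + 1 by rewrite ltrDl.
have a2 : a + 1 < a + 2 by rewrite ltrD2l ltr1n.
have cst x : a < x -> pv x - k * pu x = pv (a + 1) - k * pu (a + 1).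
  move=> ax; apply: (ac_const (u := fun x => pv x - k * pu x) _ ax a1).
  apply: (ac_ae hpw); first exact: locally_integrable_cst.
  by apply: aeW => t at_; rewrite w0// mulr0.
set c := pv (a + 1) - _ in cst.
have c0 : c != 0.
  by apply/eqP => c0; have := W' _ a1; rewrite -/c c0 mulr0 => /eqP; rewrite eq_sym oner_eq0.
have p0 : {ae lebesgue_measure, forall t, a < t -> 0 < (p t)^-1}.
  by apply: ae_imply pr0 => t H /H[p0 _]; rewrite invr_gt0.
have := int_gt0 lp p0 a1 a2.
have hz : ac_with_derivative a (fun x => v x - k * u x) (fun x => c * (p x)^-1).
  apply: (ac_ae hw); first exact: locally_integrable_scale.
  by apply: aeW => t at_; rewrite cst// mulrC.
have [_ /(_ _ _ a1 (ltW a2))] := hz.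
have a2' := lt_trans a1 a2.
rewrite !w0// subrr (intZ lp)// => /eqP; rewrite eq_sym mulf_eq0 (negbTE c0)/=.
by move=> /eqP ->; rewrite ltxx.
Qed.

(** * The criterion *)

Theorem corollary2p9 (R : realType) (a : R) (p0 q0 p1 q1 r : R -> R)
    (gamma E : R) (u0 pu0 v0 pv0 alpha beta dbeta : R -> R) (mu nu : R) :
  standing_assumptions a p0 q0 r ->
  standing_assumptions a p1 q1 r ->
  admissible a p0 q0 r gamma E u0 pu0 v0 pv0 alpha beta dbeta ->
  asymptotic (fun x => q1 x - q0 x)
    (fun x => mu * (dbeta x / (alpha x ^+ 2 * beta x ^+ 2))) ->
  asymptotic (fun x => (p0 x)^-1 - (p1 x)^-1)
    (fun x => nu * (dbeta x / (alpha x ^+ 2 * beta x ^+ 2))) ->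
  let F := fun t => mu * (u0 t ^+ 2 / alpha t ^+ 2)
                    + nu * (pu0 t ^+ 2 / alpha t ^+ 2) in
  ((inf_limsup_average F < (- (1 / 4))%:E)%E ->
     relatively_oscillatory a p0 q0 p1 q1 r E) /\
  (((- (1 / 4))%:E < sup_liminf_average F)%E ->
     relatively_nonoscillatory a p0 q0 p1 q1 r E).
Proof.
move=> [C0 reg0 _] [C1 reg1 _] adm Dq Dp F.
have [_ [S0 nt0 minimal] Sv W malpha alpha0 beta_sign hbeta O1 o1 rho0 rho1 rhoav] := adm.
have [hu0 hpu0] := solution_ac C0 S0; have [hv0 hpv0] := solution_ac C0 Sv.
have beta0 x : a < x -> beta x != 0.
  by move=> ax; case: beta_sign => H; [rewrite gt_eqF// H|rewrite lt_eqF// H].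
have [M [M1 [X1 HX1]]] := eqO_pair O1.
have u0O : exists X, forall x, X < x -> `|u0 x| <= M * alpha x /\ `|pu0 x| <= M * alpha x.
  exists (Num.max a X1) => x; rewrite gt_max => /andP[ax /HX1].
  by rewrite (gtr0_norm (alpha0 x ax)).
have wo eta : 0 < eta -> exists X, forall x, X < x ->
    `|v0 x - beta x * u0 x| <= eta * (alpha x * `|beta x|) /\
    `|pv0 x - beta x * pu0 x| <= eta * (alpha x * `|beta x|).
  move=> eta0; have [X HX] := eqo_pair eta0 o1.
  exists (Num.max a X) => x; rewrite gt_max => /andP[ax /HX].
  by rewrite normrM (gtr0_norm (alpha0 x ax)).
have rho_small eta : 0 < eta ->
    exists X, {ae lebesgue_measure, forall x, X < x -> dbeta x / beta x <= eta}.
  move=> eta0; have [X HX] : ess_pinfty [set x | dbeta x / beta x <= eta].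
    move/cvgrPdist_le : rho1 => /(_ _ eta0); apply: filterS => x /=.
    by rewrite sub0r normrN; apply: le_trans; exact: ler_norm.
  by exists X.
have rho_avg l eta : 0 < l -> 0 < eta ->
    exists X, {ae lebesgue_measure, forall x, X < x ->
      l^-1 * \int[lebesgue_measure]_(t in `[0, l])
        `|dbeta (x + t) / beta (x + t) - dbeta x / beta x| <= eta * (dbeta x / beta x)}.
  move=> l0 eta0; have /eqoP/(_ _ eta0)[X HX] := rhoav l l0.
  exists (Num.max a X); apply: ae_imply2 rho0 HX => x r0 HX.
  rewrite gt_max => /andP[ax /HX]; rewrite (gtr0_norm (r0 ax)).
  by apply: le_trans; exact: ler_norm.
have Dq' eta : 0 < eta -> exists X, {ae lebesgue_measure, forall x, X < x ->
    exists2 e, `|e| <= eta & (q1 x - E * r x) - (q0 x - E * r x)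
      = mu * (dbeta x / (alpha x ^+ 2 * beta x ^+ 2)) * (1 + e)}.
  move=> /(asymptotic_eventually Dq)[X HX]; exists X.
  apply: ae_imply HX => x H /H[e e1 He]; exists e => //.
  by rewrite -[RHS]He; ring.
have Dp' eta := @asymptotic_eventually R _ _ _ eta Dp.
have pair_neq0 u pu th x : prufer_angle a u pu th -> a < x -> 0 < u x ^+ 2 + pu x ^+ 2.
  move=> [_ [rad Hrad]] ax; have [r0 -> ->] := Hrad x ax.
  by rewrite !exprMn -mulrDr addrC cos2Dsin2 mulr1 exprn_gt0.
(* The angle of the minimal solution: in both parts the winding of y is
   measured against it. *)
have [th angle0] : exists th, prufer_angle a u0 pu0 th.
  apply: (solution_angle C0 S0) => x ax.
  rewrite lt0r addr_ge0 ?sqr_ge0// andbT paddr_eq0 ?sqr_ge0// !expf_eq0/=.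
  apply/negP => /andP[/eqP ux /eqP pux]; have := W x ax.
  by rewrite ux pux !mul0r subr0 => /eqP; rewrite eq_sym oner_eq0.
split.
- move=> /ereal_inf_lt[_ [l l0 <-]] /limf_esup_lt_eventually[kappa [k0 k1 avg]].
  have [y [py [S1 nt1 y0]]] := solution_exists E C1.
  have [th1 angle1] := solution_angle C1 S1 y0.
  have [hy hpy] := solution_ac C1 S1.
  exists u0, pu0, th, y, py, th1; split => //.
  apply: unbounded_difference_not_fin_num.
  apply: (unbounded_difference hu0 hpu0 hv0 hpv0 hy hpy W y0 malpha alpha0 beta0 hbeta M1
    u0O wo rho0 rho_small rho_avg Dq' Dp' l0 k0 k1 angle0 angle1 beta_sign _ avg).
  move=> k; have [Sw ntw] := shifted_solution k C0 S0 Sv W.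
  have [C [_ [X HX]]] := eqO_pair (minimal _ _ Sw ntw).
  by exists C, X => x /HX; rewrite prod_normE.
- move=> /ereal_sup_gt[_ [l l0 <-]] /limf_einf_gt_eventually[kappa [k0 k1 avg]].
  move=> w pw th0 y py th1 [Sw _ anglew] [S1 _ angle1].
  have [hy hpy] := solution_ac C1 S1; have [hw hpw] := solution_ac C0 Sw.
  have y0 x ax := @pair_neq0 y py th1 x angle1 ax.
  have [X2 [N2 H2]] := trapped_difference hu0 hpu0 hv0 hpv0 hy hpy W y0 malpha alpha0 beta0
    hbeta M1 u0O wo rho0 rho_small rho_avg Dq' Dp' l0 k0 k1 angle0 angle1 avg.
  have [X3 [N3 H3]] := same_equation_bounded hu0 hpu0 hw hpw angle0 anglew.
  have [c0 ac0 [N4 H4]] := prufer_bounded_left C0 reg0 Sw anglew.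
  have [c1 ac1 [N5 H5]] := prufer_bounded_left C1 reg1 S1 angle1.
  apply: (@bounded_difference_fin_num _ a th0 th1 (Num.max (N2 + N3) (N4 + N5))
    (Num.min c0 c1) (Num.max X2 X3)).
  + by rewrite lt_min ac0.
  + move=> x ax; rewrite le_min => /andP[xc0 xc1]; rewrite le_max; apply/orP; right.
    by apply: (le_trans (ler_normB _ _)); rewrite addrC lerD ?H4 ?H5.
  + move=> x; rewrite gt_max => /andP[/H2 x2 /H3 x3]; rewrite le_max; apply/orP; left.
    rewrite (_ : th1 x - th0 x = (th1 x - th x) + (th x - th0 x)); last by ring.
    by apply: (le_trans (ler_normD _ _)); exact: lerD.
Qed.
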